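(* Let $(B,\|\cdot\|)$ be a separable Banach space. The following five statements are equivalent: (i) $B$ is cotype 2. (ii) There is a constant $c\in(0,\infty)$ such that for all $X\in L$ and all $r>0$, $$ET_r\le \frac{c}{h(r)}.$$ (iii) There is a constant $c\in(0,\infty)$ such that for all $X\in L$, all $r>0$ and all integers $n\ge 1$, $$P(T_r> n)\le \frac{c}{n\,h(r)}.$$ (iv) There is a constant $c\in(0,\infty)$ such that for all $X\in L^2_0$, $$\limsup_{r\to\infty}\frac{ET_r}{r^2}\le \frac{c}{E\|X\|^2}.$$ (v) There is a constant $c\in(0,\infty)$ such that for all $X\in L^2_0$, $$\limsup_{r\to\infty}\,\sup_{n\ge 1}\frac{nP(T_r> n)}{r^2}\le \frac{c}{E\|X\|^2}.$$ Moreover, the constants appearing in these statements may be taken to depend only on each other.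
   Context: $L$ denotes the collection of non-degenerate (i.e. not almost surely constant) $B$-valued random variables, $L^2=\{X\in L:E\|X\|^2<\infty\}$ and $L^2_0=\{X\in L^2:EX=0\}$. For $X\in L$ let $X_1,X_2,\dots$ be independent copies of $X$, $S_n=\sum_{j=1}^n X_j$, and for $r>0$ let $T_r=\min\{n\ge 1:\|S_n\|>r\}$. Write $E(Y;A)=E(Y\mathbf 1_A)$ (Bochner expectation when $Y$ is $B$-valued). For $r>0$ define $$G(r)=P(\|X\|>r),\quad K(r)=r^{-2}E(\|X\|^2;\|X\|\le r),\quad M(r)=r^{-1}E(X;\|X\|\le r),$$ $$h(r)=G(r)+K(r)+\|M(r)\|.$$ Both $T_r$ and $h$ depend on (the distribution of) $X$; the constants $c$ in the statements do not depend on $X$, $r$ or $n$. $B$ is cotype 2 if there is a constant $c\in(0,\infty)$ such that for every $n\ge1$ and every sequence of independent $B$-valued random variables $X_1,\dots,X_n$ with $EX_i=0$ and $E\|X_i\|^2<\infty$ for $1\le i\le n$, $$E\Big\|\sum_{i=1}^n X_i\Big\|^2\ge c\sum_{i=1}^n E\|X_i\|^2;$$ any such $c$ is called a cotype 2 constant for $B$, and it is the constant associated with the statement ''$B$ is cotype 2''. ''The constants may be taken to depend only on each other'' means: if one of the statements holds with constant $c$, then each other statement holds with a constant that is determined by $c$ alone. *)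

(* Defs.v *)
From HB Require Import structures.
From mathcomp Require Import all_boot all_order all_algebra.
From mathcomp Require Import all_classical all_reals all_analysis.
Set Implicit Arguments.
Unset Strict Implicit.
Unset Printing Implicit Defensive.
Import Order.TTheory GRing.Theory Num.Theory.
Import numFieldNormedType.Exports.
Local Open Scope classical_set_scope.
Local Open Scope ring_scope.

Definition separable_space (T : topologicalType) : Prop :=
  exists2 D : set T, countable D & dense D.

Section RandomVariables.
Context {R : realType} {B : completeNormedModType R}.

Definition borelType := g_sigma_algebraType (@open B).
Definition borel (A : set B) : Prop := measurable (A : set borelType).

Definition random_var d (T : measurableType d) (X : T -> B) : Prop :=
  measurable_fun [set: T] (X : T -> borelType).

Definition simple_var d (T : measurableType d) (s : T -> B) : Prop :=
  random_var s /\ finite_set (range s).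

Definition simple_expectation d (T : measurableType d) (P : probability T R)
    (s : T -> B) : B :=
  \sum_(y \in range s) fine (P (s @^-1` [set y])) *: y.

Definition has_expectation d (T : measurableType d) (P : probability T R)
    (Y : T -> B) (m : B) : Prop :=
  random_var Y /\
  exists s : nat -> T -> B,
    [/\ forall k, simple_var (s k),
        (fun k => \int[P]_w (`|Y w - s k w|)%:E)%E @ \oo --> 0%E
      & (fun k => simple_expectation P (s k)) @ \oo --> m].

(* Bochner expectation; the value is unspecified when Y is not Bochner
   integrable. *)
Definition bochner_expectation d (T : measurableType d) (P : probability T R)
    (Y : T -> B) : B := get [set m | has_expectation P Y m].

Definition non_as_constant d (T : measurableType d) (P : probability T R)
    (X : T -> B) : Prop :=
  ~ exists b : B, {ae P, forall w, X w = b}.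

Definition in_L d (T : measurableType d) (P : probability T R)
    (X : T -> B) : Prop := random_var X /\ non_as_constant P X.

Definition second_moment d (T : measurableType d) (P : probability T R)
    (X : T -> B) : \bar R := 'E_P[fun w => (`|X w| ^+ 2)%R]%E.

Definition in_L2_0 d (T : measurableType d) (P : probability T R)
    (X : T -> B) : Prop :=
  [/\ in_L P X, (second_moment P X < +oo)%E & bochner_expectation P X = 0].

Definition independent_vars (I : eqType) d (T : measurableType d)
    (P : probability T R) (X : I -> T -> B) : Prop :=
  forall (J : seq I) (A : I -> set B), uniq J -> (forall i, borel (A i)) ->
    P (\bigcap_(i in [set` J]) X i @^-1` A i) =
    (\prod_(i <- J) P (X i @^-1` A i))%E.

(* The copies may live on another probability space than X, so that X itself
   may be defined on a space too small to carry an infinite i.i.d. sequence. *)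
Definition independent_copies d (T : measurableType d) (P : probability T R)
    (X : T -> B) d' (T' : measurableType d') (P' : probability T' R)
    (Xs : nat -> T' -> B) : Prop :=
  [/\ forall j, random_var (Xs j), independent_vars P' Xs
    & forall j A, borel A -> P' (Xs j @^-1` A) = P (X @^-1` A)].

(* The copies X_1, X_2, ... are numbered from 0: Xs j is X_(j+1). *)
Definition partial_sum (T : Type) (Xs : nat -> T -> B) (n : nat) (w : T) : B :=
  \sum_(j < n) Xs j w.

(* +oo when the partial sums never leave the ball of radius r. *)
Definition exit_time (T : Type) (Xs : nat -> T -> B) (r : R) (w : T) : \bar R :=
  ereal_inf [set (n%:R)%:E | n in
    [set n : nat | (1 <= n)%N /\ r < `|partial_sum Xs n w|]].

Definition G_fun d (T : measurableType d) (P : probability T R)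
    (X : T -> B) (r : R) : R := fine (P [set w | r < `|X w|]).

Definition K_fun d (T : measurableType d) (P : probability T R)
    (X : T -> B) (r : R) : R :=
  r ^- 2 * fine 'E_P[fun w => (`|X w| ^+ 2 * \1_[set w | `|X w| <= r] w)%R]%E.

Definition M_fun d (T : measurableType d) (P : probability T R)
    (X : T -> B) (r : R) : B :=
  r^-1 *: bochner_expectation P (fun w => \1_[set w | `|X w| <= r] w *: X w).

Definition h_fun d (T : measurableType d) (P : probability T R)
    (X : T -> B) (r : R) : R := G_fun P X r + K_fun P X r + `|M_fun P X r|.

End RandomVariables.

Section Statements.
Context {R : realType}.
Implicit Types (B : completeNormedModType R) (c : R).

Definition cotype2_with B c : Prop :=
  forall (n : nat) d (T : measurableType d) (P : probability T R)
    (X : 'I_n -> T -> B), (1 <= n)%N ->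
    (forall i, random_var (X i)) -> independent_vars P X ->
    (forall i, bochner_expectation P (X i) = 0) ->
    (forall i, second_moment P (X i) < +oo)%E ->
    (c%:E * \sum_(i < n) second_moment P (X i) <=
     second_moment P (fun w => (\sum_(i < n) X i w)%R))%E.

Definition mean_exit_bound B c : Prop :=
  forall d (T : measurableType d) (P : probability T R) (X : T -> B),
    in_L P X ->
  forall d' (T' : measurableType d') (P' : probability T' R)
    (Xs : nat -> T' -> B), independent_copies P X P' Xs ->
  forall r : R, 0 < r ->
    (\int[P']_w exit_time Xs r w <= (c / h_fun P X r)%:E)%E.

Definition tail_exit_bound B c : Prop :=
  forall d (T : measurableType d) (P : probability T R) (X : T -> B),
    in_L P X ->
  forall d' (T' : measurableType d') (P' : probability T' R)
    (Xs : nat -> T' -> B), independent_copies P X P' Xs ->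
  forall (r : R) (n : nat), 0 < r -> (1 <= n)%N ->
    (P' [set w | (n%:R)%:E < exit_time Xs r w] <=
     (c / (n%:R * h_fun P X r))%:E)%E.

Definition mean_exit_limsup_bound B c : Prop :=
  forall d (T : measurableType d) (P : probability T R) (X : T -> B),
    in_L2_0 P X ->
  forall d' (T' : measurableType d') (P' : probability T' R)
    (Xs : nat -> T' -> B), independent_copies P X P' Xs ->
    (limf_esup (fun r : R => (r ^- 2)%:E * \int[P']_w exit_time Xs r w)
       (pinfty_nbhs R) <= (c / fine (second_moment P X))%:E)%E.

Definition tail_exit_limsup_bound B c : Prop :=
  forall d (T : measurableType d) (P : probability T R) (X : T -> B),
    in_L2_0 P X ->
  forall d' (T' : measurableType d') (P' : probability T' R)
    (Xs : nat -> T' -> B), independent_copies P X P' Xs ->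
    (limf_esup (fun r : R =>
         ereal_sup [set (n%:R / r ^+ 2)%:E *
                        P' [set w | (n%:R)%:E < exit_time Xs r w]
                   | n in [set n : nat | (1 <= n)%N]])
       (pinfty_nbhs R) <= (c / fine (second_moment P X))%:E)%E.

Definition cotype2 B : Prop := exists2 c : R, 0 < c & cotype2_with B c.

Inductive assertion := Cotype2 | MeanExit | TailExit | MeanExitLimsup | TailExitLimsup.

Definition holds_with (s : assertion) B c : Prop :=
  match s with
  | Cotype2 => cotype2_with B c
  | MeanExit => mean_exit_bound B c
  | TailExit => tail_exit_bound B c
  | MeanExitLimsup => mean_exit_limsup_bound B c
  | TailExitLimsup => tail_exit_limsup_bound B c
  end.

End Statements.

(* Main.v *)
(* (i) => (ii). If S_1, ..., S_n stay in a ball of radius 8r with probability at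
   least 7/8, then with probability at least 3/4 so does the walk with steps
   truncated at 16r, in a ball of radius 16r; decomposing at its exit time gives
   E|S_k|^2 = O(r^2) for k <= n, and cotype 2 applied to the centered truncated
   steps yields n h(r) = O(1). Hence for N ~ C/h(r) the probability of staying
   in the ball of radius 8r for N steps is below 7/8, and the Markov property
   makes it decay geometrically, so that E T_r <= 8N.

   (ii) => (iii) and (iv) => (v) are Markov's inequality; (ii) => (iv) and
   (iii) => (v) follow from r^2 h(r) >= E(|X|^2; |X| <= r) -> E|X|^2.

   (v) => (i). For X uniform on a finite centered list, Doob's inequality at
   r^2 = 2mL turns (v) into E|X|^2 <= 4cL as soon as E|S_m|^2 <= mL for large m.
   Apply this to X = sum_i z_i x_i with i.i.d. symmetric coefficients z_i in
   {-1, 0, 1}: coefficients that vanish with high probability give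
   sum_i |x_i|^2 <= C G, where G is the supremum of the normalized second moments
   of sum_i z_i x_i over sums z_i of such coefficients. The same inequality
   applied to the indicators of |z_i| >= s for s large, together with
   fourth-moment bounds, shows that the large values of z_i contribute at most
   G/2, while the small ones reduce to Rademacher sums by convexity; so G is at
   most a multiple of E|sum_i eps_i x_i|^2. Symmetrization extends the resulting
   inequality to independent centered finitely valued variables, and
   approximation to all of L^2. *)

Require Import Defs.
From mathcomp Require Import all_boot all_order all_algebra.
From mathcomp Require Import all_classical all_reals all_analysis.
From mathcomp Require Import ring lra zify measurable_realfun.
Import Order.TTheory GRing.Theory Num.Theory.
Import numFieldNormedType.Exports.
Local Open Scope classical_set_scope.
Local Open Scope ring_scope.
Set Implicit Arguments.
Unset Strict Implicit.
Unset Printing Implicit Defensive.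

(** The Markov property, Doob's inequality and the decomposition at the exit time are proved for
    laws of finite support, where expectations are finite sums. General variables are replaced by
    their nearest points among finitely many terms of a dense sequence. This acts on each variable
    separately, so independence and equality of laws survive, and the nearest point of x has norm at
    most 2|x|, which provides domination in the limit. Only continuous functionals of the path pass
    to that limit; hence indicators of balls give way to [cutoff], which lies between the indicators
    of radii r and 2 r, and this costs factors of 2 in the radii. In (v) => (i), G takes the place
    of a gaussian second moment, but no gaussian law is constructed. Being a supremum over all
    normalized sums, G bounds E|S_m|^2 / m, up to the variance of the coefficients, for every
    admissible choice of coefficients and all large m. So the one hypothesis can be used twice: with
    rare signs, and with the layers of sums of coefficients. *)

(** * Random walks with finitely supported steps *)

Section FiniteLaws.
Context {R : realType} {B : normedModType R}.
Implicit Types (mu : seq (R * B)) (f g : B -> R) (y u v : B) (n : nat).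

(* A finitely supported law is a list of (weight, atom) pairs; [conv mu f y]
   is E f(y + X) for X of law [mu]. *)
Definition conv mu f y : R := \sum_(a <- mu) a.1 * f (y + a.2).

Definition law mu := (forall a, a \in mu -> 0 <= a.1) /\ \sum_(a <- mu) a.1 = 1.

Definition mean mu : B := \sum_(a <- mu) a.1 *: a.2.

Definition sq y : R := `|y| ^+ 2.

Lemma eq_conv mu f g : f =1 g -> conv mu f =1 conv mu g.
Proof. by move=> fg y; apply: eq_bigr => a _; rewrite fg. Qed.

Lemma conv_cst mu (c : R) y : law mu -> conv mu (fun=> c) y = c.
Proof. by case=> _ m1; rewrite /conv -mulr_suml m1 mul1r. Qed.

Lemma convD mu f g y :
  conv mu (fun u => f u + g u) y = conv mu f y + conv mu g y.
Proof. by rewrite /conv -big_split; apply: eq_bigr => a _; rewrite mulrDr. Qed.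

Lemma convZ mu (c : R) f y : conv mu (fun u => c * f u) y = c * conv mu f y.
Proof. by rewrite /conv mulr_sumr; apply: eq_bigr => a _; rewrite mulrCA. Qed.

Lemma le_conv mu f g y z : (forall a, a \in mu -> 0 <= a.1) ->
  (forall a, a \in mu -> f (y + a.2) <= g (z + a.2)) ->
  conv mu f y <= conv mu g z.
Proof.
move=> m0 fg; rewrite /conv !big_seq; apply: ler_sum => a am.
by apply: ler_wpM2l; [exact: m0|exact: fg].
Qed.

Lemma conv_ge0 mu f y : law mu -> (forall u, 0 <= f u) -> 0 <= conv mu f y.
Proof.
move=> [m0 _] f0; rewrite /conv big_seq; apply: sumr_ge0 => a am.
by rewrite mulr_ge0 ?m0.
Qed.

Lemma convC mu nu f y : conv mu (conv nu f) y = conv nu (conv mu f) y.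
Proof.
rewrite /conv; under eq_bigr => a _ do rewrite mulr_sumr.
rewrite exchange_big/=; apply: eq_bigr => b _; rewrite mulr_sumr.
by apply: eq_bigr => a _; rewrite mulrCA addrAC.
Qed.

Lemma sq_ge0 y : 0 <= sq y. Proof. exact: exprn_ge0. Qed.
Hint Resolve sq_ge0 : core.

Lemma sqD_le u v : sq (u + v) <= 2 * sq u + 2 * sq v.
Proof.
have h : sq (u + v) <= (`|u| + `|v|) ^+ 2.
  by rewrite /sq ler_sqr ?nnegrE ?addr_ge0// ler_normD.
apply: (le_trans h).
have := sqr_ge0 (`|u| - `|v|); rewrite /sq; nra.
Qed.

Lemma sqZ (c : R) y : sq (c *: y) = c ^+ 2 * sq y.
Proof. by rewrite /sq normrZ exprMn real_normK ?num_real. Qed.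

Lemma sqN y : sq (- y) = sq y. Proof. by rewrite /sq normrN. Qed.

(** Cauchy-Schwarz for the splitting |z_i| = l_i^(1/2) * l_i^(-1/2) |z_i|. In the induction the
    cross term is the geometric mean of p and q, bounded by the arithmetic one. *)
Lemma sq_sum_le (I : Type) (r : seq I) (l : I -> R) (z : I -> B) :
  (forall i, 0 < l i) ->
  sq (\sum_(i <- r) z i) <=
    (\sum_(i <- r) l i) * \sum_(i <- r) (l i)^-1 * sq (z i).
Proof.
move=> l0; elim: r => [|i r IH]; first by rewrite !big_nil /sq normr0 expr0n mul0r.
rewrite !big_cons.
set u := z i; set v := \sum_(j <- r) z j.
set L := \sum_(j <- r) l j in IH *.
set T := \sum_(j <- r) (l j)^-1 * sq (z j) in IH *.
have L0 : 0 <= L by apply: sumr_ge0 => j _; exact: ltW.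
have T0 : 0 <= T.
  by apply: sumr_ge0 => j _; rewrite mulr_ge0// invr_ge0 ltW.
have li := l0 i; set a := l i in li *.
have h1 : `|u + v| <= `|u| + `|v| by exact: ler_normD.
have h2 : sq (u + v) <= (`|u| + `|v|) ^+ 2.
  by rewrite /sq ler_sqr ?nnegrE ?addr_ge0.
apply: (le_trans h2); rewrite sqrrD.
rewrite mulrDl !mulrDr -/(sq u) -/(sq v) mulrA divff ?gt_eqF// mul1r.
set s := `|u| * `|v|.
suff : s *+ 2 <= a * T + L * (a^-1 * sq u) by move: IH; lra.
have h3 : s ^+ 2 <= (L * T) * sq u.
  by rewrite /s exprMn mulrC -/(sq u) -/(sq v) ler_wpM2r.
have s0 : 0 <= s by rewrite mulr_ge0.
set p := a * T; set q := L * (a^-1 * sq u).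
have p0 : 0 <= p by rewrite mulr_ge0 // ltW.
have q0 : 0 <= q by rewrite !mulr_ge0 // invr_ge0 ltW.
have pq : p * q = (L * T) * sq u.
  rewrite /p /q; have : a * a^-1 = 1 by rewrite divff ?gt_eqF.
  move=> e; transitivity ((a * a^-1) * (L * T) * sq u); first by ring.
  by rewrite e mul1r.
rewrite -(@ler_pXn2r _ 2) ?nnegrE ?mulrn_wge0 ?addr_ge0//.
rewrite -mulr_natl exprMn; have := sqr_ge0 (p - q).
by move: h3; rewrite -pq; nra.
Qed.

Lemma jensen_sq mu y : law mu -> sq (y + mean mu) <= conv mu sq y.
Proof.
move=> [m0 m1].
have -> : y + mean mu = \sum_(a <- mu) a.1 *: (y + a.2).
  rewrite /mean; under [RHS]eq_bigr => a _ do rewrite scalerDr.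
  by rewrite big_split /= -scaler_suml m1 scale1r.
(* A sublist of weights no longer sums to 1, so the induction carries the total weight as a
   factor. *)
have H : forall s : seq (R * B), (forall a, a \in s -> 0 <= a.1) ->
    sq (\sum_(a <- s) a.1 *: (y + a.2)) <=
    (\sum_(a <- s) a.1) * \sum_(a <- s) a.1 * sq (y + a.2).
  elim=> [|a s IH] s0; first by rewrite !big_nil /sq normr0 expr0n mul0r.
  have {}IH := IH (fun b bs => s0 b (mem_behead (s := a :: s) bs)).
  have a0 : 0 <= a.1 by apply: s0; rewrite mem_head.
  have L0 : 0 <= \sum_(b <- s) b.1.
    by rewrite big_seq; apply: sumr_ge0 => b bs; apply: s0; rewrite inE bs orbT.
  have T0 : 0 <= \sum_(b <- s) b.1 * sq (y + b.2).
    rewrite big_seq; apply: sumr_ge0 => b bs.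
    by rewrite mulr_ge0// s0// inE bs orbT.
  rewrite !big_cons.
  set u := y + a.2; set v := \sum_(b <- s) b.1 *: _ in IH *.
  set L := \sum_(b <- s) b.1 in IH L0 *.
  set T := \sum_(b <- s) b.1 * _ in IH T0 *.
  have h2 : sq (a.1 *: u + v) <= (a.1 * `|u| + `|v|) ^+ 2.
    rewrite /sq ler_sqr ?nnegrE ?addr_ge0 ?mulr_ge0//.
    by rewrite (le_trans (ler_normD _ _))// normrZ ger0_norm.
  apply: (le_trans h2).
  set c := a.1 in a0 *; have u0 := normr_ge0 u; have v0 := normr_ge0 v.
  have h3 : `|v| ^+ 2 <= L * T by exact: IH.
  have h4 : 2 * (`|u| * `|v|) <= T + L * sq u.
    have h5 : (`|u| * `|v|) ^+ 2 <= (L * T) * sq u.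
      by rewrite exprMn mulrC ler_wpM2r.
    rewrite -(@ler_pXn2r _ 2) ?nnegrE ?mulr_ge0 ?addr_ge0 ?mulr_ge0// exprMn.
    have := sqr_ge0 (T - L * sq u); move: h5.
    by rewrite -(natrX _ 2 2); nra.
  have h6 : c * (2 * (`|u| * `|v|)) <= c * (T + L * sq u) by rewrite ler_wpM2l.
  rewrite -/(sq u) in h6 *; rewrite /sq in h6 *.
  move: h3 h6; nra.
by have := H mu m0; rewrite m1 mul1r.
Qed.

Lemma jensen_sq0 mu y : law mu -> mean mu = 0 -> sq y <= conv mu sq y.
Proof. by move=> lm m0; have := jensen_sq y lm; rewrite m0 addr0. Qed.

Lemma iter_conv_ge0 mu f n y : law mu -> (forall u, 0 <= f u) ->
  0 <= iter n (conv mu) f y.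
Proof. by move=> lm f0; elim: n y => // n IH y; apply: conv_ge0. Qed.

Lemma iter_conv_sqD mu n u v : law mu ->
  iter n (conv mu) sq (u + v) <= 2 * sq u + 2 * iter n (conv mu) sq v.
Proof.
move=> lm; elim: n v => [|n IH] v; first exact: sqD_le.
rewrite [iter n.+1 _ _ (u + v)]/=.
have -> : 2 * sq u + 2 * iter n.+1 (conv mu) sq v =
    conv mu (fun z => 2 * sq u + 2 * iter n (conv mu) sq z) v.
  by rewrite convD conv_cst // convZ.
by apply: le_conv => [|a _]; [case: lm|rewrite -addrA IH].
Qed.

Lemma iter_conv_mean mu n y : law mu ->
  sq (y + mean mu *+ n) <= iter n (conv mu) sq y.
Proof.
move=> lm; elim: n y => [|n IH] y; first by rewrite mulr0n addr0.
rewrite iterS mulrSr addrA (le_trans (jensen_sq _ lm))//.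
by apply: le_conv => [|a _]; [case: lm|rewrite addrAC IH].
Qed.

(* E (chi(y + S_1) ... chi(y + S_n) f(y + S_n)) for the random walk of law mu *)
Fixpoint path_mean (chi f : B -> R) mu n y : R :=
  if n is n'.+1 then conv mu (fun u => chi u * path_mean chi f mu n' u) y
  else f y.

Lemma path_mean1 f mu n y : path_mean (fun=> 1) f mu n y = iter n (conv mu) f y.
Proof.
elim: n y => //= n IH y; apply: eq_conv => u; by rewrite mul1r IH.
Qed.

Lemma path_mean_ge0 chi f mu n y : law mu ->
  (forall u, 0 <= chi u) -> (forall u, 0 <= f u) ->
  0 <= path_mean chi f mu n y.
Proof.
move=> lm c0 f0; elim: n y => //= n IH y.
by apply: conv_ge0 => // u; rewrite mulr_ge0.
Qed.

Lemma path_meanD chi f mu n m y :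
  path_mean chi f mu (n + m) y = path_mean chi (path_mean chi f mu m) mu n y.
Proof. by elim: n y => //= n IH y; apply: eq_conv => u; rewrite IH. Qed.

(** On a path of nonzero weight every position lies in C, since [chi] vanishes elsewhere; so f is at
    most K at its end. The assumption on y covers n = 0. *)
Lemma path_mean_le_cst chi f mu n y (C : B -> Prop) (K : R) : law mu ->
  (forall u, 0 <= chi u) -> (forall u, chi u != 0 -> C u) -> C y ->
  (forall u, C u -> f u <= K) ->
  path_mean chi f mu n y <= K * path_mean chi (fun=> 1) mu n y.
Proof.
move=> lm c0 cC + fK; elim: n y => [|n IH] y Cy /=; first by rewrite mulr1 fK.
rewrite -convZ; apply: le_conv => [|a am]; first by case: lm.
rewrite mulrCA; have [->|cn] := eqVneq (chi (y + a.2)) 0; first by rewrite !mul0r.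
by rewrite ler_wpM2l// IH//; exact: cC.
Qed.

Definition cutoff (r : R) y : R := Num.min 1 (Num.max 0 (2 - `|y| / r)).

Lemma cutoff_ge0 r y : 0 <= cutoff r y.
Proof. by rewrite le_min ler01 le_max lexx. Qed.

Lemma cutoff_le1 r y : cutoff r y <= 1.
Proof. by rewrite ge_min lexx. Qed.

Lemma cutoff1 r y : 0 < r -> `|y| <= r -> cutoff r y = 1.
Proof.
move=> r0 yr; rewrite /cutoff; apply: min_l; rewrite le_max; apply/orP; right.
by rewrite lerBrDr -lerBrDl (_ : 2 - 1 = 1 :> R) ?ler_pdivrMr ?mul1r//; lra.
Qed.

Lemma cutoff0 r y : 0 < r -> 2 * r <= `|y| -> cutoff r y = 0.
Proof.
move=> r0 yr; rewrite /cutoff max_l ?min_r//.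
by rewrite subr_le0 ler_pdivlMr.
Qed.

(** A surviving walk is within 2 r of 0 at time n. Translating its continuation to start at 0 moves
    every position by at most 2 r, hence from the ball of radius 2 r into that of radius 4 r, where
    [cutoff (4 * r)] is 1. *)
Lemma path_mean_cutoffM mu n m (r : R) : law mu -> 0 < r ->
  path_mean (cutoff r) (fun=> 1) mu (n + m) 0 <=
  path_mean (cutoff r) (fun=> 1) mu n 0 *
  path_mean (cutoff (4 * r)) (fun=> 1) mu m 0.
Proof.
move=> lm r0; rewrite path_meanD mulrC.
apply: (@path_mean_le_cst _ _ _ _ _ (fun u => `|u| <= 2 * r)) => //.
- exact: cutoff_ge0.
- by move=> u; apply: contra_neqT; rewrite -ltNge => /ltW; exact: cutoff0.
- by rewrite normr0 mulr_ge0// ltW.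
(* Two walks with the same steps keep their initial distance, which carries the induction. *)
move=> u; rewrite -{1}[u]subr0; move: u 0 => u v.
elim: m u v => //= m IH u v uv; apply: le_conv => [|a am]; first by case: lm.
have uva : `|u + a.2 - (v + a.2)| <= 2 * r by rewrite opprD addrACA subrr addr0.
have h := IH _ _ uva.
have h0 z k : 0 <= path_mean (cutoff k) (fun=> 1) mu m z.
  by apply: path_mean_ge0 => // ?; exact: cutoff_ge0.
have [ur|ur] := leP (2 * r) `|u + a.2|.
  by rewrite cutoff0// mul0r mulr_ge0// cutoff_ge0.
apply: ler_pM => //; first exact: cutoff_ge0.
rewrite (le_trans (cutoff_le1 _ _))// cutoff1//; first by rewrite mulr_gt0.
by have := ler_normB (u + a.2) (u + a.2 - (v + a.2)); rewrite subKr; lra.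
Qed.

Definition stay (r : R) := path_mean (fun u => (`|u| <= r)%R%:R) (fun=> 1).

Lemma stay_le1 r mu n y : law mu -> stay r mu n y <= 1.
Proof.
move=> lm; elim: n y => //= n IH y.
rewrite -[leRHS](conv_cst 1 y lm); apply: le_conv => [|a am]; first by case: lm.
by case: (_ <= r); rewrite ?mul1r ?mul0r// IH.
Qed.

Lemma stay_anti r mu n y : law mu -> stay r mu n.+1 y <= stay r mu n y.
Proof.
move=> lm; elim: n y => [|n IH] y; first exact: stay_le1.
apply: le_conv => [|a am]; first by case: lm.
by case: (_ <= r); rewrite ?mul1r ?mul0r// IH.
Qed.

Lemma one_sub_conv_stay r mu n y : law mu ->
  1 - stay r mu n.+1 y =
  conv mu (fun u => if `|u| <= r then 1 - stay r mu n u else 1) y.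
Proof.
move=> lm; rewrite -{1}(conv_cst 1 y lm) /stay/=.
rewrite /conv -sumrB; apply: eq_bigr => a _; rewrite -mulrBr; congr (_ * _).
by case: (_ <= r); rewrite ?mul1r ?mul0r ?subr0.
Qed.

(** First-step analysis: once the walk has left the ball, Jensen keeps its mean square above r^2 at
    all later times. *)
Lemma doob_sq r mu n y : law mu -> mean mu = 0 -> 0 < r ->
  1 - stay r mu n y <= iter n (conv mu) sq y / r ^+ 2.
Proof.
move=> lm m0 r0; have r20 : 0 < r ^+ 2 by rewrite exprn_gt0.
elim: n y => [|n IH] y; first by rewrite subrr divr_ge0 // ltW.
rewrite one_sub_conv_stay // iterS mulrC -convZ.
apply: le_conv => [|a am]; first by case: lm.
case: (leP `|y + a.2| r) => ya; first by rewrite (le_trans (IH _))// mulrC.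
rewrite [leRHS]mulrC ler_pdivlMr// mul1r.
apply: (@le_trans _ _ (sq (y + a.2))).
  by rewrite /sq ler_pXn2r ?nnegrE ?(ltW r0)// ltW.
by have := iter_conv_mean n (y + a.2) lm; rewrite m0 mul0rn addr0.
Qed.

(* Decompose at the exit time of the ball of radius rho: the walk is then in
   the ball of radius rho + J and starts afresh. *)
Lemma iter_conv_sq_exit mu (rho J s : R) n y : law mu ->
  0 <= rho -> 0 <= J -> 0 <= s -> (forall a, a \in mu -> `|a.2| <= J) ->
  (forall i, (i <= n)%N -> iter i (conv mu) sq 0 <= s) -> `|y| <= rho ->
  iter n (conv mu) sq y <=
    2 * (rho + J) ^+ 2 + 2 * s * (1 - stay rho mu n y).
Proof.
move=> lm rho0 J0 s0 mJ; elim: n y => [|n IH] y si yr.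
  rewrite subrr mulr0 addr0 /= /sq.
  have : `|y| ^+ 2 <= (rho + J) ^+ 2 by rewrite ler_pXn2r ?nnegrE ?addr_ge0//; lra.
  by have := sqr_ge0 (rho + J); lra.
rewrite one_sub_conv_stay // -convZ -[X in X + _](conv_cst _ y lm) -convD.
apply: le_conv => [|a am]; first by case: lm.
case: (leP `|y + a.2| rho) => ya.
  by apply: IH => // i ni; apply: si; rewrite (leq_trans ni).
have := iter_conv_sqD n (y + a.2) 0 lm; rewrite addr0 mulr1.
have h1 : sq (y + a.2) <= (rho + J) ^+ 2.
  rewrite /sq ler_pXn2r ?nnegrE ?addr_ge0//.
  by rewrite (le_trans (ler_normD _ _))// lerD// mJ.
by rewrite -/(iter n (conv mu) sq (y + a.2)); have := si n (leqnSn n); lra.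
Qed.

(** Let V be the largest mean square up to time n. The exit probability is at most 1/4, so the
    decomposition at the exit time gives V <= 2 (rho + J)^2 + V/2. *)
Lemma iter_conv_sq_bound mu (rho J : R) n : law mu ->
  0 <= rho -> 0 <= J -> (forall a, a \in mu -> `|a.2| <= J) ->
  3 / 4 <= stay rho mu n 0 ->
  iter n (conv mu) sq 0 <= 4 * (rho + J) ^+ 2.
Proof.
move=> lm rho0 J0 mJ st.
pose V := fun k : 'I_n.+1 => iter k (conv mu) sq 0.
have [k _ kmax] := arg_maxP V (isT : xpredT (ord0 : 'I_n.+1)).
have stk i : (i <= n)%N -> 3 / 4 <= stay rho mu i 0.
  move=> ni; apply: (le_trans st); rewrite -(subnK ni).
  elim: (n - i)%N => // d IH; apply: le_trans IH; exact: stay_anti.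
have Vmax i : (i <= n)%N -> iter i (conv mu) sq 0 <= V k.
  move=> ni; exact: (kmax (Ordinal (ni : (i < n.+1)%N)) isT).
have V0 : 0 <= V k by apply: iter_conv_ge0.
have kn : (k <= n)%N by rewrite -ltnS.
have := @iter_conv_sq_exit mu rho J (V k) k 0 lm rho0 J0 V0 mJ.
have si : forall i, (i <= k)%N -> iter i (conv mu) sq 0 <= V k.
  by move=> i ik; apply: Vmax; rewrite (leq_trans ik).
move=> /(_ si); rewrite normr0 => /(_ rho0); rewrite -/(V k).
have h := stk _ kn; have := Vmax n (leqnn _).
move: h; set t := stay _ _ _ _ => h1 h2 h3.
have : 2 * V k * (1 - t) <= 2 * V k * (1 / 4) by rewrite ler_wpM2l ?mulr_ge0//; lra.
by lra.
Qed.

End FiniteLaws.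
#[global] Hint Resolve sq_ge0 : core.

(** * Moments and layers of symmetric lists of integers *)

Section UniformLists.
Context {R : realType}.
Implicit Types (zs us : seq int).

Definition avg (T : Type) (s : seq T) (g : T -> R) : R :=
  (size s)%:R^-1 * \sum_(z <- s) g z.

Lemma eq_avg (T : Type) (s : seq T) (g h : T -> R) : g =1 h -> avg s g = avg s h.
Proof. by move=> gh; congr (_ * _); apply: eq_bigr. Qed.

Lemma avg_cst (T : Type) (s : seq T) (c : R) : (0 < size s)%N ->
  avg s (fun=> c) = c.
Proof.
move=> s0; rewrite /avg big_const_seq count_predT iter_addr_0.
by rewrite -[c *+ _]mulr_natr mulrC mulfK// pnatr_eq0 -lt0n.
Qed.

Lemma avgD (T : Type) (s : seq T) (g h : T -> R) :
  avg s (fun z => g z + h z) = avg s g + avg s h.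
Proof. by rewrite /avg big_split mulrDr. Qed.

Lemma avgZ (T : Type) (s : seq T) (c : R) (g : T -> R) :
  avg s (fun z => c * g z) = c * avg s g.
Proof. by rewrite /avg -mulr_sumr mulrCA. Qed.

Lemma le_avg (T : eqType) (s : seq T) (g h : T -> R) :
  (forall z, z \in s -> g z <= h z) -> avg s g <= avg s h.
Proof.
move=> gh; rewrite /avg !big_seq ler_wpM2l ?invr_ge0 ?ler0n//.
exact: ler_sum.
Qed.

Lemma avg_ge0 (T : Type) (s : seq T) (g : T -> R) :
  (forall z, 0 <= g z) -> 0 <= avg s g.
Proof. by move=> g0; rewrite mulr_ge0 ?invr_ge0 ?ler0n// sumr_ge0. Qed.

Lemma avg_map (S T : Type) (h : S -> T) (s : seq S) (g : T -> R) :
  avg (map h s) g = avg s (g \o h).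
Proof. by rewrite /avg size_map big_map. Qed.

Lemma avg_allpairs (S T U : Type) (F : S -> T -> U) (s : seq S) (t : seq T)
    (g : U -> R) :
  avg [seq F z u | z <- s, u <- t] g = avg s (fun z => avg t (fun u => g (F z u))).
Proof.
rewrite /avg big_allpairs_dep size_allpairs natrM invfM -mulrA.
by congr (_ * _); rewrite mulr_sumr.
Qed.

Lemma perm_avg (T : eqType) (s t : seq T) (g : T -> R) : perm_eq s t ->
  avg s g = avg t g.
Proof. by move=> st; rewrite /avg (perm_size st) (perm_big _ st). Qed.

Definition symmetric_list zs := perm_eq zs (map -%R zs).

Lemma symmetric_avgN zs (g : int -> R) : symmetric_list zs ->
  avg zs (fun z => g (- z)) = avg zs g.
Proof. by move=> sz; rewrite [RHS](perm_avg _ sz) avg_map. Qed.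

Lemma symmetric_avg_odd zs (g : int -> R) : symmetric_list zs ->
  (forall z, g (- z) = - g z) -> avg zs g = 0.
Proof.
move=> sz go; have := symmetric_avgN g sz.
rewrite (eq_avg zs (h := fun z => -1 * g z)) => [|z]; last by rewrite mulN1r.
by rewrite avgZ; lra.
Qed.

Definition sumset zs us : seq int := [seq z + u | z <- zs, u <- us].

Lemma symmetric_sumset zs us : symmetric_list zs -> symmetric_list us ->
  symmetric_list (sumset zs us).
Proof.
move=> sz su; rewrite /symmetric_list /sumset map_allpairs.
rewrite (_ : [seq - (z + u) | z <- zs, u <- us] =
             [seq z + u | z <- map -%R zs, u <- map -%R us]); last first.
  rewrite allpairs_mapl allpairs_mapr.
  by apply: eq_allpairs => z u; rewrite opprD.
exact: perm_allpairs.
Qed.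

Definition sumset_pow zs m : seq int := iter m (sumset zs) [:: 0].

Lemma symmetric_sumset_pow zs m : symmetric_list zs ->
  symmetric_list (sumset_pow zs m).
Proof.
move=> sz; elim: m => [|m IH]; first by rewrite /symmetric_list /= oppr0.
exact: symmetric_sumset.
Qed.

Lemma size_sumset_pow zs m : (0 < size zs)%N -> (0 < size (sumset_pow zs m))%N.
Proof. by move=> z0; elim: m => //= m IH; rewrite size_allpairs muln_gt0 z0. Qed.

Lemma sumset_pow_le zs m : (forall z, z \in zs -> `|z| <= 1) ->
  forall z, z \in sumset_pow zs m -> `|z| <= m%:R.
Proof.
move=> z1; elim: m => [|m IH] z; first by rewrite inE => /eqP ->.
move=> /allpairsP[[a b]/= [az bm ->]]; rewrite (le_trans (ler_normD _ _))//.
by rewrite -(natr1 m) addrC lerD ?IH ?z1.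
Qed.

Lemma avg_sumset_pow2 zs m : (0 < size zs)%N -> symmetric_list zs ->
  avg (sumset_pow zs m) (fun z => z%:~R ^+ 2) =
  avg zs (fun z => z%:~R ^+ 2) * m%:R.
Proof.
move=> z0 sz; elim: m => [|m IH].
  by rewrite mulr0 /avg big_seq1 expr0n mulr0.
rewrite /= [LHS]avg_allpairs -/(sumset_pow zs m).
set p := avg zs _ in IH *; set q := avg (sumset_pow _ _) _ in IH.
transitivity (avg zs (fun z => z%:~R ^+ 2 + q)).
  apply: eq_avg => z; rewrite (eq_avg _ (h := fun u =>
    (z%:~R ^+ 2 + u%:~R ^+ 2) + (z%:~R *+ 2) * u%:~R)); last first.
    by move=> u; rewrite rmorphD/= mulr2n; ring.
  rewrite avgD avgD avg_cst ?size_sumset_pow// avgZ.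
  rewrite (@symmetric_avg_odd _ (fun u => u%:~R)) ?symmetric_sumset_pow//.
    by rewrite mulr0 addr0.
  by move=> u; rewrite rmorphN.
by rewrite avgD avg_cst// -/p IH -natr1; ring.
Qed.

(** Coefficients in {-1, 0, 1} satisfy z^4 = z^2, and odd moments vanish by symmetry. So one more
    summand adds p + 6 p q to the fourth moment, where p is the variance of a coefficient and q that
    of the sum so far. *)
Lemma avg_sumset_pow4 zs m : (0 < size zs)%N -> symmetric_list zs ->
  (forall z, z \in zs -> `|z| <= 1) ->
  let V := avg zs (fun z => z%:~R ^+ 2) * m%:R in
  avg (sumset_pow zs m) (fun z => z%:~R ^+ 4) <= 3 * V ^+ 2 + V.
Proof.
move=> z0 sz z1; cbv zeta.
have e42 : avg zs (fun z => z%:~R ^+ 4) = avg zs (fun z => z%:~R ^+ 2).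
  apply/eqP; rewrite eq_le; apply/andP; split; apply: le_avg => z /z1 hz;
  have : z = 0 \/ z = 1 \/ z = -1 by [lia | lia].
  - by move=> [|[|]] ->; rewrite ?rmorphN ?sqrrN ?expr0n ?expr1n//= -signr_odd/= expr0.
  - by move=> [|[|]] ->; rewrite ?rmorphN ?sqrrN ?expr0n ?expr1n//= -signr_odd/= expr0.
elim: m => [|m IH].
  by rewrite mulr0 /avg big_seq1 !expr0n !mulr0 addr0.
rewrite /= [leLHS]avg_allpairs -/(sumset_pow zs m).
have := avg_sumset_pow2 m z0 sz.
set p := avg zs (fun z => z%:~R ^+ 2) in e42 IH *.
set q := avg (sumset_pow _ _) _ => qE.
set r := avg (sumset_pow _ _) _ in IH.
have -> : avg zs (fun z => avg (sumset_pow zs m)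
     (fun u => (z + u)%:~R ^+ 4)) =
    avg zs (fun z => z%:~R ^+ 4 + (6 * q) * z%:~R ^+ 2 + r).
  apply: eq_avg => z; rewrite (eq_avg _ (h := fun u : int =>
    z%:~R ^+ 4 + (6 * z%:~R ^+ 2) * u%:~R ^+ 2 + u%:~R ^+ 4 +
    ((4 * z%:~R ^+ 3) * u%:~R + (4 * z%:~R) * u%:~R ^+ 3))); last first.
    by move=> u; rewrite rmorphD/=; ring.
  rewrite !avgD avg_cst ?size_sumset_pow// !avgZ -/q -/r.
  rewrite (@symmetric_avg_odd _ (fun u => u%:~R)) ?symmetric_sumset_pow//;
    last by move=> u; rewrite rmorphN.
  rewrite (@symmetric_avg_odd _ (fun u => u%:~R ^+ 3)) ?symmetric_sumset_pow//;
    last by move=> u; rewrite rmorphN/=; ring.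
  by ring.
rewrite !avgD avgZ avg_cst// e42 -/p qE -natr1.
have p0 : 0 <= p by apply: avg_ge0 => z; exact: sqr_ge0.
have m0 : 0 <= m%:R :> R by rewrite ler0n.
by move: IH; have := sqr_ge0 p; nra.
Qed.

(** The layer cake of an integer, arranged so that each layer is again an admissible coefficient in
    {-1, 0, 1}. *)
Definition layer (s : nat) (z : int) : int := if (s <= `|z|%N)%N then sgz z else 0.

Lemma layer_norm s z : `|layer s z| <= 1.
Proof. by rewrite /layer; case: ifP => _ //; rewrite normr_sgz; case: (z != 0). Qed.

Lemma layerN s z : layer s (- z) = - layer s z.
Proof. by rewrite /layer abszN sgzN; case: ifP => //; rewrite oppr0. Qed.

Lemma sum_layer M z : `|z| <= M%:R -> z = \sum_(s <- iota 1 M) layer s z.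
Proof.
move=> zM; have {}zM : (`|z|%N <= M)%N by rewrite -lez_nat abszE -natz.
rewrite [LHS]intEsg.
rewrite -[X in Posz X](_ : count (fun s => (s <= `|z|%N)%N) (iota 1 M) = _); last first.
  rewrite -(subnKC zM) iotaD count_cat.
  rewrite (@eq_in_count _ _ predT) => [|s]; last first.
    by rewrite mem_iota/= => /andP[_]; rewrite add1n ltnS.
  rewrite count_predT size_iota (@eq_in_count _ _ pred0) ?count_pred0 ?addn0// => s.
  by rewrite mem_iota add1n => /andP[h _]; apply/negbTE; rewrite -ltnNge.
rewrite /layer -big_mkcond/= big_const_seq iter_addr_0.
by rewrite -mulr_natr natz.
Qed.

Lemma symmetric_layer s zs : symmetric_list zs -> symmetric_list (map (layer s) zs).
Proof.
move=> sz; rewrite /symmetric_list -map_comp.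
have -> : map (-%R \o layer s) zs = map (layer s \o -%R) zs.
  by apply: eq_map => z /=; rewrite layerN.
by rewrite map_comp perm_map.
Qed.

(** Markov's inequality at the fourth power. The decay s^-4 pays for weights of order s^-2 on the
    high layers. *)
Lemma avg_layer2 s zs : (0 < s)%N ->
  avg (map (layer s) zs) (fun z => z%:~R ^+ 2) <=
  avg zs (fun z => z%:~R ^+ 4) / s%:R ^+ 4.
Proof.
move=> s0; rewrite avg_map mulrC -avgZ; apply: le_avg => z _ /=.
have sR : 0 < s%:R :> R by rewrite ltr0n.
have e0 (x : R) : 0 <= x ^+ 4 by rewrite (_ : x ^+ 4 = (x ^+ 2) ^+ 2) ?sqr_ge0// -exprM.
rewrite /layer; case: ifP => [sz|_]; last by rewrite expr0n mulr_ge0 ?invr_ge0.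
rewrite mulrC ler_pdivlMr ?exprn_gt0//.
apply: (@le_trans _ _ (1 * s%:R ^+ 4)).
  rewrite ler_wpM2r// -[leRHS](expr1n _ 2) -[X in X ^+ 2 <= _]/((sgz z)%:~R : R).
  rewrite -real_normK ?num_real// ler_pXn2r ?nnegrE// -intr_norm normr_sgz.
  by case: (z != 0).
rewrite mul1r -[leRHS](_ : `|z%:~R| ^+ 4 = _); last first.
  by rewrite (exprM _ 2 2) real_normK ?num_real// -exprM.
by rewrite ler_pXn2r ?nnegrE// -intr_norm -abszE -pmulrn ler_nat.
Qed.

End UniformLists.

(** * Vector sums with random integer coefficients *)

Section IntegerWalks.
Context {R : realType} {B : normedModType R}.
Implicit Types (zs us : seq int) (xs vs : seq B) (f g : B -> R) (y u v x : B).

Definition unif vs : seq (R * B) := [seq ((size vs)%:R^-1, v) | v <- vs].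

Lemma conv_unif vs f y : conv (unif vs) f y = avg vs (fun v => f (y + v)).
Proof. by rewrite /conv big_map /= -mulr_sumr. Qed.

Lemma law_unif vs : (0 < size vs)%N -> law (unif vs).
Proof.
move=> v0; split=> [_ /mapP[v _ ->]|]; first by rewrite invr_ge0 ler0n.
by have := conv_unif vs (fun=> 1) 0; rewrite avg_cst// => <-; apply: eq_bigr => a; rewrite mulr1.
Qed.

Lemma mean_unif vs : mean (unif vs) = (size vs)%:R^-1 *: \sum_(v <- vs) v.
Proof. by rewrite /mean big_map scaler_sumr. Qed.

Definition step zs x : seq (R * B) := unif [seq x *~ z | z <- zs].

Lemma conv_step zs x f y : conv (step zs x) f y = avg zs (fun z => f (y + x *~ z)).
Proof. by rewrite conv_unif avg_map. Qed.

Lemma law_step zs x : (0 < size zs)%N -> law (step zs x).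
Proof. by move=> z0; apply: law_unif; rewrite size_map. Qed.

Lemma conv_step_step zs us x f y :
  conv (step zs x) (conv (step us x) f) y = conv (step (sumset zs us) x) f y.
Proof.
rewrite !conv_step avg_allpairs; apply: eq_avg => z; rewrite conv_step.
by apply: eq_avg => u; rewrite mulrzDr addrA.
Qed.

(* [walk zs xs f y] is E f(y + sum_i z_i x_i), the z_i being independent and
   uniform in the list [zs]. *)
Definition walk zs xs f : B -> R := foldr (fun x => conv (step zs x)) f xs.

Lemma conv_walk mu zs xs f y :
  conv mu (walk zs xs f) y = walk zs xs (conv mu f) y.
Proof.
elim: xs y => //= x xs IH y; rewrite convC; apply: eq_conv => u; exact: IH.
Qed.

Lemma walk_walk zs us xs f : walk zs xs (walk us xs f) =1 walk (sumset zs us) xs f.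
Proof.
elim: xs => //= x xs IH y; rewrite -conv_step_step; apply: eq_conv => {}y.
rewrite -conv_walk; apply: eq_conv => {}y; exact: IH.
Qed.

(** The values of sum_i z_i x_i with multiplicity: the whole sum becomes one uniform law on a list,
    to which [clt_cotype] applies. *)
Fixpoint combinations zs xs : seq B :=
  if xs is x :: xs' then [seq x *~ z + u | z <- zs, u <- combinations zs xs']
  else [:: 0].

Lemma conv_combinations zs xs f y :
  conv (unif (combinations zs xs)) f y = walk zs xs f y.
Proof.
elim: xs y => /= [|x xs IH] y.
  by rewrite conv_unif /avg big_seq1 addr0 invr1 mul1r.
rewrite conv_unif avg_allpairs conv_step; apply: eq_avg => z.
by rewrite -IH conv_unif; apply: eq_avg => u; rewrite addrA.
Qed.

(** Copies of sum_i z_i x_i add up coefficient by coefficient. This identifies the walks in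
    [clt_cotype] with those that define [normalized_walks]. *)
Lemma iter_conv_combinations zs xs m f y :
  iter m (conv (unif (combinations zs xs))) f y = walk (sumset_pow zs m) xs f y.
Proof.
elim: m y => [|m IH] y.
  elim: xs y => //= x xs IHx y; rewrite conv_step /avg big_seq1 invr1 mul1r.
  by rewrite addr0.
rewrite [LHS]/= (eq_conv _ IH) conv_combinations; exact: walk_walk.
Qed.

Lemma size_combinations zs xs : (0 < size zs)%N -> (0 < size (combinations zs xs))%N.
Proof. by move=> z0; elim: xs => //= x xs IH; rewrite size_allpairs muln_gt0 z0. Qed.

Lemma sum_combinations zs xs : (0 < size zs)%N -> symmetric_list zs ->
  \sum_(v <- combinations zs xs) v = 0.
Proof.
move=> z0 sz; elim: xs => [|x xs IH]/=; first by rewrite big_seq1.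
rewrite big_allpairs_dep/=; under eq_bigr => z _.
  rewrite big_split/= IH addr0 big_const_seq count_predT iter_addr_0; over.
rewrite sumrMnl -mulrz_sumr.
suff -> : \sum_(z <- zs) z = 0 by rewrite mulr0z mul0rn.
have : \sum_(z <- zs) z = - \sum_(z <- zs) z.
  by rewrite -sumrN -(big_map -%R xpredT id); exact: perm_big.
lia.
Qed.

Lemma walk_ge0 zs xs f y : (0 < size zs)%N -> (forall u, 0 <= f u) ->
  0 <= walk zs xs f y.
Proof.
move=> z0 f0; elim: xs y => //= x xs IH y.
by apply: conv_ge0 => //; exact: law_step.
Qed.

Lemma sq_le_walk zs xs y : (0 < size zs)%N -> symmetric_list zs ->
  sq y <= walk zs xs sq y.
Proof.
move=> z0 sz; rewrite -conv_combinations; apply: jensen_sq0.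
  by apply: law_unif; exact: size_combinations.
by rewrite mean_unif sum_combinations// scaler0.
Qed.

Lemma walk_sqD zs xs u v : (0 < size zs)%N ->
  walk zs xs sq (u + v) <= 2 * sq u + 2 * walk zs xs sq v.
Proof.
move=> z0; rewrite -!conv_combinations.
by apply: (@iter_conv_sqD _ _ _ 1); apply: law_unif; exact: size_combinations.
Qed.

Lemma sq_mulrz (x : B) (z : int) : sq (x *~ z) = sq x * z%:~R ^+ 2 :> R.
Proof. by rewrite -scaler_int sqZ mulrC. Qed.

(** The constant is exponential in the number of vectors; it serves only to make the supremum G
    finite and to settle the case of zero variance. *)
Lemma walk_sq_ub zs xs : (0 < size zs)%N ->
  walk zs xs sq 0 <= foldr (fun x (c : R) => 2 * sq x + 2 * c) 0 xs *
                     avg zs (fun z => z%:~R ^+ 2).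
Proof.
move=> z0; elim: xs => [|x xs IH]/=; first by rewrite /sq normr0 expr0n mul0r.
rewrite conv_step; set p := avg zs _ in IH *; set c := foldr _ _ _ in IH *.
have -> : (2 * sq x + 2 * c) * p =
    avg zs (fun z => 2 * (sq x * z%:~R ^+ 2) + 2 * (c * p)).
  by rewrite avgD avg_cst// !avgZ -/p; ring.
apply: le_avg => z _; rewrite add0r -[x *~ z]addr0.
apply: (le_trans (walk_sqD _ _ _ z0)).
by rewrite sq_mulrz lerD2l ler_pM2l.
Qed.

(* Cauchy-Schwarz with weights [l] over the layers [h s] of the coefficients. *)
Lemma walk_sq_layers zs xs (S : seq nat) (h : nat -> int -> int) (l : nat -> R)
    (y : nat -> B) : (0 < size zs)%N ->
  (forall s, 0 < l s) ->
  (forall z, z \in zs -> z = \sum_(s <- S) h s z) ->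
  walk zs xs sq (\sum_(s <- S) y s) <=
  (\sum_(s <- S) l s) *
  \sum_(s <- S) (l s)^-1 * walk (map (h s) zs) xs sq (y s).
Proof.
move=> z0 l0 hz; elim: xs y => [|x xs IH] y /=; first exact: sq_sum_le.
rewrite conv_step.
have -> : (\sum_(s <- S) l s) *
    \sum_(s <- S) (l s)^-1 * conv (step (map (h s) zs) x) (walk (map (h s) zs) xs sq) (y s) =
  avg zs (fun z => (\sum_(s <- S) l s) *
    \sum_(s <- S) (l s)^-1 * walk (map (h s) zs) xs sq (y s + x *~ h s z)).
  rewrite avgZ; congr (_ * _); rewrite /avg exchange_big/= mulr_sumr.
  apply: eq_bigr => s _.
  by rewrite conv_step avg_map /avg mulrCA mulr_sumr.
apply: le_avg => z /hz {1}->.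
by rewrite mulrz_sumr -big_split/=; exact: IH.
Qed.

(** One coefficient at a time: by symmetry z may be averaged with -z; then z = 1 and z = -1 give
    equality, and z = 0 is Jensen's inequality. *)
Lemma walk_le_rademacher zs xs y : (0 < size zs)%N -> symmetric_list zs ->
  (forall z, z \in zs -> `|z| <= 1) ->
  walk zs xs sq y <= walk [:: 1; -1] xs sq y.
Proof.
move=> z0 sz z1; elim: xs y => //= x xs IH y.
set g := walk [:: 1; -1] xs sq.
rewrite conv_step; apply: (@le_trans _ _ (avg zs (fun z => g (y + x *~ z)))).
  by apply: le_avg => z _; exact: IH.
have -> : avg zs (fun z => g (y + x *~ z)) =
    avg zs (fun z => 2^-1 * (g (y + x *~ z) + g (y - x *~ z))).
  rewrite avgZ avgD -[X in _ + X](@symmetric_avgN _ zs (fun z => g (y - x *~ z)))//.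
  rewrite (eq_avg _ (g := fun z => g (y - x *~ - z)) (h := fun z => g (y + x *~ z))).
    by lra.
  by move=> z; rewrite mulrNz opprK.
rewrite -[leRHS](avg_cst _ z0); apply: le_avg => z /z1 hz.
have -> : conv (step [:: 1; -1] x) g y = 2^-1 * (g (y + x) + g (y - x)).
  by rewrite conv_step /avg/= !big_cons big_nil mulrN1z addr0.
have : z = 0 \/ z = 1 \/ z = -1 by lia.
have jg : g y <= 2^-1 * (g (y + x) + g (y - x)).
  have -> : 2^-1 * (g (y + x) + g (y - x)) = conv (step [:: 1; -1] x) g y.
    by rewrite conv_step /avg/= !big_cons big_nil mulrN1z addr0.
  (* The sign step commutes with the rest of the walk, so that Jensen is needed for [sq] only. *)
  rewrite /g conv_walk -!conv_combinations; apply: le_conv => [a|a _].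
    by apply: (law_unif _).1; exact: size_combinations.
  apply: jensen_sq0; first exact: law_step.
  by rewrite mean_unif /= !big_cons big_nil mulrN1z addr0 addrN scaler0.
case=> [->|[->|->]].
- by rewrite mulr0z subr0 addr0; move: jg; lra.
- by rewrite mulr1z.
- by rewrite mulrN1z opprK [g (y - x) + _]addrC.
Qed.

End IntegerWalks.

(** * From the central limit bound to Rademacher sums *)

Section CltToRademacher.
Context {R : realType} {B : normedModType R}.
Implicit Types (zs : seq int) (xs vs : seq B).

(* [L] stands for the limsup of E|S_m|^2 / m, where S_m is the walk with steps
   uniform in [vs]; the 4 is what Doob's inequality at radius sqrt (2 m L) costs. *)
Definition clt_cotype (c : R) := forall vs L, (0 < size vs)%N ->
  \sum_(v <- vs) v = 0 -> 0 < L ->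
  (exists m0 : nat, forall m, (m0 <= m)%N ->
     iter m (conv (unif vs)) sq 0 <= m%:R * L) ->
  conv (unif vs) sq 0 <= 4 * c * L.

(** The first sigma weights add up to at most 1. The later ones are dominated by the telescoping
    differences sigma/(s-1) - sigma/s and also add up to at most 1. *)
Lemma sum_layer_weights (sigma M : nat) : (0 < sigma)%N ->
  \sum_(s <- iota 1 M)
     (if (s <= sigma)%N then sigma%:R^-1 else sigma%:R / s%:R ^+ 2) <= 2 :> R.
Proof.
move=> s0; have sR : 0 < sigma%:R :> R by rewrite ltr0n.
pose g (n : nat) : R := if (n <= sigma)%N then n%:R / sigma%:R else 2 - sigma%:R / n%:R.
suff H : \sum_(s <- iota 1 M)
     (if (s <= sigma)%N then sigma%:R^-1 else sigma%:R / s%:R ^+ 2) <= g M.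
  apply: (le_trans H); rewrite /g; case: ifP => h.
    by rewrite ler_pdivrMr// -natrM ler_nat; lia.
  by rewrite gerBl divr_ge0.
elim: M => [|M IH]; first by rewrite big_nil /g leq0n mul0r.
rewrite -[X in iota _ X]addn1 iotaD big_cat/= add1n big_seq1.
apply: (le_trans (lerD IH (lexx _))); rewrite /g.
have [Ms|sM] := leqP M.+1 sigma.
  by rewrite (ltnW Ms) -(natr1 M) mulrDl mul1r.
have M0 : 0 < M%:R :> R by rewrite ltr0n; lia.
have M1 : 0 < M.+1%:R :> R by rewrite ltr0n.
have : sigma%:R / M.+1%:R ^+ 2 <= sigma%:R / M%:R - sigma%:R / M.+1%:R :> R.
  rewrite -mulrBr ler_pM2l// -[leRHS](_ : (M%:R * M.+1%:R)^-1 = _); last first.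
    rewrite -(natr1 M); field; rewrite ?natr1 !gt_eqF//.
  rewrite lef_pV2 ?posrE ?mulr_gt0 ?exprn_gt0// expr2 ler_pM2r//.
  by rewrite ler_nat.
set u := _ / _ ^+ 2; set v := _ / M.+1%:R; case: ifP => h.
  by have -> : M = sigma by [lia]; rewrite divff ?gt_eqF//; lra.
by set w := _ / M%:R; lra.
Qed.

Context {c : R} (c0 : 0 < c) (Hc : clt_cotype c).

Definition coefficient_list zs :=
  [/\ (0 < size zs)%N, symmetric_list zs & forall z, z \in zs -> `|z| <= 1].

Definition variance zs : R := avg zs (fun z => z%:~R ^+ 2).

Lemma variance_ge0 zs : 0 <= variance zs.
Proof. by apply: avg_ge0 => z; exact: sqr_ge0. Qed.

(* The supremum of this set bounds E|sum_i g_i x_i|^2 for the gaussian limits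
   g_i of normalized sums of integer coefficients. *)
Definition normalized_walks xs : set R :=
  [set r | exists zs m, [/\ coefficient_list zs, 1 <= variance zs * m%:R &
     r = walk (sumset_pow zs m) xs sq 0 / (variance zs * m%:R)]].

Lemma normalized_walks_ub xs : has_ubound (normalized_walks xs).
Proof.
exists (foldr (fun x (c : R) => 2 * sq x + 2 * c) 0 xs).
move=> _ [zs [m [[z0 sz z1] V1 ->]]].
rewrite ler_pdivrMr ?(lt_le_trans _ V1)//.
by rewrite -(avg_sumset_pow2 m z0 sz); apply: walk_sq_ub; exact: size_sumset_pow.
Qed.

Lemma coefficient_list_signs : coefficient_list [:: 1; -1].
Proof.
split=> // z.
by rewrite !inE => /orP[] /eqP ->.
Qed.

Lemma variance_signs : variance [:: 1; -1] = 1.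
Proof. by rewrite /variance /avg/= !big_cons big_nil rmorphN/= sqrrN expr1n addr0; lra. Qed.

Lemma normalized_walks_nonempty xs : normalized_walks xs !=set0.
Proof.
eexists; exists [:: 1; -1], 1%N; split; [exact: coefficient_list_signs| |reflexivity].
by rewrite variance_signs mul1r.
Qed.

Lemma sup_normalized_walks_ge0 xs : 0 <= sup (normalized_walks xs).
Proof.
have [r rW] := normalized_walks_nonempty xs.
apply: (@le_trans _ _ r); last by apply: ub_le_sup => //; exact: normalized_walks_ub.
case: rW => zs [m [[z0 sz _] V1 ->]]; apply: divr_ge0.
  by apply: walk_ge0 => //; exact: size_sumset_pow.
by rewrite mulr_ge0 ?variance_ge0.
Qed.

(** The hypothesis is applied to the list of all combinations: once m times the variance reaches 1,
    E|S_m|^2 is among the quantities controlled by G, so L may be any number above the variance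
    times G. *)
Lemma walk_le_variance xs zs : coefficient_list zs ->
  walk zs xs sq 0 <= 4 * c * (variance zs * sup (normalized_walks xs)).
Proof.
move=> Zzs; have [z0 sz z1] := Zzs.
have p0 := variance_ge0 zs; set p := variance zs in p0 *.
have G0 := sup_normalized_walks_ge0 xs; set G := sup _ in G0 *.
have [p00|pp] := eqVneq p 0.
  by have := walk_sq_ub xs z0; rewrite -/(variance zs) -/p p00 !(mulr0, mul0r).
have {}pp : 0 < p by rewrite lt_neqAle eq_sym pp.
(* The slack e' keeps L = p (G + e') positive even when G = 0. *)
apply/ler_addgt0Pr => e e0; pose e' := e / (4 * c * p).
have e'0 : 0 < e' by rewrite /e' divr_gt0// mulr_gt0// mulr_gt0.
have -> : 4 * c * (p * G) + e = 4 * c * (p * (G + e')).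
  by rewrite /e'; field; rewrite !gt_eqF.
rewrite -conv_combinations; apply: Hc.
- exact: size_combinations.
- exact: sum_combinations.
- by rewrite mulr_gt0// ltr_wpDl.
exists (Num.truncn p^-1).+1 => m hm.
have pm : 1 <= p * m%:R.
  rewrite mulrC -ler_pdivrMr// mul1r.
  by rewrite (le_trans (ltW (truncnS_gt _)))// ler_nat.
rewrite iter_conv_combinations.
have : walk (sumset_pow zs m) xs sq 0 / (p * m%:R) <= G.
  by apply: ub_le_sup; [exact: normalized_walks_ub|exists zs, m].
rewrite ler_pdivrMr ?(lt_le_trans _ pm)// => /le_trans -> //.
have -> : G * (p * m%:R) = m%:R * (p * G) by ring.
by rewrite ler_wpM2l// ler_pM2l// lerDl ltW.
Qed.

(** Chosen so that 64 c <= tau/2, which bounds the share of the high layers by G/2, and tau >= 1. *)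
Let tau : R := 128 * c + 1.

(** A self-bounding argument. A layer s <= sigma costs at most the Rademacher moment a; a layer s >
    sigma has variance at most 4 V^2 / s^4 and costs at most 16 c V^2 G / s^4. After normalization
    the second kind amounts to at most G/2, which is absorbed because G is finite. *)
Lemma sup_normalized_walks_le xs :
  sup (normalized_walks xs) <= 32 * tau * walk [:: 1; -1] xs sq 0.
Proof.
have t0 : 0 < tau by rewrite addr_gt0// mulr_gt0.
have G0 := sup_normalized_walks_ge0 xs; set G := sup _ in G0 *.
set a := walk _ _ _ _.
suff : G <= 16 * tau * a + 2^-1 * G by lra.
apply: ge_sup; first exact: normalized_walks_nonempty.
move=> _ [zs [m [Zzs V1 ->]]]; have [z0 sz z1] := Zzs.
set V := variance zs * m%:R in V1 *.
have V0 : 0 < V by rewrite (lt_le_trans _ V1).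
rewrite ler_pdivrMr//.
(* The least integer with tau V <= sigma^2; minimality and 1 <= tau V yield the upper bound. *)
have [sigma s0 [s1 s2]] : exists2 sigma : nat, (0 < sigma)%N &
    tau * V <= sigma%:R ^+ 2 /\ sigma%:R ^+ 2 <= 4 * (tau * V).
  have tV1 : 1 <= tau * V.
    by rewrite -[leLHS]mulr1 ler_pM//; rewrite /tau lerDr mulr_ge0 // ltW.
  have ex : exists k : nat, tau * V <= k%:R ^+ 2.
    exists (Num.truncn (tau * V)).+1; set k := _.+1.
    have h1 : tau * V <= k%:R by exact/ltW/truncnS_gt.
    have k1 : 1 <= k%:R :> R by rewrite ler1n.
    by rewrite (le_trans h1)// expr2 ler_peMl.
  have := ex_minnP ex => -[k hk kmin]; exists k.
    rewrite lt0n; apply/eqP => k0; move: hk; rewrite k0 expr0n/=.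
    by move: tV1; lra.
  split=> //; case: k hk kmin => [|k] hk kmin; first by rewrite expr0n; lra.
  have : k%:R ^+ 2 < tau * V.
    by rewrite ltNge; apply/negP => /kmin; rewrite ltnn.
  have k0 : 0 <= k%:R :> R by rewrite ler0n.
  have := sqr_ge0 (k%:R - 1 : R); rewrite -(natr1 k); nra.
have sR : 0 < sigma%:R :> R by rewrite ltr0n.
pose l (s : nat) : R := if (s <= sigma)%N then sigma%:R^-1 else if s == 0%N then 1 else sigma%:R / s%:R ^+ 2.
have l0 s : 0 < l s.
  rewrite /l; case: ifP => _; first by rewrite invr_gt0.
  by case: s => [|s]//=; rewrite divr_gt0// exprn_gt0.
have suml : \sum_(s <- iota 1 m) l s <= 2.
  rewrite (le_trans _ (sum_layer_weights m s0))// le_eqVlt; apply/orP; left.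
  apply/eqP; rewrite !big_seq; apply: eq_bigr => s; rewrite mem_iota => /andP[s1' _].
  by rewrite /l; case: ifP => // _; rewrite gtn_eqF.
have suml0 : 0 <= \sum_(s <- iota 1 m) l s by apply: sumr_ge0 => s _; exact: ltW.
set us := sumset_pow zs m.
have us0 : (0 < size us)%N by exact: size_sumset_pow.
have sus : symmetric_list us by exact: symmetric_sumset_pow.
have Zl s : coefficient_list (map (layer s) us).
  split; rewrite ?size_map//; first exact: symmetric_layer.
  by move=> _ /mapP[z _ ->]; exact: layer_norm.
have a0 : 0 <= a by apply: walk_ge0.
(* The summands come from the layers s <= sigma and s > sigma. In both ranges a layer costs at most
   K (l s)^2, so Cauchy-Schwarz gives K times the squared sum of weights, at most 4 K. *)
set K := sigma%:R ^+ 2 * a + 16 * c * V ^+ 2 * G / sigma%:R ^+ 2.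
have cV0 : 0 <= 16 * c * V ^+ 2 * G / sigma%:R ^+ 2.
  apply: divr_ge0; last exact: sqr_ge0.
  apply: mulr_ge0 => //; apply: mulr_ge0; last exact: sqr_ge0.
  by rewrite mulr_ge0// ltW.
have K0 : 0 <= K by apply: addr_ge0 => //; apply: mulr_ge0 => //; exact: sqr_ge0.
have term s : s \in iota 1 m -> (l s)^-1 * walk (map (layer s) us) xs sq 0 <= K * l s.
  rewrite mem_iota => /andP[ss _].
  have sR' : 0 < s%:R :> R by rewrite ltr0n.
  rewrite /l; case: ifPn => hs.
    rewrite invrK ler_pdivlMr//.
    have : walk (map (layer s) us) xs sq 0 <= a.
      by have [? ? ?] := Zl s; apply: walk_le_rademacher.
    move=> h; rewrite mulrAC -expr2 (@le_trans _ _ (sigma%:R ^+ 2 * a))//.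
      by rewrite ler_pM2l// exprn_gt0.
    by rewrite /K lerDl.
  rewrite gtn_eqF// invf_div.
  have h1 := walk_le_variance xs (Zl s).
  have h2 : variance (map (layer s) us) <= 4 * V ^+ 2 / s%:R ^+ 4.
    apply: (le_trans (avg_layer2 _ ss)); rewrite ler_pM2r ?invr_gt0 ?exprn_gt0//.
    have h4 : avg us (fun z => z%:~R ^+ 4) <= 3 * V ^+ 2 + V.
      exact: avg_sumset_pow4.
    (* The normalization 1 <= V in [normalized_walks] turns 3 V^2 + V into 4 V^2. *)
    apply: (le_trans h4); have : V <= V ^+ 2 by rewrite expr2 ler_peMl// ltW.
    by lra.
  have h3 : walk (map (layer s) us) xs sq 0 <= 4 * c * (4 * V ^+ 2 / s%:R ^+ 4 * G).
    apply: (le_trans h1); rewrite ler_wpM2l ?mulr_ge0 ?(ltW c0)//.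
    by rewrite ler_wpM2r.
  apply: (@le_trans _ _ (s%:R ^+ 2 / sigma%:R * (4 * c * (4 * V ^+ 2 / s%:R ^+ 4 * G)))).
    by rewrite ler_pM2l// divr_gt0// exprn_gt0.
  apply: (@le_trans _ _ (16 * c * V ^+ 2 * G / sigma%:R ^+ 2 * (sigma%:R / s%:R ^+ 2))).
    by rewrite le_eqVlt; apply/orP; left; apply/eqP; field; rewrite !gt_eqF.
  by rewrite ler_pM2r ?divr_gt0 ?exprn_gt0// /K lerDr; apply: mulr_ge0 => //; exact: sqr_ge0.
have W : walk us xs sq 0 <= 4 * K.
  have := @walk_sq_layers R B us xs (iota 1 m) layer l (fun=> 0) us0 l0.
  rewrite big1// => H; apply: (le_trans (H _)) => [z zus|].
    by apply: sum_layer; apply: sumset_pow_le zus.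
  apply: (@le_trans _ _ ((\sum_(s <- iota 1 m) l s) * (K * \sum_(s <- iota 1 m) l s))).
    by rewrite ler_wpM2l// mulr_sumr big_seq [leRHS]big_seq; apply: ler_sum.
  have : (\sum_(s <- iota 1 m) l s) ^+ 2 <= 2 ^+ 2 by rewrite ler_pXn2r ?nnegrE.
  by move: K0; set q := \sum_(s <- _) _; nra.
apply: (le_trans W); rewrite /K mulrDr [leRHS]mulrDl; apply: lerD.
  have -> : 16 * tau * a * V = 4 * (4 * (tau * V) * a) by ring.
  by rewrite ler_pM2l// ler_wpM2r.
rewrite mulrA ler_pdivrMr ?exprn_gt0//.
apply: (@le_trans _ _ (2^-1 * G * V * (tau * V))).
  have -> : 2^-1 * G * V * (tau * V) = (2^-1 * tau) * (G * V ^+ 2) by ring.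
  have -> : 4 * (16 * c * V ^+ 2 * G) = (64 * c) * (G * V ^+ 2) by ring.
  apply: ler_wpM2r; first by apply: mulr_ge0 => //; exact: sqr_ge0.
  by rewrite /tau; lra.
apply: ler_wpM2l => //; apply: mulr_ge0; last exact: ltW.
by apply: mulr_ge0.
Qed.

(** A random sign that is switched off except with probability 1/(k + 1). *)
Definition lazy_signs (k : nat) : seq int := [:: 1; -1] ++ nseq (k.*2) 0.

Lemma avg_lazy_signs k (g : int -> R) : let p := (k.+1)%:R^-1 in
  avg (lazy_signs k) g = p * (2^-1 * (g 1 + g (-1))) + (1 - p) * g 0.
Proof.
cbv zeta; rewrite /avg /lazy_signs /= size_nseq !big_cons.
rewrite big_nseq iter_addr_0.
have -> : (k.*2.+2)%:R = 2 * k.+1%:R :> R by rewrite -natrM; congr _%:R; lia.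
have -> : g 0 *+ k.*2 = 2 * (k.+1%:R - 1) * g 0.
  by rewrite -[k.+1%:R]natr1 addrK -(natrM _ 2 k) mul2n mulr_natl.
by field; rewrite nat1r pnatr_eq0.
Qed.

Lemma coefficient_list_lazy k : coefficient_list (lazy_signs k).
Proof.
split=> // [|z]; last first.
  by rewrite !inE mem_nseq => /orP[/eqP->//|/orP[/eqP->//|/andP[_ /eqP->]]].
by rewrite /symmetric_list /lazy_signs map_cat perm_cat// map_nseq oppr0.
Qed.

Lemma variance_lazy k : variance (lazy_signs k) = k.+1%:R^-1.
Proof.
rewrite /variance avg_lazy_signs /= mulrN1z mulr1z mulr0z sqrrN expr1n expr0n/=.
by rewrite mulr0 addr0 (_ : 1 + 1 = 2) ?mulVf ?mulr1.
Qed.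

(** Condition on the coefficient of the first vector x: if it is a sign, Jensen drops all other
    terms and leaves |x|^2; if it is 0, the induction hypothesis remains. The factor 1 - p n is
    Bernoulli's bound for (1 - p)^n. *)
Lemma walk_lazy_ge k xs : let p := k.+1%:R^-1 : R in (size xs <= k)%N ->
  p * (1 - p * (size xs)%:R) * \sum_(x <- xs) sq x <= walk (lazy_signs k) xs sq 0.
Proof.
cbv zeta; set p : R := k.+1%:R^-1.
have kR : 0 < k.+1%:R :> R by rewrite ltr0n.
have p0 : 0 < p by rewrite invr_gt0.
have p1 : p <= 1 by rewrite invf_le1// ler1n.
have [z0 sz _] := coefficient_list_lazy k.
elim: xs => [|x xs IH] sk; first by rewrite big_nil mulr0 /= sq_ge0.
have {}IH := IH (ltnW sk).
rewrite big_cons /= conv_step avg_lazy_signs -/p add0r mulr1z mulr0z addr0 add0r mulrN1z.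
set w := walk _ xs sq in IH *.
have w1 : sq x <= w x by exact: sq_le_walk.
have w2 : sq x <= w (- x) by rewrite -[leLHS]sqN; exact: sq_le_walk.
set S := \sum_(x <- xs) sq x in IH *.
have S0 : 0 <= S by apply: sumr_ge0 => *; exact: sq_ge0.
have q0 : 0 <= sq x by exact: sq_ge0.
have pn : p * (size xs).+1%:R <= 1.
  by rewrite mulrC ler_pdivrMr// mul1r ler_nat (leq_trans sk).
rewrite -(natr1 (size xs)) in pn *; set n := (size xs)%:R in IH pn *.
have n0 : 0 <= n by rewrite ler0n.
apply: (@le_trans _ _ (p * sq x + (1 - p) * (p * (1 - p * n) * S))).
  have h1 : p * (1 - p * (n + 1)) * sq x <= p * sq x.
    by rewrite ler_wpM2r// ler_piMr ?(ltW p0)// gerBl mulr_ge0 ?addr_ge0// ltW.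
  have h2 : p * (1 - p * (n + 1)) * S <= (1 - p) * (p * (1 - p * n) * S).
    rewrite mulrA ler_wpM2r//.
    have -> : (1 - p) * (p * (1 - p * n)) = p * ((1 - p) * (1 - p * n)) by ring.
    rewrite ler_pM2l//.
    by have := mulr_ge0 (ltW p0) (mulr_ge0 (ltW p0) n0); nra.
  by rewrite mulrDr lerD.
apply: lerD; first by rewrite ler_pM2l//; lra.
by rewrite ler_wpM2l ?subr_ge0.
Qed.

Lemma rademacher_cotype xs :
  \sum_(x <- xs) sq x <= 256 * c * tau * walk [:: 1; -1] xs sq 0.
Proof.
(* Then p times the number of vectors is at most 1/2. Upper and lower bound are both proportional to
   p, which cancels: (1/2) sum |x_i|^2 <= 4 c G. *)
set k := (size xs).*2; have sk : (size xs <= k)%N by rewrite /k; lia.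
have h1 := walk_lazy_ge sk.
have h2 := walk_le_variance xs (coefficient_list_lazy k).
have h3 := sup_normalized_walks_le xs.
rewrite variance_lazy in h2.
have kR : 0 < k.+1%:R :> R by rewrite ltr0n.
have p0 : 0 < k.+1%:R^-1 :> R by rewrite invr_gt0.
have half : 2^-1 <= 1 - k.+1%:R^-1 * (size xs)%:R :> R.
  rewrite lerBrDr -lerBrDl (_ : 1 - 2^-1 = 2^-1 :> R); last by lra.
  by rewrite mulrC ler_pdivrMr// ler_pdivlMl// -natrM ler_nat /k; lia.
set S := \sum_(x <- xs) sq x in h1 *.
have S0 : 0 <= S by apply: sumr_ge0 => *; exact: sq_ge0.
set p := k.+1%:R^-1 in h1 h2 p0 half.
have : p * (2^-1 * S) <= p * (4 * c * sup (normalized_walks xs)).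
  apply: (@le_trans _ _ (p * ((1 - p * (size xs)%:R) * S))).
    by rewrite ler_pM2l// ler_wpM2r.
  by rewrite mulrA (le_trans h1)// (le_trans h2)// mulrCA.
rewrite ler_pM2l// => h4.
have : 4 * c * sup (normalized_walks xs) <= 4 * c * (32 * tau * walk [:: 1; -1] xs sq 0).
  by rewrite ler_pM2l ?mulr_gt0.
by move: h4; lra.
Qed.

End CltToRademacher.

(** * Borel maps and random variables *)

Section BorelMaps.
Context {R : realType} {B : completeNormedModType R}.
Implicit Types (A : set B) (x y : B).

Lemma borel_open A : open A -> borel A.
Proof. by move=> oA; apply: sub_sigma_algebra. Qed.

Lemma borel_set1 x : borel [set x].
Proof.
rewrite -[X in borel X]setCK; apply: measurableC; apply: borel_open.
by apply/closed_openC/accessible_closed_set1/hausdorff_accessible/norm_hausdorff.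
Qed.

Lemma continuous_borel_fun (f : B -> R) : continuous f ->
  measurable_fun [set: borelType] (f : borelType (B := B) -> R).
Proof.
move=> cf; apply: (measurability _ (RGenOpens.measurableE R)) => _ [_ [a [b ->] <-]].
rewrite setTI; apply: borel_open; move/continuousP : cf; apply; exact: itv_open.
Qed.

Lemma random_var_preimage d (T : measurableType d) (X : T -> B) A :
  random_var X -> borel A -> measurable (X @^-1` A).
Proof. by move=> rX bA; rewrite -[X in measurable X]setTI; exact: rX. Qed.

Lemma random_var_comp d (T : measurableType d) (X : T -> B) (f : B -> B) :
  random_var X -> random_var (f : borelType (B := B) -> B) -> random_var (f \o X).
Proof. by move=> rX rf; exact: (measurableT_comp rf rX). Qed.

Lemma random_var_cst d (T : measurableType d) (b : B) :
  random_var (cst b : T -> B).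
Proof. exact: measurable_cst. Qed.

Lemma random_var_continuous d (T : measurableType d) (X : T -> B) (f : B -> R) :
  random_var X -> continuous f -> measurable_fun [set: T] (f \o X).
Proof. by move=> rX /continuous_borel_fun cf; exact: (measurableT_comp cf rX). Qed.

Lemma random_var_norm d (T : measurableType d) (X : T -> B) :
  random_var X -> measurable_fun [set: T] (fun w => `|X w|).
Proof. by move=> rX; apply: (random_var_continuous rX); exact: norm_continuous. Qed.

Lemma continuous_sq : continuous (sq : B -> R).
Proof.
move=> x; rewrite /sq; apply: (@continuous_comp _ _ _ (fun y : B => `|y|) (fun r : R => r ^+ 2)).
  exact: norm_continuous.
exact: exprn_continuous.
Qed.

Lemma random_var_sq d (T : measurableType d) (X : T -> B) :
  random_var X -> measurable_fun [set: T] (sq \o X).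
Proof. by move=> rX; apply: (random_var_continuous rX); exact: continuous_sq. Qed.

End BorelMaps.

(** * Approximation by nearest points of a dense sequence *)

Section NearestPoint.
Context {R : realType} {B : completeNormedModType R}.
Implicit Types (x : B).

Lemma dense_sequence : separable_space B ->
  exists e : nat -> B, forall x (eps : R), 0 < eps -> exists k, `|x - e k| < eps.
Proof.
move=> [D cD dD]; have [g ginj] := countable_injP _ cD.
(* An index that g does not attain yields an arbitrary point, which does not harm density. *)
exists (fun k => get [set y | D y /\ g y = k]) => x eps eps0.
have [y [xy Dy]] : ball x eps `&` D !=set0.
  by apply: dD; [exists x; exact: ballxx|exact: ball_open].
exists (g y); have /getPex [] : [set z | D z /\ g z = g y] !=set0 by exists y.
set z := get _ => Dz gz; have -> : z = y by apply: ginj; rewrite ?inE.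
by move: xy; rewrite -ball_normE.
Qed.

Variable e : nat -> B.

(** The search starts from 0 rather than from the sequence: the distance to x never exceeds |x|, so
    norms at most double, uniformly in k, and 0 is fixed. *)
Fixpoint nearest (k : nat) x : B :=
  if k is k'.+1 then
    if `|x - e k'| < `|x - nearest k' x| then e k' else nearest k' x
  else 0.

Definition nearest_range (k : nat) : seq B := undup (0 :: [seq e i | i <- iota 0 k]).

Lemma nearest_rangeP k x : nearest k x \in nearest_range k.
Proof.
rewrite mem_undup; elim: k => [|k IH]; first by rewrite mem_head.
rewrite -[X in iota _ X]addn1 iotaD map_cat add0n -cat_cons mem_cat [nearest _ _]/=.
by case: ifP => _; [rewrite mem_head orbT|rewrite IH].
Qed.

Lemma nearest_distS k x :
  `|x - nearest k.+1 x| = Num.min `|x - nearest k x| `|x - e k|.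
Proof. by rewrite /= minC /Order.min; case: ifP. Qed.

Lemma nearest_dist_le k j x : (k <= j)%N ->
  `|x - nearest j x| <= `|x - nearest k x|.
Proof.
move=> /subnK <-; elim: (j - k)%N => // i IH; rewrite addSn nearest_distS.
by rewrite ge_min IH.
Qed.

Lemma nearest_dist_le_norm k x : `|x - nearest k x| <= `|x|.
Proof. by have := nearest_dist_le x (leq0n k); rewrite /= subr0. Qed.

Lemma nearest_norm_le k x : `|nearest k x| <= 2 * `|x|.
Proof.
have := ler_normB x (x - nearest k x); rewrite subKr.
by have := nearest_dist_le_norm k x; lra.
Qed.

Lemma nearest0 k : nearest k 0 = 0.
Proof.
by apply/eqP; rewrite -normr_le0; have := nearest_norm_le k 0; rewrite normr0 mulr0.
Qed.

Lemma nearest_cvg x : (forall (eps : R), 0 < eps -> exists k, `|x - e k| < eps) ->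
  nearest ^~ x @ \oo --> x.
Proof.
move=> ed; apply/cvgrPdist_lt => eps /ed [k xk]; exists k.+1 => //= j kj.
rewrite (le_lt_trans (nearest_dist_le x kj))// nearest_distS.
by rewrite gt_min xk orbT.
Qed.

Lemma measurable_nearest k : random_var (nearest k : borelType (B := B) -> B).
Proof.
have md y : measurable_fun [set: borelType] (fun x : borelType (B := B) => `|(x : B) - y|).
  apply: continuous_borel_fun => x; apply: cvg_norm; apply: cvgB => //.
  exact: cvg_cst.
have mn j : measurable_fun [set: borelType] (fun x : borelType (B := B) => `|(x : B) - nearest j x|).
  elim: j => [|j IH]; first exact: md.
  rewrite (_ : (fun x => _) = (fun x : borelType => `|(x : B) - nearest j x|) \min
     (fun x : borelType => `|(x : B) - e j|)); first exact: measurable_minr.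
  by apply/funext => x; rewrite nearest_distS.
elim: k => [|k IH]; first exact: measurable_cst.
by apply: measurable_fun_ifT => //; exact: measurable_fun_ltr.
Qed.

End NearestPoint.

(** * Expectations under products of finite laws *)

Section SequenceMean.
Context {R : realType} {B : completeNormedModType R}.
Implicit Types (mu : seq (R * B)) (phi psi : seq B -> R).

(** The integral of [phi] against the product of the laws [mus]. *)
Fixpoint seq_mean (mus : seq (seq (R * B))) phi : R :=
  if mus is mu :: mus' then
    \sum_(a <- mu) a.1 * seq_mean mus' (fun l => phi (a.2 :: l))
  else phi [::].

(** The integrand of [path_mean], as a function of the list of steps. *)
Fixpoint path_fun (chi f : B -> R) (y : B) (l : seq B) : R :=
  if l is a :: l' then chi (y + a) * path_fun chi f (y + a) l' else f y.

Definition path_of (T : Type) (Z : nat -> T -> B) (chi f : B -> R) (n : nat) (w : T) : R :=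
  path_fun chi f 0 [seq Z j w | j <- iota 0 n].

Lemma eq_seq_mean mus phi psi : phi =1 psi -> seq_mean mus phi = seq_mean mus psi.
Proof.
elim: mus phi psi => /= [|mu mus IH] phi psi e; first exact: e.
by apply: eq_bigr => a _; congr (_ * _); apply: IH => l; exact: e.
Qed.

Lemma seq_meanZ mus (c : R) phi : seq_mean mus (fun l => c * phi l) = c * seq_mean mus phi.
Proof.
elim: mus phi => //= mu mus IH phi; rewrite mulr_sumr; apply: eq_bigr => a _.
by rewrite IH mulrCA.
Qed.

Lemma seq_meanD mus phi psi :
  seq_mean mus (fun l => phi l + psi l) = seq_mean mus phi + seq_mean mus psi.
Proof.
elim: mus phi psi => //= mu mus IH phi psi; rewrite -big_split; apply: eq_bigr => a _.
by rewrite IH mulrDr.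
Qed.

Lemma le_seq_mean mus phi psi : (forall mu, mu \in mus -> law mu) ->
  (forall l, phi l <= psi l) -> seq_mean mus phi <= seq_mean mus psi.
Proof.
elim: mus phi psi => /= [|mu mus IH] phi psi lm e; first exact: e.
have [m0 _] := lm mu (mem_head _ _).
rewrite !big_seq; apply: ler_sum => a am; rewrite ler_wpM2l ?m0// IH// => nu nus.
by apply: lm; rewrite inE nus orbT.
Qed.

Lemma seq_mean_cst mus (c : R) : (forall mu, mu \in mus -> law mu) ->
  seq_mean mus (fun=> c) = c.
Proof.
elim: mus => //= mu mus IH lm; have [_ m1] := lm mu (mem_head _ _).
rewrite -mulr_suml m1 mul1r IH// => nu nus.
by apply: lm; rewrite inE nus orbT.
Qed.

Lemma seq_mean_path chi f mu n y :
  seq_mean (nseq n mu) (path_fun chi f y) = path_mean chi f mu n y.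
Proof.
elim: n y => //= n IH y; apply: eq_bigr => a _; congr (_ * _).
by rewrite seq_meanZ IH.
Qed.

Lemma path_fun1 f y l : path_fun (fun=> 1) f y l = f (y + \sum_(a <- l) a).
Proof.
elim: l y => /= [|a l IH] y; first by rewrite big_nil addr0.
by rewrite mul1r IH big_cons addrA.
Qed.

Lemma path_fun_ge0 chi f y l : (forall u, 0 <= chi u) -> (forall u, 0 <= f u) ->
  0 <= path_fun chi f y l.
Proof. by move=> c0 f0; elim: l y => //= a l IH y; rewrite mulr_ge0. Qed.

Lemma path_fun_le1 chi y l : (forall u, 0 <= chi u <= 1) ->
  path_fun chi (fun=> 1) y l <= 1.
Proof.
move=> c01; elim: l y => //= a l IH y; have /andP[c0 c1] := c01 (y + a).
rewrite -[leRHS]mulr1 ler_pM//; apply: path_fun_ge0 => // u.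
by have /andP[] := c01 u.
Qed.

Lemma path_fun_cvg (chi f : B -> R) (J : eqType) (r : seq J) (x : J -> B)
    (xk : nat -> J -> B) (y : B) (yk : nat -> B) :
  continuous chi -> continuous f ->
  (forall i, (xk ^~ i) @ \oo --> x i) -> yk @ \oo --> y ->
  (fun k => path_fun chi f (yk k) [seq xk k i | i <- r]) @ \oo -->
  path_fun chi f y [seq x i | i <- r].
Proof.
move=> cc cf xx; elim: r y yk => /= [|i r IH] y yk yy.
  by apply: (@continuous_cvg _ _ _ _ _ yk f y) => //; exact: cf.
have yx : (fun k => yk k + xk k i) @ \oo --> y + x i by apply: cvgD.
apply: cvgM; last exact: IH.
by apply: (@continuous_cvg _ _ _ _ _ (fun k => yk k + xk k i) chi) => //; exact: cc.
Qed.

End SequenceMean.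

(** * Integrals of functions of independent finitely valued variables *)

Section FiniteValuedVariables.
Context {R : realType} {B : completeNormedModType R}.
Context {d} {T : measurableType d} (P : probability T R).
Context {I : eqType} (X : I -> T -> B) (V : I -> seq B).
Hypothesis rX : forall i, random_var (X i).
Hypothesis VX : forall i w, X i w \in V i.
Hypothesis uV : forall i, uniq (V i).
Implicit Types (J : seq I) (phi : seq B -> R).

Lemma prob_setT : P [set: T] = 1%E. Proof. exact: probability_setT. Qed.


Definition law_of (Y : T -> B) (W : seq B) : seq (R * B) :=
  [seq (fine (P (Y @^-1` [set v])), v) | v <- W].

Lemma split_values i (F : B -> R) w :
  F (X i w) = \sum_(v <- V i) \1_(X i @^-1` [set v]) w * F v.
Proof.
rewrite (bigD1_seq (X i w))//= indicE mem_set// mul1r big1 ?addr0// => v vX.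
by rewrite indicE memNset ?mul0r//= => Xv; rewrite Xv eqxx in vX.
Qed.

Lemma measurable_finite_valued J phi :
  measurable_fun [set: T] (fun w => phi [seq X i w | i <- J]).
Proof.
elim: J phi => [|i J IH] phi /=; first exact: measurable_cst.
rewrite (_ : (fun w => _) = (fun w => \sum_(v <- V i)
    (\1_(X i @^-1` [set v]) w * phi (v :: [seq X j w | j <- J])))).
  apply: measurable_sum => v; apply: measurable_funM; last exact: (IH (fun l => phi (v :: l))).
  apply: measurable_indic; apply: random_var_preimage => //; exact: borel_set1.
apply/funext => w.
exact: (@split_values i (fun v => phi (v :: [seq X j w | j <- J]))).
Qed.

Hypothesis iX : independent_vars P X.

(** The event over J' makes the induction on J possible: splitting X_i according to its value v
    moves i from J to J' with the constraint {v}, and independence factors the enlarged event. *)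
Lemma integral_indic_finite_valued J J' (A : I -> set B) phi :
  uniq (J ++ J') -> (forall i, borel (A i)) -> (forall l, 0 <= phi l) ->
  (\int[P]_w (\1_(\bigcap_(i in [set` J']) (X i @^-1` A i)) w *
     phi [seq X i w | i <- J])%:E =
   P (\bigcap_(i in [set` J']) (X i @^-1` A i)) *
   (seq_mean [seq law_of (X i) (V i) | i <- J] phi)%:E)%E.
Proof.
elim: J J' A phi => [|i J IH] J' A phi uJ bA phi0.
  have mC : measurable (\bigcap_(i in [set` J']) (X i @^-1` A i)).
    by apply: fin_bigcap_measurable => // i _; exact: random_var_preimage.
  rewrite /= muleC; set C := \bigcap_(i in _) _ in mC *.
  have -> : P C = (\int[P]_w (\1_C w)%:E)%E by rewrite integral_indic// setIT.
  rewrite -ge0_integralZl//; last 2 first.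
    by apply/measurable_EFinP; exact: measurable_indic.
    by rewrite lee_fin.
  by apply: eq_integral => w _; rewrite -EFinM mulrC.
pose C := \bigcap_(i in [set` J']) (X i @^-1` A i).
have /= /andP[iJ uJJ'] := uJ.
have iJ' : i \notin J' by move: iJ; rewrite mem_cat negb_or => /andP[].
pose A' v j := if j == i then [set v] else A j.
have bA' v j : borel (A' v j) by rewrite /A'; case: ifP => _ //; exact: borel_set1.
pose C' v := \bigcap_(j in [set` i :: J']) (X j @^-1` A' v j).
have A'J v j : j \in J' -> A' v j = A j.
  by rewrite /A'; case: eqP => // ->; rewrite (negbTE iJ').
have C'E v : C' v = C `&` X i @^-1` [set v].
  apply/seteqP; split=> w.
    move=> Cw; split; last by have := Cw i; rewrite /= mem_head /A' eqxx; apply.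
    by move=> j /= jJ'; rewrite -(A'J v)//; apply: Cw; rewrite /= inE jJ' orbT.
  move=> [Cw Xv] j /=; rewrite inE => /orP[/eqP ->|jJ']; first by rewrite /A' eqxx.
  by rewrite A'J//; exact: Cw.
have PC' v : P (C' v) = (P C * P (X i @^-1` [set v]))%E.
  rewrite /C' iX//=; last by rewrite iJ'; move: uJJ'; rewrite cat_uniq => /and3P[].
  rewrite big_cons /A' eqxx muleC; congr (_ * _)%E.
  rewrite /C iX//; last by move: uJJ'; rewrite cat_uniq => /and3P[].
  by rewrite !big_seq; apply: eq_bigr => j jJ'; rewrite -/(A' v j) A'J.
have mC' v : measurable (C' v).
  by apply: fin_bigcap_measurable => // j _; exact: random_var_preimage.
under eq_integral => w _.
  rewrite (_ : (_ * _)%:E = (\sum_(v <- V i)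
      (\1_(C' v) w * phi (v :: [seq X j w | j <- J]))%:E)%E); last first.
    rewrite sumEFin; congr (_%:E).
    rewrite /= (@split_values i (fun v => phi (v :: [seq X j w | j <- J]))).
    rewrite mulr_sumr; apply: eq_bigr => v _.
    by rewrite C'E indicI /= mulrA.
  over.
rewrite ge0_integral_sum//; last 2 first.
- move=> v; apply/measurable_EFinP; apply: measurable_funM.
    exact: measurable_indic.
  exact: (measurable_finite_valued J (fun l => phi (v :: l))).
- by move=> v w _; rewrite lee_fin mulr_ge0.
have PCfin : P C \is a fin_num.
  apply: fin_num_measure; apply: fin_bigcap_measurable => // j _.
  exact: random_var_preimage.
rewrite -/C -(fineK PCfin) -EFinM /= big_map/= mulr_sumr -sumEFin.
apply: eq_bigr => v _.
rewrite (IH (i :: J') (A' v) (fun l => phi (v :: l)))//; last first.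
  by rewrite -cat_rcons -cats1 -catA/= -cat1s uniq_catCA/= in uJ *; move: uJ; rewrite /= mem_cat.
rewrite -/(C' v) PC' EFinM -muleA EFinM !fineK//.
by apply: fin_num_measure; apply: random_var_preimage => //; exact: borel_set1.
Qed.

Lemma integral_finite_valued J phi : uniq J -> (forall l, 0 <= phi l) ->
  (\int[P]_w (phi [seq X i w | i <- J])%:E =
   (seq_mean [seq law_of (X i) (V i) | i <- J] phi)%:E)%E.
Proof.
move=> uJ phi0.
have := @integral_indic_finite_valued J [::] (fun=> setT) phi.
rewrite cats0 => /(_ uJ) H.
rewrite (_ : \bigcap_(_ in _) _ = setT) in H; last by apply/seteqP; split.
have {}H := H (fun=> measurableT) phi0.
rewrite prob_setT mul1e in H; rewrite -H.
by apply: eq_integral => w _; rewrite indicT mul1r.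
Qed.

Lemma law_of_law i : law (law_of (X i) (V i)).
Proof.
split=> [_ /mapP[v _ ->]|]; first by rewrite fine_ge0.
have := @integral_finite_valued [:: i] (fun=> 1) isT (fun=> ler01).
rewrite integral_cst// mul1e [X in X = _]prob_setT /= => -[/esym].
by under eq_bigr do rewrite mulr1.
Qed.

End FiniteValuedVariables.

(** * Passage from finite laws to general independent variables *)

Section Discretization.
Context {R : realType} {B : completeNormedModType R}.
Variable e : nat -> B.
Hypothesis e_dense : forall x (eps : R), 0 < eps -> exists k, `|x - e k| < eps.
Context {d} {T : measurableType d} (P : probability T R).
Context {I : eqType} (Z : I -> T -> B) (q : pred B).
Hypothesis rZ : forall i, random_var (Z i).
Hypothesis iZ : independent_vars P Z.
Hypothesis qZ : forall k i w, q (nearest e k (Z i w)).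

(** The predicate q records a property common to all values, such as a norm bound, so that the atoms
    of the law inherit it. *)
Definition grid (k : nat) : seq B := [seq v <- nearest_range e k | q v].

Definition grid_law k i : seq (R * B) := law_of P (nearest e k \o Z i) (grid k).

Lemma random_var_nearest k i : random_var (nearest e k \o Z i).
Proof. by apply: random_var_comp => //; exact: measurable_nearest. Qed.

Lemma nearest_grid k i w : (nearest e k \o Z i) w \in grid k.
Proof. by rewrite mem_filter qZ nearest_rangeP. Qed.

Lemma uniq_grid k : uniq (grid k). Proof. exact: (filter_uniq _ (undup_uniq _)). Qed.

Lemma independent_nearest k : independent_vars P (fun i => nearest e k \o Z i).
Proof.
move=> J A uJ bA; apply: (iZ (A := fun i => nearest e k @^-1` A i) uJ) => i.
exact: (random_var_preimage (measurable_nearest e k) (bA i)).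
Qed.

Lemma grid_law_law k i : law (grid_law k i).
Proof.
apply: (@law_of_law _ _ _ _ P I (fun i => nearest e k \o Z i) (fun=> grid k)).
- by move=> j; exact: random_var_nearest.
- by move=> j w; exact: nearest_grid.
- by move=> j; exact: uniq_grid.
- exact: independent_nearest.
Qed.

Lemma grid_integral k J (phi : seq B -> R) : uniq J -> (forall l, 0 <= phi l) ->
  (\int[P]_w (phi [seq nearest e k (Z i w) | i <- J])%:E =
   (seq_mean [seq grid_law k i | i <- J] phi)%:E)%E.
Proof.
move=> uJ phi0.
apply: (@integral_finite_valued _ _ _ _ P I (fun i => nearest e k \o Z i) (fun=> grid k)) => //.
- by move=> j; exact: random_var_nearest.
- by move=> j w; exact: nearest_grid.
- by move=> j; exact: uniq_grid.
- exact: independent_nearest.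
Qed.

Lemma measurable_grid k J (phi : seq B -> R) :
  measurable_fun [set: T] (fun w => phi [seq nearest e k (Z i w) | i <- J]).
Proof.
apply: (@measurable_finite_valued _ _ _ _ I (fun i => nearest e k \o Z i) (fun=> grid k)).
- by move=> j; exact: random_var_nearest.
- by move=> j w; exact: nearest_grid.
- by move=> j; exact: uniq_grid.
Qed.

Section Limit.
Variables (J : seq I) (phi : seq B -> R).
Hypothesis phi_cvg : forall w,
  (fun k => phi [seq nearest e k (Z i w) | i <- J]) @ \oo --> phi [seq Z i w | i <- J].

Lemma measurable_seq_fun : measurable_fun [set: T] (fun w => phi [seq Z i w | i <- J]).
Proof.
apply: (@measurable_fun_cvg _ _ _ _
  (fun k w => phi [seq nearest e k (Z i w) | i <- J])) => // k.
exact: measurable_grid.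
Qed.

Hypotheses (uJ : uniq J) (phi0 : forall l, 0 <= phi l).
Variable g : T -> R.
Hypothesis ig : P.-integrable setT (EFin \o g).
Hypothesis phi_g : forall k w, phi [seq nearest e k (Z i w) | i <- J] <= g w.

Lemma grid_mean_cvg :
  (\int[P]_w (phi [seq Z i w | i <- J])%:E \is a fin_num)%E /\
  (fun k => seq_mean [seq grid_law k i | i <- J] phi) @ \oo -->
    fine (\int[P]_w (phi [seq Z i w | i <- J])%:E)%E.
Proof.
have [|||||] := @dominated_convergence _ _ _ P setT measurableT
  (fun k w => (phi [seq nearest e k (Z i w) | i <- J])%:E)
  (fun w => (phi [seq Z i w | i <- J])%:E) (EFin \o g).
- by move=> k; apply/measurable_EFinP; exact: measurable_grid.
- by apply/measurable_EFinP; exact: measurable_seq_fun.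
- by apply: aeW => w _; apply: cvg_EFin; [exact: nearW|exact: phi_cvg].
- exact: ig.
- by apply: aeW => w k _; rewrite gee0_abs ?lee_fin.
move=> iphi _ H; split; first exact: integrable_fin_num iphi.
have {}H : (fun k => (seq_mean [seq grid_law k i | i <- J] phi)%:E) @ \oo -->
    (\int[P]_w (phi [seq Z i w | i <- J])%:E)%E.
  apply: cvg_trans H; apply: near_eq_cvg; apply: nearW => k /=.
  by rewrite grid_integral.
rewrite -(fineK (integrable_fin_num _ iphi)) // in H.
exact: fine_cvg H.
Qed.

End Limit.

End Discretization.

(** * Path functionals of i.i.d. sequences as limits of finite walks *)

Section IidPaths.
Context {R : realType} {B : completeNormedModType R}.
Variable e : nat -> B.
Hypothesis e_dense : forall x (eps : R), 0 < eps -> exists k, `|x - e k| < eps.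
Context {d} {T : measurableType d} (P : probability T R).
Variables (Z : nat -> T -> B) (q : pred B).
Hypothesis rZ : forall i, random_var (Z i).
Hypothesis iZ : independent_vars P Z.
Hypothesis lZ : forall i A, borel A -> P (Z i @^-1` A) = P (Z 0%N @^-1` A).
Hypothesis qZ : forall k i w, q (nearest e k (Z i w)).
Implicit Types (chi f : B -> R).

Lemma grid_law_iid k n :
  [seq grid_law e P Z q k i | i <- iota 0 n] = nseq n (grid_law e P Z q k 0%N).
Proof.
apply: (@eq_from_nth _ [::]) => [|i]; first by rewrite size_map size_iota size_nseq.
rewrite size_map size_iota => ilt.
rewrite (nth_map 0%N) ?size_iota// nth_iota// add0n nth_nseq ilt.
apply: eq_map => v; congr (fine _, v); rewrite comp_preimage lZ//.
exact: (random_var_preimage (measurable_nearest e k) (borel_set1 v)).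
Qed.

Lemma path_of_cvg chi f n w : continuous chi -> continuous f ->
  (fun k => path_fun chi f 0 [seq nearest e k (Z i w) | i <- iota 0 n]) @ \oo -->
  path_of Z chi f n w.
Proof.
move=> cc cf; apply: (@path_fun_cvg _ _ chi f _ (iota 0 n) (fun j => Z j w)
  (fun k j => nearest e k (Z j w)) 0 (fun=> 0)) => // [i|].
  by apply: nearest_cvg => eps; exact: e_dense.
exact: cvg_cst.
Qed.

Lemma measurable_path_of chi f n : continuous chi -> continuous f ->
  measurable_fun [set: T] (path_of Z chi f n).
Proof.
move=> cc cf; apply: (@measurable_seq_fun _ _ e _ _ _ Z q) => //.
by move=> w; exact: path_of_cvg.
Qed.

Lemma path_mean_cvg chi f n (c : R) : continuous chi -> continuous f ->
  (forall u, 0 <= chi u) -> (forall u, 0 <= f u) ->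
  (forall k w, path_fun chi f 0 [seq nearest e k (Z i w) | i <- iota 0 n] <= c) ->
  (\int[P]_w (path_of Z chi f n w)%:E \is a fin_num)%E /\
  (fun k => path_mean chi f (grid_law e P Z q k 0%N) n 0) @ \oo -->
    fine (\int[P]_w (path_of Z chi f n w)%:E)%E.
Proof.
move=> cc cf c0 f0 bnd.
have [|||||fin H] := @grid_mean_cvg _ _ e _ _ P _ Z q rZ iZ qZ (iota 0 n)
  (path_fun chi f 0) _ _ _ (cst c).
- by move=> w; exact: path_of_cvg.
- exact: iota_uniq.
- by move=> l; exact: path_fun_ge0.
- exact: finite_measure_integrable_cst.
- exact: bnd.
split; first exact: fin.
apply: cvg_trans H; apply: near_eq_cvg; apply: nearW => k /=.
by rewrite grid_law_iid seq_mean_path.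
Qed.

End IidPaths.

(** * The Bochner expectation as a limit of finite means *)

Section BochnerExpectation.
Context {R : realType} {B : completeNormedModType R}.
Context {d} {T : measurableType d} (P : probability T R).
Implicit Types (Y s t : T -> B) (V W : seq B).

Lemma measurable_fiber Y v : random_var Y -> measurable (Y @^-1` [set v]).
Proof. by move=> rY; apply: random_var_preimage => //; exact: borel_set1. Qed.

Lemma simple_expectation_mean Y V : uniq V -> (forall w, Y w \in V) ->
  simple_expectation P Y = mean (law_of P Y V).
Proof.
move=> uV YV; rewrite /simple_expectation (fsbig_widen _ [set` V]); last 2 first.
- by move=> _ [w _ <-] /=.
- move=> v [_ /= vY]; rewrite (_ : Y @^-1` [set v] = set0) ?measure0 ?scale0r//.
  by apply/seteqP; split=> // w /= Yw; apply: vY; exists w.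
by rewrite -fsbig_seq// /mean big_map.
Qed.

Lemma simple_varP Y : simple_var Y <->
  random_var Y /\ exists V, uniq V /\ forall w, Y w \in V.
Proof.
split=> [[rY /finite_seqP [V YV]]|[rY [V [uV YV]]]]; split=> //.
  exists (undup V); rewrite undup_uniq; split=> // w; rewrite mem_undup.
  by have : range Y (Y w) by [exists w]; rewrite YV.
by apply: (sub_finite_set _ (finite_seq V)) => _ [w _ <-] /=.
Qed.

(** Both means can be computed from the joint law p of (s, t); their difference is the sum of p(v,
    v') (v - v'). *)
Lemma mean_law_of_dist s t V W : random_var s -> random_var t ->
  uniq V -> uniq W -> (forall w, s w \in V) -> (forall w, t w \in W) ->
  (`|mean (law_of P s V) - mean (law_of P t W)|%:E <=
   \int[P]_w `|s w - t w|%:E)%E.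
Proof.
move=> rs rt uV uW sV tW.
pose E v v' := s @^-1` [set v] `&` t @^-1` [set v'].
have mE v v' : measurable (E v v') by apply: measurableI; exact: measurable_fiber.
pose p v v' : R := fine (P (E v v')).
have pE v v' : (\int[P]_w (\1_(E v v') w)%:E = (p v v')%:E)%E.
  by rewrite integral_indic// setIT fineK// fin_num_measure.
have EV w (F : B -> B -> R) :
    F (s w) (t w) = \sum_(v <- V) \sum_(v' <- W) \1_(E v v') w * F v v'.
  rewrite (bigD1_seq (s w))//= [X in _ + X]big1 ?addr0 => [|v vs]; last first.
    rewrite big1// => v' _; rewrite indicE memNset ?mul0r// => -[/= sv _].
    by rewrite sv eqxx in vs.
  rewrite (bigD1_seq (t w))//= big1 ?addr0 => [|v' vs]; last first.
    rewrite indicE memNset ?mul0r// => -[/= _ tv].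
    by rewrite tv eqxx in vs.
  by rewrite indicE mem_set// mul1r.
have intF (F : B -> B -> R) : (forall v v', 0 <= F v v') ->
    (\int[P]_w (F (s w) (t w))%:E =
     (\sum_(v <- V) \sum_(v' <- W) p v v' * F v v')%:E)%E.
  move=> F0; under eq_integral => w _.
    rewrite (EV w F) -sumEFin; under eq_bigr => v _ do rewrite -sumEFin.
    over.
  have mF v v' : measurable_fun [set: T] (fun w => (\1_(E v v') w * F v v')%:E).
    apply/measurable_EFinP; apply: measurable_funM; last exact: measurable_cst.
    exact: measurable_indic.
  have F0' v v' w : (0 <= (\1_(E v v') w * F v v')%:E)%E by rewrite lee_fin mulr_ge0.
  rewrite ge0_integral_sum//=; last 2 first.
  - by move=> v; exact: emeasurable_sum.
  - by move=> v w _; apply: sume_ge0.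
  rewrite -sumEFin; apply: eq_bigr => v _.
  rewrite ge0_integral_sum//= -sumEFin; apply: eq_bigr => v' _.
  under eq_integral => w _ do rewrite mulrC EFinM.
  rewrite ge0_integralZl//; last 2 first.
  - by apply/measurable_EFinP; exact: measurable_indic.
  - by rewrite lee_fin.
  by rewrite pE muleC.
(* A marginal of p, obtained from [intF] with the indicator of the value v. *)
have ms v : v \in V -> fine (P (s @^-1` [set v])) = \sum_(v' <- W) p v v'.
  move=> vV; apply: EFin_inj; rewrite fineK ?fin_num_measure//; last exact: measurable_fiber.
  have := intF (fun u _ => (u == v)%:R) (fun _ _ => ler0n _ _).
  rewrite (bigD1_seq v)//= [X in _ + X]big1 ?addr0 => [|u uv]; last first.
    by rewrite big1// => v' _; rewrite (negbTE uv) mulr0.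
  under [in RHS]eq_bigr do rewrite eqxx mulr1.
  move=> <-; transitivity (\int[P]_w (\1_(s @^-1` [set v]) w)%:E)%E.
    by rewrite integral_indic ?setIT//; exact: measurable_fiber.
  apply: eq_integral => w _; congr (_%:E); rewrite indicE.
  case: eqP => [<-|sv]; first by rewrite mem_set.
  by rewrite memNset.
have mt v' : v' \in W -> fine (P (t @^-1` [set v'])) = \sum_(v <- V) p v v'.
  move=> vW; apply: EFin_inj; rewrite fineK ?fin_num_measure//; last exact: measurable_fiber.
  have := intF (fun _ u => (u == v')%:R) (fun _ _ => ler0n _ _).
  under eq_bigr => v _.
    rewrite (bigD1_seq v')//= big1 ?addr0 => [|u uv]; last by rewrite (negbTE uv) mulr0.
    rewrite eqxx mulr1; over.
  move=> <-; transitivity (\int[P]_w (\1_(t @^-1` [set v']) w)%:E)%E.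
    by rewrite integral_indic ?setIT//; exact: measurable_fiber.
  apply: eq_integral => w _; congr (_%:E); rewrite indicE.
  case: eqP => [<-|sv]; first by rewrite mem_set.
  by rewrite memNset.
rewrite (intF (fun u v => `|u - v|))// lee_fin.
have -> : mean (law_of P s V) - mean (law_of P t W) =
    \sum_(v <- V) \sum_(v' <- W) p v v' *: (v - v').
  rewrite /mean !big_map/=.
  have -> : \sum_(v <- V) fine (P (s @^-1` [set v])) *: v =
      \sum_(v <- V) \sum_(v' <- W) p v v' *: v.
    by rewrite !big_seq; apply: eq_bigr => v vV; rewrite ms// scaler_suml.
  have -> : \sum_(v <- W) fine (P (t @^-1` [set v])) *: v =
      \sum_(v <- V) \sum_(v' <- W) p v v' *: v'.
    rewrite exchange_big/= !big_seq; apply: eq_bigr => v vV.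
    by rewrite mt// scaler_suml.
  rewrite -sumrB; apply: eq_bigr => v _; rewrite -sumrB; apply: eq_bigr => v' _.
  by rewrite scalerBr.
apply: (le_trans (ler_norm_sum _ _ _)); apply: ler_sum => v _.
apply: (le_trans (ler_norm_sum _ _ _)); apply: ler_sum => v' _.
by rewrite normrZ ger0_norm// fine_ge0.
Qed.

Lemma measurable_dist Y s V : random_var Y -> random_var s ->
  uniq V -> (forall w, s w \in V) ->
  measurable_fun [set: T] (fun w => `|Y w - s w|%:E : \bar R).
Proof.
move=> rY rs uV sV; apply/measurable_EFinP.
rewrite (_ : (fun w => _) = fun w => \sum_(v <- V) (\1_(s @^-1` [set v]) w * `|Y w - v|)).
  apply: measurable_sum => v; apply: measurable_funM.
    by apply: measurable_indic; exact: measurable_fiber.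
  apply: (@random_var_continuous _ _ _ _ Y (fun y : B => `|y - v|)) => // y.
  by apply: cvg_norm; apply: cvgB => //; exact: cvg_cst.
apply/funext => w.
rewrite (bigD1_seq (s w))//= indicE mem_set// mul1r big1 ?addr0// => v vs.
by rewrite indicE memNset ?mul0r//= => sv; rewrite sv eqxx in vs.
Qed.

Lemma simple_expectation_dist Y s t : random_var Y -> simple_var s -> simple_var t ->
  (`|simple_expectation P s - simple_expectation P t|%:E <=
   \int[P]_w `|Y w - s w|%:E + \int[P]_w `|Y w - t w|%:E)%E.
Proof.
move=> rY /simple_varP[rs [V [uV sV]]] /simple_varP[rt [W [uW tW]]].
rewrite (simple_expectation_mean uV sV) (simple_expectation_mean uW tW).
apply: (le_trans (mean_law_of_dist rs rt uV uW sV tW)).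
have mYs := measurable_dist rY rs uV sV; have mYt := measurable_dist rY rt uW tW.
rewrite -ge0_integralD//; apply: ge0_le_integral => //.
- exact: (measurable_dist rs rt uW tW).
- exact: emeasurable_funD.
move=> w _; rewrite -EFinD lee_fin.
rewrite (_ : s w - t w = (Y w - t w) - (Y w - s w)); last by rewrite opprB [RHS]addrC addrA subrK.
by rewrite (le_trans (ler_normB _ _))// addrC.
Qed.

Lemma has_expectation_unique Y (m m' : B) :
  has_expectation P Y m -> has_expectation P Y m' -> m = m'.
Proof.
move=> [rY [s [ss sY sm]]] [_ [t [st tY tm]]].
have D : (fun k => `|simple_expectation P (s k) - simple_expectation P (t k)|%:E)
    @ \oo --> 0%E.
  apply: (@squeeze_cvge _ _ _ _ (fun=> 0%E) _
    (fun k => \int[P]_w `|Y w - s k w|%:E + \int[P]_w `|Y w - t k w|%:E)%E).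
  - by apply: nearW => k; rewrite lee_fin normr_ge0/=; exact: simple_expectation_dist.
  - exact: cvg_cst.
  - by rewrite -[0%E]adde0; apply: cvgeD.
have {}D : (fun k => `|simple_expectation P (s k) - simple_expectation P (t k)|)
    @ \oo --> (0 : R) by exact: (fine_cvg D).
have M : (fun k => `|simple_expectation P (s k) - simple_expectation P (t k)|)
    @ \oo --> `|m - m'| by apply: cvg_norm; apply: cvgB.
have : `|m - m'| = 0 by exact: (@cvg_unique _ (@Rhausdorff R) _ _ _ _ M D).
by move/eqP; rewrite normr_eq0 subr_eq0 => /eqP.
Qed.

Lemma has_expectation_bochner Y (m : B) : has_expectation P Y m ->
  bochner_expectation P Y = m.
Proof.
move=> Ym; have /getPex H : [set m | has_expectation P Y m] !=set0 by exists m.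
exact: has_expectation_unique H Ym.
Qed.

Lemma bochner_expectation_simple Y V : random_var Y -> uniq V ->
  (forall w, Y w \in V) -> bochner_expectation P Y = mean (law_of P Y V).
Proof.
move=> rY uV YV; apply: has_expectation_bochner; split=> //.
exists (fun=> Y); split.
- by move=> _; apply/simple_varP; split=> //; exists V.
- under eq_fun => k do under eq_integral => w _ do rewrite subrr normr0.
  by rewrite integral0; exact: cvg_cst.
- rewrite (simple_expectation_mean uV YV); exact: cvg_cst.
Qed.

Variable e : nat -> B.
Hypothesis e_dense : forall x (eps : R), 0 < eps -> exists k, `|x - e k| < eps.

(** The nearest points of Y converge to Y in L^1, dominated by |Y|. Hence their means form a Cauchy
    sequence, and completeness supplies the expectation itself. *)
Lemma bochner_expectation_cvg Y : random_var Y ->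
  (\int[P]_w `|Y w|%:E < +oo)%E ->
  (fun k => simple_expectation P (nearest e k \o Y)) @ \oo --> bochner_expectation P Y.
Proof.
move=> rY iY.
have mY : measurable_fun [set: T] (fun w => `|Y w|%:E : \bar R).
  by apply/measurable_EFinP; exact: random_var_norm.
have rn k : random_var (nearest e k \o Y).
  by apply: random_var_comp => //; exact: measurable_nearest.
have Vn k w : (nearest e k \o Y) w \in nearest_range e k by exact: nearest_rangeP.
have ss k : simple_var (nearest e k \o Y).
  apply/simple_varP; split=> //; exists (nearest_range e k).
  by rewrite undup_uniq.
have D0 : (fun k => \int[P]_w `|Y w - (nearest e k \o Y) w|%:E)%E @ \oo --> 0%E.
  have [|||||_ _] := @dominated_convergence _ _ _ P setT measurableT
    (fun k w => `|Y w - (nearest e k \o Y) w|%:E) (fun=> 0%E) (fun w => `|Y w|%:E).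
  - by move=> k; apply: (measurable_dist rY (rn k) _ (Vn k)); exact: undup_uniq.
  - exact: measurable_cst.
  - apply: aeW => w _; apply: cvg_EFin; first exact: nearW.
    apply/norm_cvg0P; rewrite -(subrr (Y w)); apply: cvgB; first exact: cvg_cst.
    by apply: nearest_cvg => eps; exact: e_dense.
  - apply/integrableP; split => //.
    by under eq_integral => w _ do rewrite gee0_abs ?lee_fin//.
  - by apply: aeW => w k _; rewrite gee0_abs ?lee_fin// nearest_dist_le_norm.
  by rewrite integral0.
suff [m Hm] : exists m : B, (fun k => simple_expectation P (nearest e k \o Y)) @ \oo --> m.
  rewrite (@has_expectation_bochner Y m)//; split=> //.
  by exists (fun k => nearest e k \o Y).
have Dfin := cvg_is_fine D0.
suff : cvg ((fun k => simple_expectation P (nearest e k \o Y)) @ \oo).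
  by move=> /cvg_ex[m Hm]; exists m.
apply/cauchy_cvgP/cauchy_ballP => eps eps0; near_simpl.
have e20 : 0 < eps / 2 by rewrite divr_gt0.
pose I k := (\int[P]_w `|Y w - (nearest e k \o Y) w|%:E)%E.
have D0' : (fun k => fine (I k)) @ \oo --> (0 : R) by exact: (fine_cvg D0).
have HI : \forall k \near \oo, I k \is a fin_num /\ fine (I k) < eps / 2.
  have H2 : \forall k \near \oo, fine (I k) < eps / 2.
    move/cvgrPdist_lt : D0' => /(_ _ e20); apply: filterS => k; rewrite sub0r normrN.
    by apply: le_lt_trans; exact: ler_norm.
  by apply: filterS2 Dfin H2.
near=> k l; rewrite -ball_normE /=.
have [fa ha] : I k \is a fin_num /\ fine (I k) < eps / 2 by near: k.
have [fb hb] : I l \is a fin_num /\ fine (I l) < eps / 2 by near: l.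
have := simple_expectation_dist rY (ss k) (ss l); rewrite -/(I k) -/(I l).
rewrite -(fineK fa) -(fineK fb) -EFinD lee_fin => h; apply: (le_lt_trans h).
by rewrite [eps]splitr ltrD.
Unshelve. all: by end_near. Qed.

End BochnerExpectation.

(** * Staying events and the exit time *)

Section StayingEvents.
Context {R : realType} {B : completeNormedModType R}.
Context {T : Type} (Z : nat -> T -> B).
Implicit Types (chi : B -> R) (r : R) (n : nat) (w : T).

Definition stays r n : set T :=
  [set w | forall k, (1 <= k <= n)%N -> `|partial_sum Z k w| <= r].

Lemma stays0 r : stays r 0 = setT.
Proof. by apply/seteqP; split=> // w _ k /andP[k1 k0]; move: (leq_trans k1 k0). Qed.

Lemma staysS r n w : stays r n.+1 w <-> stays r n w /\ `|partial_sum Z n.+1 w| <= r.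
Proof.
split=> [H|[H Hn] k /andP[k1]].
  split; last by apply: H; rewrite ltnSn.
  by move=> k /andP[k1 kn]; apply: H; rewrite k1 ltnW.
by rewrite leq_eqVlt => /predU1P[->//|]; rewrite ltnS => kn; apply: H; rewrite k1.
Qed.

Lemma stays_le r n m : (n <= m)%N -> stays r m `<=` stays r n.
Proof. by move=> nm w H k /andP[k1 kn]; apply: H; rewrite k1 (leq_trans kn). Qed.

Lemma path_fun_rcons chi y l a :
  path_fun chi (fun=> 1) y (rcons l a) =
  path_fun chi (fun=> 1) y l * chi (y + \sum_(b <- rcons l a) b).
Proof.
elim: l y => /= [|b l IH] y; first by rewrite big_seq1 mulr1 mul1r.
by rewrite IH big_cons mulrA addrA.
Qed.

Lemma partial_sum_iota n w : partial_sum Z n w = \sum_(b <- [seq Z j w | j <- iota 0 n]) b.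
Proof.
by rewrite big_map /partial_sum -(big_mkord xpredT (fun j => Z j w)) /index_iota subn0.
Qed.

Lemma path_ofS chi n w : path_of Z chi (fun=> 1) n.+1 w =
  path_of Z chi (fun=> 1) n w * chi (partial_sum Z n.+1 w).
Proof.
rewrite /path_of partial_sum_iota -[X in iota _ X]addn1 iotaD map_cat cats1 /=.
by rewrite path_fun_rcons add0r.
Qed.

Lemma path_of_fun1 (f : B -> R) n w :
  path_of Z (fun=> 1) f n w = f (partial_sum Z n w).
Proof. by rewrite /path_of path_fun1 add0r partial_sum_iota. Qed.

Lemma path_of_cutoff_ge r n w : 0 < r ->
  \1_(stays r n) w <= path_of Z (cutoff r) (fun=> 1) n w.
Proof.
move=> r0; rewrite indicE; case: (boolP (w \in _)); last first.
  by move=> _; apply: path_fun_ge0 => // u; exact: cutoff_ge0.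
rewrite inE; elim: n => // n IH /staysS [/IH h hn].
by rewrite path_ofS cutoff1// mulr1.
Qed.

Lemma path_of_cutoff_le r n w : 0 < r ->
  path_of Z (cutoff r) (fun=> 1) n w <= \1_(stays (2 * r) n) w.
Proof.
move=> r0; rewrite indicE; case: (boolP (w \in _)).
  by move=> _; apply: path_fun_le1 => // u; rewrite cutoff_ge0 cutoff_le1.
rewrite notin_setE => ns; rewrite le_eqVlt; apply/orP; left; apply/eqP.
elim: n ns => [|n IH] ns; first by exfalso; apply: ns; rewrite stays0.
rewrite path_ofS; have [s|/IH ->] := pselect (stays (2 * r) n w); last by rewrite mul0r.
rewrite cutoff0 ?mulr0// leNgt; apply/negP => /ltW h.
by apply: ns; apply/staysS.
Qed.

Lemma path_of_indic r n w :
  path_of Z (fun u => (`|u| <= r)%R%:R) (fun=> 1) n w = \1_(stays r n) w :> R.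
Proof.
elim: n => [|n IH]; first by rewrite stays0 indicT.
rewrite path_ofS IH !indicE -natrM mulnb; congr (_%:R); apply/congr1.
apply/idP/idP => [/andP[]|]; rewrite !inE => h.
  by move=> h2; apply/staysS.
by have [h1 h2] := (staysS r n w).1 h; apply/andP; rewrite inE.
Qed.

Lemma exit_time_gt r n : [set w | ((n%:R)%:E < exit_time Z r w)%E] = stays r n.
Proof.
apply/seteqP; split=> w /=.
  move=> h k /andP[k1 kn]; rewrite leNgt; apply/negP => rk.
  have : (exit_time Z r w <= (k%:R)%:E)%E by apply: ereal_inf_lbound; exists k.
  by move=> /(lt_le_trans h); rewrite lte_fin ltr_nat ltnNge kn.
move=> h; apply: (@lt_le_trans _ _ (n.+1%:R)%:E); first by rewrite lte_fin ltr_nat.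
apply: le_ereal_inf_tmp => _ [k [k1 rk] <-]; rewrite lee_fin ler_nat ltnNge.
by apply/negP => kn; move: rk; rewrite ltNge h// k1.
Qed.

(** The tail-sum formula, also valid when T_r = +oo; the term n = 0 is 1 because T_r >= 1.
    Measurability and the integral of T_r are both read off from it. *)
Lemma exit_time_series r w :
  exit_time Z r w = (\sum_(0 <= n <oo) (\1_(stays r n) w)%:E)%E.
Proof.
have [H|/existsNP[n0 Hn0]] := pselect (forall n, stays r n w).
  transitivity (+oo%E : \bar R).
    rewrite /exit_time (_ : [set _ | _ in _] = set0) ?ereal_inf0//.
    apply/seteqP; split=> // _ [k [k1 rk] <-]; move: rk.
    by rewrite ltNge (H k k)// k1 leqnn.
  apply/esym/cvg_lim => //; apply/cvgeyPge => A.
  exists (Num.truncn A).+1 => // N /= AN.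
  under eq_bigr => k _ do rewrite indicE mem_set//.
  rewrite sumEFin lee_fin sumr_const_nat subn0.
  by rewrite (le_trans (ltW (truncnS_gt A)))// ler_nat.
have [n /asboolP Hn nmin] := ex_minnP (ex_intro (fun n => `[< ~ stays r n w >]) n0 (asboolT Hn0)).
have nS k : (k < n)%N -> stays r k w.
  by move=> kn; apply: contrapT => /asboolP /nmin; rewrite leqNgt kn.
have nN k : (n <= k)%N -> ~ stays r k w by move=> nk /(stays_le nk).
transitivity ((n%:R)%:E : \bar R).
  case: n Hn nmin nS nN => [|n] Hn nmin nS nN; first by exfalso; apply: Hn; rewrite stays0.
  apply/eqP; rewrite eq_le; apply/andP; split.
    apply: ereal_inf_lbound; exists n.+1 => //; split=> //.
    rewrite ltNge; apply/negP => h; apply: Hn; apply/staysS; split=> //.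
    exact: nS.
  apply: le_ereal_inf_tmp => _ [k [k1 rk] <-]; rewrite lee_fin ler_nat leqNgt.
  apply/negP => kn; have := nS k kn; move=> /(_ k); rewrite k1 leqnn => /(_ isT).
  by rewrite leNgt rk.
apply/esym/cvg_lim => //; apply: cvg_near_cst; exists n => // N /= nN'.
rewrite (big_cat_nat _ nN')//= [X in (_ + X)%E]big_nat.
rewrite [X in (_ + X)%E]big1 ?adde0 => [|k /andP[nk _]]; last first.
  by rewrite indicE memNset//; exact: nN.
rewrite big_nat (eq_bigr (fun=> 1%:E)) => [|k /andP[_ kn]]; last first.
  by rewrite indicE mem_set//; exact: nS.
by rewrite -big_nat sumEFin sumr_const_nat subn0.
Qed.

End StayingEvents.

(** * Measurability and mean of the exit time *)

Section ExitTimeIntegral.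
Context {R : realType} {B : completeNormedModType R}.
Variable e : nat -> B.
Hypothesis e_dense : forall x (eps : R), 0 < eps -> exists k, `|x - e k| < eps.
Context {d} {T : measurableType d} (P : probability T R).
Variables (Z : nat -> T -> B).
Hypothesis rZ : forall i, random_var (Z i).

(** Separability enters here: |S_n| is a pointwise limit of functions of finitely valued
    variables. *)
Lemma measurable_norm_partial_sum n : measurable_fun [set: T] (fun w => `|partial_sum Z n w|).
Proof.
rewrite (_ : (fun w => _) = path_of Z (fun=> 1) (fun u => `|u|) n).
  apply: (@measurable_path_of _ _ e e_dense _ _ Z xpredT) => //.
    by move=> ?; exact: cvg_cst.
  exact: norm_continuous.
by apply/funext => w; rewrite path_of_fun1.
Qed.

Lemma measurable_stays r n : measurable (stays Z r n).
Proof.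
elim: n => [|n IH]; first by rewrite stays0; exact: measurableT.
rewrite (_ : stays Z r n.+1 = stays Z r n `&` [set w | `|partial_sum Z n.+1 w| <= r]).
  apply: measurableI => //.
  have -> : [set w | `|partial_sum Z n.+1 w| <= r] =
      [set: T] `&` (fun w => `|partial_sum Z n.+1 w|) @^-1` `]-oo, r].
    by apply/seteqP; split=> w /=; rewrite in_itv/=; tauto.
  by apply: measurable_norm_partial_sum => //; exact: measurable_itv.
by apply/seteqP; split=> w /staysS.
Qed.

Lemma integral_exit_time r :
  (\int[P]_w exit_time Z r w = \sum_(0 <= n <oo) P (stays Z r n))%E.
Proof.
under eq_integral => w _ do rewrite exit_time_series.
rewrite integral_nneseries//.
  by apply: eq_eseriesr => n _; rewrite integral_indic ?setIT//; exact: measurable_stays.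
by move=> n; apply/measurable_EFinP; apply: measurable_indic; exact: measurable_stays.
Qed.

Lemma measurable_exit_time r : measurable_fun [set: T] (exit_time Z r).
Proof.
rewrite (_ : exit_time Z r = fun w => (\sum_(0 <= n <oo) (\1_(stays Z r n) w)%:E)%E).
  apply: ge0_emeasurable_sum => n //.
  by move=> _; apply/measurable_EFinP; apply: measurable_indic; exact: measurable_stays.
by apply/funext => w; rewrite exit_time_series.
Qed.

Lemma exit_time_ge0 r w : (0 <= exit_time Z r w)%E.
Proof. by apply: le_ereal_inf_tmp => _ [k _ <-]; rewrite lee_fin. Qed.

Lemma markov_exit_time r n :
  ((n%:R)%:E * P (stays Z r n) <= \int[P]_w exit_time Z r w)%E.
Proof.
have mS := measurable_stays r n.
have <- : (\int[P]_w ((n%:R)%:E * (\1_(stays Z r n) w)%:E) = (n%:R)%:E * P (stays Z r n))%E.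
  have mI : measurable_fun [set: T] (fun w => (\1_(stays Z r n) w)%:E : \bar R).
    by apply/measurable_EFinP; exact: measurable_indic.
  rewrite (ge0_integralZl P measurableT mI) ?lee_fin//.
  by rewrite integral_indic// setIT.
apply: ge0_le_integral => //.
- by apply: measurable_funeM; apply/measurable_EFinP; exact: measurable_indic.
- exact: measurable_exit_time.
move=> w _; rewrite indicE; case: (boolP (w \in _)) => [|_].
  by rewrite inE -exit_time_gt /= mule1 => /ltW.
by rewrite mule0; exact: exit_time_ge0.
Qed.

End ExitTimeIntegral.

(** * Independence under Borel maps, translations and truncations *)

Section IndependentMaps.
Context {R : realType} {B : completeNormedModType R}.
Context {d} {T : measurableType d} (P : probability T R).

Lemma independent_comp (I : eqType) (X : I -> T -> B) (f : I -> B -> B) :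
  (forall i, random_var (f i : borelType (B := B) -> B)) ->
  independent_vars P X -> independent_vars P (fun i => f i \o X i).
Proof.
move=> rf iX J A uJ bA; apply: (iX J (fun i => f i @^-1` A i) uJ) => i.
exact: (random_var_preimage (rf i) (bA i)).
Qed.

Lemma independent_ord (X : nat -> T -> B) n :
  independent_vars P X -> independent_vars P (fun i : 'I_n => X i).
Proof.
move=> iX J A uJ bA.
pose A' (j : nat) := if insub j is Some i then A (i : 'I_n) else setT.
have bA' j : borel (A' j) by rewrite /A'; case: insubP => // _; exact: measurableT.
have A'E (i : 'I_n) : A' i = A i by rewrite /A' valK.
have := iX [seq val i | i <- J] A'; rewrite map_inj_uniq; last exact: val_inj.
move=> /(_ uJ bA'); rewrite big_map.
under eq_bigr => i _ do rewrite A'E.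
move=> <-; congr (P _); apply/seteqP; split=> w Hw.
  by move=> _ /mapP[i iJ ->]; rewrite A'E; exact: Hw.
by move=> i iJ /=; rewrite -A'E; apply: (Hw (val i)); apply: map_f.
Qed.

Lemma random_var_translate (b : B) :
  random_var ((fun x => x - b) : borelType (B := B) -> B).
Proof.
rewrite /random_var; apply: (@measurability _ _ _ borelType _ _ (@open B)) => [//|_ [A oA <-]].
rewrite setTI; apply: borel_open; apply: open_comp => // x _.
by apply: cvgB => //; exact: cvg_cst.
Qed.

Lemma random_var_trunc (r : R) :
  random_var ((fun x => if `|x| <= r then x else 0) : borelType (B := B) -> B).
Proof.
apply: measurable_fun_ifT => //; last first.
apply: measurable_fun_ler => //.
by apply: continuous_borel_fun; exact: norm_continuous.
Qed.

End IndependentMaps.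

(** * Walks with i.i.d. finitely valued steps, and cotype 2 *)

Section IidFiniteValued.
Context {R : realType} {B : completeNormedModType R}.
Context {d} {T : measurableType d} (P : probability T R).
Variables (Y : nat -> T -> B) (V : seq B).
Hypothesis rY : forall i, random_var (Y i).
Hypothesis VY : forall i w, Y i w \in V.
Hypothesis uV : uniq V.
Hypothesis iY : independent_vars P Y.
Hypothesis lY : forall i A, borel A -> P (Y i @^-1` A) = P (Y 0%N @^-1` A).

Let mu := law_of P (Y 0%N) V.

Lemma law_of_iid i : law_of P (Y i) V = mu.
Proof.
apply: eq_map => v; congr (fine _, v); apply: lY; exact: borel_set1.
Qed.

Lemma law_iid : law mu.
Proof. exact: (law_of_law rY VY (fun=> uV) iY). Qed.

Lemma integral_path_fun (chi f : B -> R) n y :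
  (forall u, 0 <= chi u) -> (forall u, 0 <= f u) ->
  (\int[P]_w (path_fun chi f y [seq Y j w | j <- iota 0 n])%:E =
   (path_mean chi f mu n y)%:E)%E.
Proof.
move=> c0 f0; rewrite (integral_finite_valued rY VY (fun=> uV) iY) ?iota_uniq//; last first.
  by move=> l; exact: path_fun_ge0.
congr (_%:E); rewrite -seq_mean_path; congr seq_mean.
apply: (@eq_from_nth _ [::]) => [|i]; first by rewrite size_map size_iota size_nseq.
rewrite size_map size_iota => ilt.
by rewrite (nth_map 0%N) ?size_iota// nth_iota// add0n nth_nseq ilt law_of_iid.
Qed.

Lemma integral_fun1 (f : B -> R) i y : (forall u, 0 <= f u) ->
  (\int[P]_w (f (y + Y i w))%:E = (conv mu f y)%:E)%E.
Proof.
move=> f0.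
have := @integral_finite_valued _ _ _ _ P _ Y (fun=> V) rY VY (fun=> uV) iY [:: i]
  (path_fun (fun=> 1) f y) isT.
move=> /(_ (fun l => path_fun_ge0 y l (fun=> ler01) f0)) /= H.
rewrite law_of_iid in H.
transitivity (\int[P]_w (1 * f (y + Y i w))%:E)%E.
  by apply: eq_integral => w _; rewrite mul1r.
rewrite H; congr (_%:E); apply: eq_bigr => a _; by rewrite mul1r.
Qed.

(** Cotype 2 for the centered variables Y_i - m. Centering is expressed by the starting point: -m
    for one step, -n m for n steps. *)
Lemma cotype2_iid (c : R) n : cotype2_with B c -> (1 <= n)%N ->
  c * n%:R * conv mu sq (- mean mu) <= iter n (conv mu) sq (- (mean mu *+ n)).
Proof.
move=> cB n1; set m := mean mu.
pose X (i : 'I_n) w := Y i w - m.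
have rX i : random_var (X i) := random_var_comp (rY i) (random_var_translate m).
have mX i : second_moment P (X i) = (conv mu sq (- m))%:E.
  rewrite /second_moment unlock -(integral_fun1 i) => [|u]; last exact: sq_ge0.
  by apply: eq_integral => w _; rewrite /sq addrC.
have EX i : bochner_expectation P (X i) = 0.
  pose W := undup [seq v - m | v <- V].
  have XW w : X i w \in W by rewrite mem_undup; exact: (map_f (fun v => v - m) (VY i w)).
  rewrite (bochner_expectation_simple P (rX i) _ XW) ?undup_uniq//.
  apply/eqP; rewrite -normr_eq0 -sqrf_eq0 -/(sq _) eq_le sq_ge0 andbT.
  have -> : mean (law_of P (X i) W) = \sum_(v <- V) fine (P (Y i @^-1` [set v])) *: (v - m).
    have uVm : uniq [seq v - m | v <- V] by rewrite map_inj_uniq//; exact: addIr.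
    rewrite /mean big_map /W (undup_id uVm) big_map; apply: eq_bigr => v _ /=.
    congr (fine (P _) *: _); apply/seteqP; split=> w /=; rewrite /X; last by move=> ->.
    by move/addIr.
  under eq_bigr do rewrite scalerBr.
  rewrite sumrB -scaler_suml.
  have -> : \sum_(v <- V) fine (P (Y i @^-1` [set v])) *: v = m.
    by rewrite /m -(law_of_iid i) /mean big_map.
  have -> : \sum_(v <- V) fine (P (Y i @^-1` [set v])) = 1.
    by have [_] := law_iid; rewrite -(law_of_iid i) big_map.
  by rewrite scale1r subrr /sq normr0 expr0n.
have := cB n d T P X n1 rX.
have iX : independent_vars P X.
  apply: (@independent_comp _ _ _ _ P _ (fun i : 'I_n => Y i) (fun _ x => x - m)).
    by move=> _; exact: random_var_translate.
  exact: independent_ord.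
move=> /(_ iX EX) H.
have {}H : (c%:E * \sum_(i < n) second_moment P (X i) <=
    second_moment P (fun w => (\sum_(i < n) X i w)%R))%E.
  by apply: H => i; rewrite mX ltry.
have E2 : second_moment P (fun w => (\sum_(i < n) X i w)%R) =
    (iter n (conv mu) sq (- (m *+ n)))%:E.
  rewrite -path_mean1 -integral_path_fun//.
  rewrite /second_moment unlock; apply: eq_integral => w _; congr (_%:E).
  rewrite path_fun1 /sq; congr (`|_| ^+ 2).
  rewrite /X sumrB sumr_const card_ord addrC; congr (_ + _).
  by rewrite -partial_sum_iota.
rewrite E2 (eq_bigr _ (fun i _ => mX i)) in H.
rewrite sumEFin -EFinM lee_fin sumr_const card_ord in H.
by rewrite -mulrA mulr_natl.
Qed.

End IidFiniteValued.

(** * The bound on n h(r) for a walk that stays in a ball *)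

Section KeyEstimate.
Context {R : realType} {B : completeNormedModType R}.
Variable e : nat -> B.
Hypothesis e_dense : forall x (eps : R), 0 < eps -> exists k, `|x - e k| < eps.
Variable c : R.
Hypotheses (c0 : 0 < c) (cB : cotype2_with B c).
Context {d} {T : measurableType d} (P : probability T R) (X : T -> B).
Hypothesis rX : random_var X.
Context {d'} {T' : measurableType d'} (P' : probability T' R) (Xs : nat -> T' -> B).
Hypothesis rXs : forall j, random_var (Xs j).
Hypothesis iXs : independent_vars P' Xs.
Hypothesis lXs : forall j A, borel A -> P' (Xs j @^-1` A) = P (X @^-1` A).

Definition trunc (rho : R) (x : B) : B := if `|x| <= rho then x else 0.

Lemma norm_trunc_le rho x : 0 <= rho -> `|trunc rho x| <= rho.
Proof. by move=> h; rewrite /trunc; case: ifPn => //; rewrite normr0. Qed.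

Lemma continuous_cutoff (rho : R) : continuous (cutoff rho : B -> R).
Proof.
have h2 : continuous (fun t : R => 2 - t / rho).
  by move=> t; apply: cvgB; [exact: cvg_cst|apply: cvgM => //; exact: cvg_cst].
move=> y; rewrite /cutoff; apply: (@continuous_cvg _ _ _ _ _ (fun y : B => `|y|)
  (fun t : R => Num.min 1 (Num.max 0 (2 - t / rho)))); last exact: norm_continuous.
apply: (@continuous_min _ _ (cst 1) (fun t : R => Num.max 0 (2 - t / rho))).
  exact: cst_continuous.
apply: (@continuous_max _ _ (cst 0) (fun t : R => 2 - t / rho)); last exact: h2.
exact: cst_continuous.
Qed.

Section FixedRadius.
Variables (r : R) (n : nat).
Hypotheses (r0 : 0 < r) (n1 : (1 <= n)%N).

(** Two consecutive positions in the ball of radius 8 r differ by at most 16 r, so truncation at 16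
    r does not alter a staying path. Nearest points may double norms, whence 32 r in [q]. *)
Let Y := trunc (16 * r) \o X.
Let Z j := trunc (16 * r) \o Xs j.
Let q (v : B) := `|v| <= 32 * r.
Let mu k := law_of P (nearest e k \o Y) (grid e q k).

Let r16 : 0 <= 16 * r. Proof. by rewrite mulr_ge0// ltW. Qed.

Let rY : random_var Y.
Proof. by apply: random_var_comp => //; exact: random_var_trunc. Qed.

Let rZ j : random_var (Z j).
Proof. by apply: random_var_comp => //; exact: random_var_trunc. Qed.

Let iZ : independent_vars P' Z.
Proof.
apply: (@independent_comp _ _ _ _ P' _ Xs (fun _ => trunc (16 * r))) => //.
by move=> _; exact: random_var_trunc.
Qed.

Let lZY j A : borel A -> P' (Z j @^-1` A) = P (Y @^-1` A).
Proof.
move=> bA; apply: (lXs j (A := trunc (16 * r) @^-1` A)).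
exact: (random_var_preimage (random_var_trunc _) bA).
Qed.

Let lZ j A : borel A -> P' (Z j @^-1` A) = P' (Z 0%N @^-1` A).
Proof. by move=> bA; rewrite !lZY. Qed.

Let q_nearest k x : q (nearest e k (trunc (16 * r) x)).
Proof.
rewrite /q (le_trans (nearest_norm_le _ _ _))//.
by have := norm_trunc_le x r16; lra.
Qed.

Let grid_law_mu k : grid_law e P' Z q k 0%N = mu k.
Proof.
apply: eq_map => v; congr (fine _, v); apply: (lZY 0 (A := nearest e k @^-1` [set v])).
exact: (random_var_preimage (measurable_nearest e k) (borel_set1 v)).
Qed.

Let law_mu k : law (mu k).
Proof. rewrite -grid_law_mu; apply: grid_law_law => // k' i w; exact: q_nearest. Qed.

Let EY2 : R := fine (\int[P]_w (sq (Y w))%:E)%E.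

Lemma mean_square_cvg :
  (\int[P]_w (sq (Y w))%:E = EY2%:E)%E /\
  (fun k => conv (mu k) sq 0) @ \oo --> EY2.
Proof.
(* A single variable is treated as an independent family indexed by [unit]. *)
have iU : independent_vars P (fun _ : unit => Y).
  move=> [|[] [|[] J]] A uJ bA.
  - rewrite big_nil -[RHS](probability_setT P); congr (P _).
    by apply/seteqP; split.
  - rewrite big_seq1; congr (P _); apply/seteqP; split=> w Hw.
      by apply: (Hw tt) => /=; rewrite mem_head.
    by move=> [].
  - by [].
have [|||||fin H] := @grid_mean_cvg _ _ e _ _ P _ (fun _ : unit => Y) q (fun=> rY) iU
  _ [:: tt] (path_fun (fun=> 1) sq 0) _ isT _ (cst ((32 * r) ^+ 2)).
- by move=> k _ w; exact: q_nearest.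
- move=> w; rewrite path_fun1.
  under eq_fun do rewrite path_fun1.
  rewrite /= !big_seq1 add0r; under eq_fun do rewrite big_seq1 add0r.
  apply: (@continuous_cvg _ _ _ _ _ (fun k => nearest e k (Y w)) sq); first exact: continuous_sq.
  by apply: nearest_cvg => eps; exact: e_dense.
- by move=> l; apply: path_fun_ge0.
- exact: finite_measure_integrable_cst.
- move=> k w; rewrite path_fun1 /= big_seq1 add0r /sq ler_pXn2r ?nnegrE ?mulr_ge0 ?(ltW r0)//.
  exact: q_nearest.
have E : (\int[P]_w (path_fun (fun=> 1) sq 0 [seq Y w | _ <- [:: tt]])%:E = \int[P]_w (sq (Y w))%:E)%E.
  by apply: eq_integral => w _; rewrite path_fun1 big_seq1 add0r.
rewrite E in fin H; split; first by rewrite fineK.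
apply: cvg_trans H; apply: near_eq_cvg; apply: nearW => k /=.
by apply: eq_bigr => a _; rewrite mul1r.
Qed.

Hypothesis stay_prob : ((7 / 8)%:E <= P' (stays Xs (8 * r) n))%E.

Lemma stays_step w j : stays Xs (8 * r) n w -> (j < n)%N -> `|Xs j w| <= 16 * r.
Proof.
move=> H jn; have H1 : `|partial_sum Xs j.+1 w| <= 8 * r by apply: H.
have H0 : `|partial_sum Xs j w| <= 8 * r.
  case: j jn {H1} => [|j] jn; last by apply: H; rewrite (ltnW jn).
  by rewrite /partial_sum big_ord0 normr0 mulr_ge0// ltW.
have -> : Xs j w = partial_sum Xs j.+1 w - partial_sum Xs j w.
  by rewrite /partial_sum big_ord_recr/= addrAC subrr add0r.
by rewrite (le_trans (ler_normB _ _))//; lra.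
Qed.

(** The path weight built from [cutoff (8 * r)] dominates the indicator of staying within 8 r and is
    dominated by that of staying within 16 r; being continuous, it links the original walk to its
    discretizations. The drop from 7/8 to 3/4 is the room needed in the limit. *)
Lemma near_stay : \forall k \near \oo, 3 / 4 <= stay (16 * r) (mu k) n 0.
Proof.
have r8 : 0 < 8 * r by rewrite mulr_gt0.
have cont : continuous (cutoff (8 * r) : B -> R) by exact: continuous_cutoff.
have cont1 : continuous ((fun=> 1) : B -> R) by move=> ?; exact: cvg_cst.
have c01 (u : B) : 0 <= cutoff (8 * r) u <= 1 by rewrite cutoff_ge0 cutoff_le1.
have [|||fin H] := @path_mean_cvg _ _ e e_dense _ _ P' Z q rZ iZ lZ (fun k i w => q_nearest k _)
   (cutoff (8 * r)) (fun=> 1) n 1 cont cont1.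
- by move=> u; exact: cutoff_ge0.
- by [].
- by move=> k w; apply: path_fun_le1.
have L : 7 / 8 <= fine (\int[P']_w (path_of Z (cutoff (8 * r)) (fun=> 1) n w)%:E)%E.
  rewrite -lee_fin fineK// (le_trans stay_prob)//.
  have mS := measurable_stays e_dense rXs (8 * r) n.
  have -> : P' (stays Xs (8 * r) n) = (\int[P']_w (\1_(stays Xs (8 * r) n) w)%:E)%E.
    by rewrite integral_indic// setIT.
  apply: ge0_le_integral => //.
  - by apply/measurable_EFinP; exact: measurable_indic.
  - apply/measurable_EFinP; apply: (@measurable_path_of _ _ e e_dense _ _ Z q) => // k i w.
    exact: q_nearest.
  move=> w _; rewrite lee_fin indicE; case: (boolP (w \in _)); last first.
    by move=> _; apply: path_fun_ge0 => // u; exact: cutoff_ge0.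
  move=> wS; have := path_of_cutoff_ge Xs n w r8; rewrite indicE wS.
  rewrite inE in wS; rewrite /path_of.
  have -> : [seq Xs j w | j <- iota 0 n] = [seq Z j w | j <- iota 0 n].
    apply/eq_in_map => j; rewrite mem_iota add0n => /= jn.
    by rewrite /Z /trunc/= (stays_step wS jn).
  by [].
have : \forall k \near \oo, 3 / 4 < path_mean (cutoff (8 * r)) (fun=> 1) (grid_law e P' Z q k 0%N) n 0.
  move/cvgrPdist_lt : H => /(_ (1 / 8)) H; have /H : 0 < 1 / 8 :> R by [].
  apply: filterS => k; rewrite ltr_norml => /andP[_ h].
  by move: L h; set a := fine _; set b := path_mean _ _ _ _ _; lra.
apply: filterS => k h; apply: (le_trans (ltW h)); rewrite grid_law_mu.
have := law_mu k; move: (mu k) (0 : B) => nu y lnu.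
rewrite /stay; elim: n y => // m IH y /=; apply: le_conv => [|a am]; first by case: lnu.
apply: ler_pM; [exact: cutoff_ge0| |  |exact: IH].
  by apply: path_mean_ge0 => // u; exact: cutoff_ge0.
case: (leP `|y + a.2| (16 * r)) => [_|h']; first exact: cutoff_le1.
by rewrite cutoff0//; move: h'; lra.
Qed.

(** Staying forces all n steps below 16 r, so a^n >= 7/8 with a = 1 - G(16 r). Bernoulli's
    inequality in the form a^n (1 + n (1 - a)) <= 1 then gives n G(16 r) <= 8/7 - 1. *)
Lemma jump_prob_le : n%:R * G_fun P X (16 * r) <= 1 / 7.
Proof.
pose A := [set x : B | `|x| <= 16 * r].
have bA : borel A.
  rewrite /borel (_ : A = [set: borelType] `&` (fun x : borelType (B := B) => `|x : B|) @^-1` `]-oo, 16 * r]).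
    by apply: continuous_borel_fun; [exact: norm_continuous|exact: measurableT|exact: measurable_itv].
  by apply/seteqP; split=> x /=; rewrite in_itv/=; tauto.
have mA : measurable (X @^-1` A) by exact: random_var_preimage.
set a := fine (P (X @^-1` A)).
have Pa : P (X @^-1` A) = a%:E by rewrite fineK// fin_num_measure.
have a0 : 0 <= a by rewrite fine_ge0.
have a1 : a <= 1 by rewrite -lee_fin -Pa; exact: probability_le1.
have GE : G_fun P X (16 * r) = 1 - a.
  rewrite /G_fun (_ : [set w | _] = ~` (X @^-1` A)); last first.
    by apply/seteqP; split=> w /=; [move=> h; apply/negP; rewrite -ltNge|move/negP; rewrite -ltNge].
  by rewrite probability_setC// Pa.
have an : 7 / 8 <= a ^+ n.
  rewrite -lee_fin (le_trans stay_prob)//.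
  apply: (@le_trans _ _ (P' (\bigcap_(i in [set` iota 0 n]) Xs i @^-1` A))).
    apply: le_measure; rewrite ?inE.
    - exact: (measurable_stays e_dense).
    - by apply: fin_bigcap_measurable => // i _; exact: random_var_preimage.
    - move=> w ws i /=; rewrite mem_iota add0n => /= jn; exact: (stays_step ws jn).
  rewrite iXs ?iota_uniq//.
  rewrite (eq_bigr (fun=> a%:E)) => [|i _]; last by rewrite lXs.
  rewrite big_const_seq count_predT size_iota.
  elim: n => // m IH; rewrite iterS exprS EFinM lee_pmul//.
  by elim: (m) => //= k; apply: mule_ge0.
have bern m : a ^+ m * (1 + m%:R * (1 - a)) <= 1.
  elim: m => [|m IH]; first by rewrite mul0r addr0 mulr1.
  apply: le_trans IH; rewrite exprSr -mulrA ler_wpM2l ?exprn_ge0//.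
  rewrite -natr1; have m0 : 0 <= m%:R :> R by rewrite ler0n.
  by have := sqr_ge0 (1 - a); have := mulr_ge0 m0 (sqr_ge0 (1 - a)); nra.
rewrite GE; have := bern n; have nn : 0 <= n%:R * (1 - a) by rewrite mulr_ge0// subr_ge0.
have : 7 / 8 * (1 + n%:R * (1 - a)) <= a ^+ n * (1 + n%:R * (1 - a)).
  by rewrite ler_wpM2r// addr_ge0.
by set x := a ^+ n * _; set y := n%:R * _; lra.
Qed.

(** Here (96 r)^2 = 4 (16 r + 32 r)^2 is the bound of [iter_conv_sq_bound] for radius 16 r and steps
    up to 32 r; the factor 2 + 8/c is the price of centering. *)
Let D : R := 96 ^+ 2 * (2 + 8 / c).

(** Write b for the bound on E|S_n|^2 and m for the mean of a step. Jensen gives |n m|^2 <= b, hence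
    n |m|^2 <= b and E|S_n - n m|^2 <= 4 b. Cotype 2 bounds n times the centered second moment by 4
    b / c; undoing the centering gives 2 b + 8 b / c. *)
Lemma grid_bounds k : 3 / 4 <= stay (16 * r) (mu k) n 0 ->
  n%:R * conv (mu k) sq 0 <= D * r ^+ 2 /\ n%:R * `|mean (mu k)| <= 96 * r.
Proof.
move=> st; have lm := law_mu k.
have r32 : 0 <= 32 * r by rewrite mulr_ge0// ltW.
have atoms a : a \in mu k -> `|a.2| <= 32 * r.
  by move=> /mapP[v + ->]; rewrite mem_filter => /andP[].
have h1 := iter_conv_sq_bound lm r16 r32 atoms st.
pose K := 96 * r; have K0 : 0 <= K by rewrite mulr_ge0// ltW.
have {}h1 : iter n (conv (mu k)) sq 0 <= K ^+ 2.
  apply: (le_trans h1); have -> : 16 * r + 32 * r = K / 2 by rewrite /K; lra.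
  by clearbody K; nra.
have DK : D * r ^+ 2 = K ^+ 2 * (2 + 8 / c) by rewrite /D /K exprMn mulrAC.
rewrite DK -/K; clearbody K => {DK}.
set b := K ^+ 2 in h1 *.
have := iter_conv_mean n 0 lm; rewrite add0r => /le_trans/(_ h1).
set m := mean (mu k) => h2.
have n1R : 1 <= n%:R :> R by rewrite ler1n.
have n0R : 0 < n%:R :> R by rewrite (lt_le_trans _ n1R).
have nm : `|m *+ n| = n%:R * `|m| by rewrite normrMn mulr_natl.
split; last first.
  by rewrite -nm -(@ler_pXn2r _ 2) ?nnegrE.
have b0 : 0 <= b by exact: sqr_ge0.
have h3 : c * n%:R * conv (mu k) sq (- m) <= iter n (conv (mu k)) sq (- (m *+ n)).
  rewrite /m -grid_law_mu; apply: (@cotype2_iid _ _ _ _ P' (fun i => nearest e k \o Z i) (grid e q k)) => //.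
  - by move=> i; apply: random_var_nearest.
  - by move=> i w; apply: nearest_grid => // k' i' w'; exact: q_nearest.
  - exact: uniq_grid.
  - exact: independent_nearest.
  - move=> i A bA; apply: (lZ i (A := nearest e k @^-1` A)).
    exact: (random_var_preimage (measurable_nearest e k) bA).
have h4 := iter_conv_sqD n (- (m *+ n)) 0 lm; rewrite addr0 sqN in h4.
have h5 := @iter_conv_sqD _ _ _ 1 m (- m) lm; rewrite subrr /= in h5.
have h6 : n%:R * sq m <= b.
  apply: le_trans h2; rewrite /sq nm exprMn ler_wpM2r ?sqr_ge0// expr2.
  by rewrite ler_peMl.
have h7 : n%:R * conv (mu k) sq (- m) <= 4 * b / c.
  by rewrite ler_pdivlMr// mulrC mulrA; move: h3 h4 h1 h2; lra.
have -> : b * (2 + 8 / c) = 2 * b + 2 * (4 * b / c) by ring.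
have : n%:R * conv (mu k) sq 0 <= n%:R * (2 * sq m + 2 * conv (mu k) sq (- m)).
  by rewrite ler_pM2l.
by move: h6 h7; set x := conv _ _ _; set y := conv _ _ _; set z := 4 * b / c; lra.
Qed.

Lemma mean_square_le : n%:R * EY2 <= D * r ^+ 2.
Proof.
have [_ H] := mean_square_cvg.
have H' : (fun k => n%:R * conv (mu k) sq 0) @ \oo --> n%:R * EY2.
  by apply: cvgM => //; exact: cvg_cst.
rewrite -(cvg_lim _ H')//; apply: limr_le; first by apply/cvg_ex; eexists; exact: H'.
by apply: filterS near_stay => k /grid_bounds[].
Qed.

(** The two truncations differ only for r < |x| <= 16 r, where |x| <= |x|^2 / r. *)
Lemma nearest_trunc_dist k x :
  `|nearest e k (trunc r x) - nearest e k (trunc (16 * r) x)| <=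
  2 / r * sq (trunc (16 * r) x).
Proof.
have r2 : 0 <= 2 / r by rewrite divr_ge0// ltW.
have h0 y : 0 <= 2 / r * sq y by rewrite mulr_ge0// sq_ge0.
rewrite {1}/trunc; case: ifPn => [xr|].
  have -> : trunc (16 * r) x = x by rewrite /trunc ifT//; move: r0 xr; lra.
  by rewrite subrr normr0 h0.
rewrite -ltNge => rx; rewrite nearest0 sub0r normrN (le_trans (nearest_norm_le _ _ _))//.
rewrite /trunc; case: ifPn => _; last by rewrite normr0 mulr0 h0.
by rewrite mulrAC ler_pdivlMr// -mulrA ler_pM2l// /sq expr2 ler_wpM2l// ltW.
Qed.

(** The walk controls the mean of the steps truncated at 16 r, whereas M(r) truncates at r; the
    second moment pays for the difference. *)
Lemma bochner_trunc_le :
  n%:R * `|bochner_expectation P (trunc r \o X)| <= 96 * r + 2 / r * (n%:R * EY2).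
Proof.
have rt : random_var (trunc r \o X) by apply: random_var_comp => //; exact: random_var_trunc.
have it : (\int[P]_w `|(trunc r \o X) w|%:E < +oo)%E.
  apply: (@le_lt_trans _ _ (\int[P]_w (cst r%:E) w)%E).
    apply: ge0_le_integral => //.
    - by apply/measurable_EFinP; exact: random_var_norm.
    - by move=> w _; rewrite lee_fin norm_trunc_le// ltW.
  by rewrite integral_cst// [X in (_ * X)%E](probability_setT P) mule1 ltry.
have H := bochner_expectation_cvg e_dense rt it.
have H' : (fun k => n%:R * `|simple_expectation P (nearest e k \o (trunc r \o X))|) @ \oo -->
    n%:R * `|bochner_expectation P (trunc r \o X)|.
  by apply: cvgM; [exact: cvg_cst|exact: cvg_norm].
rewrite -(cvg_lim _ H')//; apply: limr_le; first by apply/cvg_ex; eexists; exact: H'.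
apply: filterS near_stay => k /grid_bounds[_ hm].
have rn1 : random_var (nearest e k \o (trunc r \o X)).
  by apply: random_var_comp => //; exact: measurable_nearest.
have rn2 : random_var (nearest e k \o Y).
  by apply: random_var_comp => //; exact: measurable_nearest.
have V2 w : (nearest e k \o Y) w \in grid e q k.
  by rewrite mem_filter q_nearest; exact: nearest_rangeP.
rewrite (simple_expectation_mean P (undup_uniq _) (fun w => nearest_rangeP e k _)).
have := mean_law_of_dist P rn1 rn2 (undup_uniq _) (uniq_grid e q k)
  (fun w => nearest_rangeP e k _) V2.
rewrite -/(mu k) -/(nearest_range e k).
set m1 := mean _ => hd.
have {}hd : `|m1 - mean (mu k)| <= 2 / r * EY2.
  rewrite -lee_fin (le_trans hd)// EFinM -mean_square_cvg.1 -ge0_integralZl//; last 3 first.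
  - by apply/measurable_EFinP; exact: random_var_sq.
  - by move=> w _; rewrite lee_fin sq_ge0.
  - by rewrite lee_fin divr_ge0// ltW.
  apply: ge0_le_integral => //.
  - exact: (measurable_dist rn1 rn2 (uniq_grid e q k) V2).
  - by apply: measurable_funeM; apply/measurable_EFinP; exact: random_var_sq.
  - by move=> w _; rewrite -EFinM lee_fin; exact: nearest_trunc_dist.
have n0R : 0 < n%:R :> R by rewrite ltr0n.
apply: (@le_trans _ _ (n%:R * (`|mean (mu k)| + 2 / r * EY2))).
  rewrite ler_pM2l// -[m1](subrK (mean (mu k))) (le_trans (ler_normD _ _))//.
  by rewrite addrC lerD2l.
by rewrite mulrDr lerD// mulrCA.
Qed.

(** Chebyshev's inequality on the shell r < |X| <= 16 r. *)
Lemma tail_prob_le : G_fun P X r <= G_fun P X (16 * r) + EY2 / r ^+ 2.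
Proof.
have mG t : measurable [set w | t < `|X w|].
  rewrite (_ : [set w | _] = [set: T] `&` (fun w => `|X w|) @^-1` `]t, +oo[).
    by apply: random_var_norm => //; exact: measurable_itv.
  by apply/seteqP; split=> w /=; rewrite in_itv/= andbT; tauto.
have fG t : P [set w | t < `|X w|] = (G_fun P X t)%:E.
  by rewrite /G_fun fineK// fin_num_measure.
rewrite -lee_fin EFinD -!fG [EY2 / _]mulrC EFinM -mean_square_cvg.1 -ge0_integralZl//; last 3 first.
- by apply/measurable_EFinP; exact: random_var_sq.
- by move=> w _; rewrite lee_fin sq_ge0.
- by rewrite lee_fin invr_ge0 sqr_ge0.
have iG (t : R) : (\int[P]_w (\1_[set w | (t < `|X w|)%R] w)%:E = P [set w | (t < `|X w|)%R])%E.
  by rewrite integral_indic// setIT.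
have mI t : measurable_fun [set: T] (fun w => (\1_[set w | t < `|X w|] w)%:E : \bar R).
  by apply/measurable_EFinP; exact: measurable_indic.
have mS : measurable_fun [set: T] (fun w => ((r ^+ 2)^-1)%:E * (sq (Y w))%:E)%E.
  by apply: measurable_funeM; apply/measurable_EFinP; exact: random_var_sq.
have pS w : (0 <= ((r ^+ 2)^-1)%:E * (sq (Y w))%:E)%E.
  by rewrite mule_ge0// lee_fin ?invr_ge0 ?sqr_ge0 ?sq_ge0.
rewrite -!iG -ge0_integralD//.
have r20 : 0 < r ^+ 2 by rewrite exprn_gt0.
apply: ge0_le_integral => //; first exact: emeasurable_funD.
move=> w _; rewrite -EFinM -EFinD lee_fin !indicE.
have [rx|xr] := ltP r `|X w|; last first.
  rewrite memNset /=; last by apply/negP; rewrite -leNgt.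
  by rewrite addr_ge0// mulr_ge0 ?sq_ge0// invr_ge0 ltW.
rewrite mem_set//; have [rx16|xr16] := ltP (16 * r) `|X w|.
  by rewrite mem_set// lerDl mulr_ge0 ?sq_ge0// invr_ge0 ltW.
rewrite memNset /=; last by apply/negP; rewrite -leNgt.
rewrite add0r mulrC ler_pdivlMr// mul1r /Y /trunc /= xr16 /sq.
by rewrite ler_pXn2r ?nnegrE ?(ltW r0)// ltW.
Qed.

Lemma trunc_moment_le : K_fun P X r <= EY2 / r ^+ 2.
Proof.
have r20 : 0 < r ^+ 2 by rewrite exprn_gt0.
rewrite /K_fun mulrC ler_pM2r ?invr_gt0// unlock.
have pw w : `|X w| ^+ 2 * \1_[set w | `|X w| <= r] w = sq (trunc r (X w)).
  rewrite indicE /trunc; case: (leP `|X w| r) => h.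
    by rewrite mem_set// mulr1.
  by rewrite memNset /= ?mulr0 ?/sq ?normr0 ?expr0n//; apply/negP; rewrite -ltNge.
under eq_integral => w _ do rewrite pw.
have mt : measurable_fun [set: T] (fun w => (sq (trunc r (X w)))%:E : \bar R).
  apply/measurable_EFinP; apply: (@random_var_sq _ _ _ _ (trunc r \o X)).
  by apply: random_var_comp => //; exact: random_var_trunc.
have le : (\int[P]_w (sq (trunc r (X w)))%:E <= EY2%:E)%E.
  rewrite -mean_square_cvg.1; apply: ge0_le_integral => //.
  - by move=> w _; rewrite lee_fin sq_ge0.
  - by apply/measurable_EFinP; exact: random_var_sq.
  move=> w _; rewrite lee_fin /Y /trunc /=; case: (leP `|X w| r) => h.
    by rewrite ifT//; move: r0; lra.
  by rewrite [X in X <= _]/sq normr0 expr0n sq_ge0.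
rewrite -lee_fin fineK//; rewrite ge0_fin_numE ?(le_lt_trans le) ?ltry//.
by apply: integral_ge0 => w _; rewrite lee_fin sq_ge0.
Qed.

(** The shares of G, K and M are 1/7 + D, D and 96 + 2 D. *)
Lemma stay_h_fun_le : n%:R * h_fun P X r <= 97 + 4 * D.
Proof.
have r20 : 0 < r ^+ 2 by rewrite exprn_gt0.
have n0R : 0 < n%:R :> R by rewrite ltr0n.
have E : n%:R * (EY2 / r ^+ 2) <= D by rewrite mulrA ler_pdivrMr//; exact: mean_square_le.
have hG : n%:R * G_fun P X r <= 1 / 7 + D.
  apply: (@le_trans _ _ (n%:R * (G_fun P X (16 * r) + EY2 / r ^+ 2))).
    by rewrite ler_pM2l//; exact: tail_prob_le.
  by rewrite mulrDr lerD//; exact: jump_prob_le.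
have hK : n%:R * K_fun P X r <= D.
  by apply: le_trans E; rewrite ler_pM2l//; exact: trunc_moment_le.
have hM : n%:R * `|M_fun P X r| <= 96 + 2 * D.
  have -> : M_fun P X r = r^-1 *: bochner_expectation P (trunc r \o X).
    rewrite /M_fun; congr (_ *: bochner_expectation P _); apply/funext => w.
    rewrite indicE /trunc /=; case: (leP `|X w| r) => h.
      by rewrite mem_set// scale1r.
    by rewrite memNset /= ?scale0r//; apply/negP; rewrite -ltNge.
  rewrite normrZ mulrCA gtr0_norm ?invr_gt0// mulrC ler_pdivrMr//.
  apply: (le_trans bochner_trunc_le); rewrite [leRHS]mulrDl lerD2l.
  have -> : 2 / r * (n%:R * EY2) = 2 * (n%:R * (EY2 / r ^+ 2)) * r.
    by field; rewrite gt_eqF.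
  by rewrite ler_pM2r// ler_pM2l.
rewrite /h_fun !mulrDr; move: hG hK hM.
by set x := _ * G_fun _ _ _; set y := _ * K_fun _ _ _; set z := _ * `|_|; lra.
Qed.

End FixedRadius.

End KeyEstimate.

(** * Bounds and positivity of h(r) *)

Section TruncatedMoments.
Context {R : realType} {B : completeNormedModType R}.
Context {d} {T : measurableType d} (P : probability T R) (X : T -> B).
Hypothesis rX : random_var X.

Lemma G_fun_bounds r : 0 <= G_fun P X r <= 1.
Proof.
have mG : measurable [set w | r < `|X w|].
  rewrite (_ : [set w | _] = [set: T] `&` (fun w => `|X w|) @^-1` `]r, +oo[).
    by apply: random_var_norm => //; exact: measurable_itv.
  by apply/seteqP; split=> w /=; rewrite in_itv/= andbT; tauto.
rewrite /G_fun fine_ge0//= -lee_fin fineK; first exact: probability_le1.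
exact: fin_num_measure.
Qed.

Lemma trunc_sqE r w :
  `|X w| ^+ 2 * \1_[set w | `|X w| <= r] w = sq (trunc r (X w)).
Proof.
rewrite indicE /trunc; case: (leP `|X w| r) => h.
  by rewrite mem_set// mulr1.
by rewrite memNset /= ?mulr0 ?/sq ?normr0 ?expr0n//; apply/negP; rewrite -ltNge.
Qed.

Lemma random_var_trunc_comp r : random_var (trunc r \o X).
Proof. by apply: random_var_comp => //; exact: random_var_trunc. Qed.

Lemma measurable_trunc_sq r :
  measurable_fun [set: T] (fun w => (sq (trunc r (X w)))%:E : \bar R).
Proof.
apply/measurable_EFinP; apply: (@random_var_sq _ _ _ _ (trunc r \o X)).
exact: random_var_trunc_comp.
Qed.

Lemma integral_trunc_sq r : 0 < r ->
  (\int[P]_w (sq (trunc r (X w)))%:E = (r ^+ 2 * K_fun P X r)%:E)%E.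
Proof.
move=> r0; have r20 : 0 < r ^+ 2 by rewrite exprn_gt0.
rewrite /K_fun mulrA divff ?gt_eqF// mul1r unlock.
under [in RHS]eq_integral => w _ do rewrite trunc_sqE.
rewrite fineK//; rewrite ge0_fin_numE; last first.
  by apply: integral_ge0 => w _; rewrite lee_fin sq_ge0.
apply: (@le_lt_trans _ _ (\int[P]_w (cst (r ^+ 2)%:E) w)%E).
  apply: ge0_le_integral => //.
  - by move=> w _; rewrite lee_fin sq_ge0.
  - exact: measurable_trunc_sq.
  - move=> w _; rewrite lee_fin /sq ler_pXn2r ?nnegrE ?(ltW r0)//.
    exact: norm_trunc_le (ltW r0).
by rewrite integral_cst// [X in (_ * X)%E](probability_setT P) mule1 ltry.
Qed.

Lemma K_fun_bounds r : 0 < r -> 0 <= K_fun P X r <= 1.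
Proof.
move=> r0; have r20 : 0 < r ^+ 2 by rewrite exprn_gt0.
rewrite -(pmulr_rge0 _ r20) -[X in _ && X](ler_pM2l r20) mulr1 -!lee_fin.
rewrite -integral_trunc_sq//; apply/andP; split.
  by apply: integral_ge0 => w _; rewrite lee_fin sq_ge0.
rewrite -[leRHS]mule1 -[X in (_ * X)%E](probability_setT P) -integral_cst//.
apply: ge0_le_integral => //.
- by move=> w _; rewrite lee_fin sq_ge0.
- exact: measurable_trunc_sq.
- move=> w _; rewrite lee_fin /sq ler_pXn2r ?nnegrE ?(ltW r0)//.
  exact: norm_trunc_le (ltW r0).
Qed.

Lemma M_funE r : M_fun P X r = r^-1 *: bochner_expectation P (trunc r \o X).
Proof.
rewrite /M_fun; congr (_ *: bochner_expectation P _); apply/funext => w.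
rewrite indicE /trunc /=; case: (leP `|X w| r) => h.
  by rewrite mem_set// scale1r.
by rewrite memNset /= ?scale0r//; apply/negP; rewrite -ltNge.
Qed.

Lemma K_fun_le_h_fun r : K_fun P X r <= h_fun P X r.
Proof.
have /andP[G0 _] := G_fun_bounds r.
by rewrite /h_fun; have := normr_ge0 (M_fun P X r); lra.
Qed.

(** If h(r) = 0 then G(r) and K(r) vanish and X = 0 almost surely, which non-degeneracy excludes. So
    no quotient c / h(r) divides by zero. *)
Lemma h_fun_gt0 r : in_L P X -> 0 < r -> 0 < h_fun P X r.
Proof.
move=> [_ nX] r0; have r20 : 0 < r ^+ 2 by rewrite exprn_gt0.
have /andP[G0 _] := G_fun_bounds r; have /andP[K0 _] := K_fun_bounds r0.
have M0 := normr_ge0 (M_fun P X r).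
rewrite lt_neqAle; apply/andP; split; last by rewrite /h_fun !addr_ge0.
apply/eqP => h0; apply: nX; exists 0.
have KE : K_fun P X r = 0 by move: h0; rewrite /h_fun; lra.
have GE : G_fun P X r = 0 by move: h0; rewrite /h_fun; lra.
have I0 : (\int[P]_w (sq (trunc r (X w)))%:E = 0)%E.
  by rewrite integral_trunc_sq// KE mulr0.
have mG : measurable [set w | r < `|X w|].
  rewrite (_ : [set w | _] = [set: T] `&` (fun w => `|X w|) @^-1` `]r, +oo[).
    by apply: random_var_norm => //; exact: measurable_itv.
  by apply/seteqP; split=> w /=; rewrite in_itv/= andbT; tauto.
have PG : P [set w | r < `|X w|] = 0%E.
  by rewrite -[LHS]fineK ?fin_num_measure// -[fine _]/(G_fun P X r) GE.
have A1 : {ae P, forall w, ~ r < `|X w|}.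
  exists [set w | r < `|X w|]; split=> // w /=.
  by move=> h; apply: contrapT => h'; apply: h.
have A2 : ae_eq P setT (fun w => (sq (trunc r (X w)))%:E) (cst 0%E).
  apply/ae_eq_integral_abs => //; first exact: measurable_trunc_sq.
  by rewrite -[RHS]I0; apply: eq_integral => w _; rewrite gee0_abs// lee_fin sq_ge0.
apply: filterS2 A1 A2 => w h1 /(_ I) [].
rewrite /trunc ifT; last by rewrite leNgt; apply/negP.
by move=> /eqP; rewrite /sq sqrf_eq0 normr_eq0 => /eqP.
Qed.

Variable e : nat -> B.
Hypothesis e_dense : forall x (eps : R), 0 < eps -> exists k, `|x - e k| < eps.

Lemma integral_norm_trunc r : 0 < r -> (\int[P]_w `|(trunc r \o X) w|%:E < +oo)%E.
Proof.
move=> r0; apply: (@le_lt_trans _ _ (\int[P]_w (cst r%:E) w)%E).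
  apply: ge0_le_integral => //.
  - by apply/measurable_EFinP; apply: random_var_norm; exact: random_var_trunc_comp.
  - by move=> w _; rewrite lee_fin norm_trunc_le// ltW.
by rewrite integral_cst// [X in (_ * X)%E](probability_setT P) mule1 ltry.
Qed.

(** The 2 instead of 1 comes from nearest points, which may double norms. *)
Lemma norm_M_fun_le r : 0 < r -> `|M_fun P X r| <= 2.
Proof.
move=> r0; rewrite M_funE normrZ gtr0_norm ?invr_gt0// mulrC ler_pdivrMr//.
have rt := random_var_trunc_comp r.
have H := bochner_expectation_cvg e_dense rt (integral_norm_trunc r0).
have H' : (fun k => `|simple_expectation P (nearest e k \o (trunc r \o X))|) @ \oo -->
    `|bochner_expectation P (trunc r \o X)| by exact: cvg_norm.
rewrite -(cvg_lim _ H')//; apply: limr_le; first by apply/cvg_ex; eexists; exact: H'.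
apply: nearW => k.
have rn : random_var (nearest e k \o (trunc r \o X)).
  by apply: random_var_comp => //; exact: measurable_nearest.
have rc : random_var (cst 0 : T -> B) by exact: random_var_cst.
rewrite (simple_expectation_mean P (undup_uniq _) (fun w => nearest_rangeP e k _)).
have := mean_law_of_dist P rn rc (undup_uniq _) (isT : uniq [:: 0])
  (fun w => nearest_rangeP e k _) (fun w => mem_head 0 [::]).
rewrite {2}/mean big_map big_seq1 scaler0 subr0 => h.
rewrite -lee_fin (le_trans h)//.
apply: (@le_trans _ _ (\int[P]_w (cst (2 * r)%:E) w)%E); last first.
  by rewrite integral_cst// [X in (_ * X)%E](probability_setT P) mule1.
apply: ge0_le_integral => //.
- exact: (measurable_dist rn rc (isT : uniq [:: 0]) (fun w => mem_head 0 [::])).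
- move=> w _; rewrite lee_fin subr0 (le_trans (nearest_norm_le _ _ _))//.
  by rewrite ler_pM2l// norm_trunc_le// ltW.
Qed.

Lemma h_fun_le4 r : 0 < r -> h_fun P X r <= 4.
Proof.
move=> r0; have /andP[_ G1] := G_fun_bounds r; have /andP[_ K1] := K_fun_bounds r0.
by rewrite /h_fun; have := norm_M_fun_le r0; lra.
Qed.

End TruncatedMoments.

(** * The mean exit time under a bound on the staying probability *)

Section MeanExitTime.
Context {R : realType} {B : completeNormedModType R}.
Variable e : nat -> B.
Hypothesis e_dense : forall x (eps : R), 0 < eps -> exists k, `|x - e k| < eps.
Context {d} {T : measurableType d} (P : probability T R) (Z : nat -> T -> B).
Hypothesis rZ : forall i, random_var (Z i).
Hypothesis iZ : independent_vars P Z.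
Hypothesis lZ : forall i A, borel A -> P (Z i @^-1` A) = P (Z 0%N @^-1` A).

(** A smoothed staying probability, between those for the radii r and 2 r. *)
Definition soft_stay r n : R := fine (\int[P]_w (path_of Z (cutoff r) (fun=> 1) n w)%:E)%E.

Lemma soft_stay_cvg r n :
  (\int[P]_w (path_of Z (cutoff r) (fun=> 1) n w)%:E = (soft_stay r n)%:E)%E /\
  (fun k => path_mean (cutoff r) (fun=> 1) (grid_law e P Z xpredT k 0%N) n 0) @ \oo -->
    soft_stay r n.
Proof.
have cont1 : continuous ((fun=> 1) : B -> R) by move=> ?; exact: cvg_cst.
have c01 (u : B) : 0 <= cutoff r u <= 1 by rewrite cutoff_ge0 cutoff_le1.
have [|||fin H] := @path_mean_cvg _ _ e e_dense _ _ P Z xpredT rZ iZ lZ (fun k i w => isT)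
   (cutoff r) (fun=> 1) n 1 (@continuous_cutoff _ _ r) cont1.
- by move=> u; exact: cutoff_ge0.
- by [].
- by move=> k w; apply: path_fun_le1.
by split; first by rewrite /soft_stay fineK.
Qed.

Lemma soft_stayM r n m : 0 < r ->
  soft_stay r (n + m) <= soft_stay r n * soft_stay (4 * r) m.
Proof.
move=> r0; have [_ H1] := soft_stay_cvg r (n + m).
have [_ H2] := soft_stay_cvg r n; have [_ H3] := soft_stay_cvg (4 * r) m.
apply: (ler_cvg_to H1 (cvgM H2 H3)); apply: nearW => k /=.
by apply: path_mean_cutoffM => //; apply: grid_law_law.
Qed.

Lemma measurable_soft r n :
  measurable_fun [set: T] (fun w => (path_of Z (cutoff r) (fun=> 1) n w)%:E : \bar R).
Proof.
apply/measurable_EFinP; apply: (@measurable_path_of _ _ e e_dense _ _ Z xpredT) => //.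
  exact: continuous_cutoff.
by move=> ?; exact: cvg_cst.
Qed.

Lemma stays_le_soft r n : 0 < r -> (P (stays Z r n) <= (soft_stay r n)%:E)%E.
Proof.
move=> r0; have mS := measurable_stays e_dense rZ r n.
rewrite -(soft_stay_cvg r n).1.
have -> : P (stays Z r n) = (\int[P]_w (\1_(stays Z r n) w)%:E)%E.
  by rewrite integral_indic// setIT.
apply: ge0_le_integral => //.
- by apply/measurable_EFinP; exact: measurable_indic.
- exact: measurable_soft.
- by move=> w _; rewrite lee_fin path_of_cutoff_ge.
Qed.

Lemma soft_le_stays r n : 0 < r -> ((soft_stay r n)%:E <= P (stays Z (2 * r) n))%E.
Proof.
move=> r0; have mS := measurable_stays e_dense rZ (2 * r) n.
rewrite -(soft_stay_cvg r n).1.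
have -> : P (stays Z (2 * r) n) = (\int[P]_w (\1_(stays Z (2 * r) n) w)%:E)%E.
  by rewrite integral_indic// setIT.
apply: ge0_le_integral => //.
- move=> w _; rewrite lee_fin; apply: path_fun_ge0 => // u; exact: cutoff_ge0.
- exact: measurable_soft.
- by apply/measurable_EFinP; exact: measurable_indic.
- by move=> w _; rewrite lee_fin path_of_cutoff_le.
Qed.

Lemma soft_stay_ge0 r n : 0 <= soft_stay r n.
Proof.
apply: fine_ge0; apply: integral_ge0 => w _; rewrite lee_fin.
by apply: path_fun_ge0 => // u; exact: cutoff_ge0.
Qed.

Lemma soft_stay_le1 r n : 0 < r -> soft_stay r n <= 1.
Proof.
move=> r0; rewrite -lee_fin (le_trans (soft_le_stays n r0))// probability_le1//.
exact: (measurable_stays e_dense).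
Qed.

Lemma mean_exit_time_le r N : 0 < r -> (P (stays Z (8 * r) N) < (7 / 8)%:E)%E ->
  (\int[P]_w exit_time Z r w <= (8 * N%:R)%:E)%E.
Proof.
move=> r0 hN; have r4 : 0 < 4 * r by rewrite mulr_gt0.
(* Restarting enlarges r to 4 r, and leaving the smoothed probability doubles this: hence 8 r in the
   hypothesis. *)
have q78 : soft_stay (4 * r) N <= 7 / 8.
  rewrite -lee_fin (le_trans (soft_le_stays N r4))// mulrA.
  by rewrite (_ : 2 * 4 = 8) ?ltW// -natrM.
have step n : soft_stay r (n + N) <= 7 / 8 * soft_stay r n.
  rewrite (le_trans (soft_stayM n N r0))// mulrC.
  by rewrite ler_wpM2r// soft_stay_ge0.
(* A partial sum x satisfies x <= N + (7/8) x. *)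
have sum_le M : \sum_(0 <= n < M) soft_stay r n <= 8 * N%:R.
  have h1 : \sum_(0 <= n < M) soft_stay r n <= \sum_(0 <= n < N + M) soft_stay r n.
    rewrite [leRHS](big_cat_nat (n := M)) ?leq_addl//= lerDl.
    by apply: sumr_ge0 => i _; exact: soft_stay_ge0.
  have h2 : \sum_(0 <= n < N + M) soft_stay r n <=
      N%:R + 7 / 8 * \sum_(0 <= n < M) soft_stay r n.
    rewrite (big_cat_nat (n := N)) ?leq_addr//= lerD//.
      apply: (@le_trans _ _ (\sum_(0 <= n < N) 1)).
        by apply: ler_sum => i _; exact: soft_stay_le1.
      by rewrite sumr_const_nat subn0.
    rewrite -{1}[N]add0n big_addn addKn mulr_sumr; apply: ler_sum => i _.
    exact: step.
  by move: (le_trans h1 h2); set x := \sum_(_ <= _ < _) _; lra.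
rewrite (integral_exit_time e_dense)//; apply: lime_le.
  by apply: is_cvg_nneseries => n _ _; exact: measure_ge0.
apply: nearW => M; apply: (@le_trans _ _ (\sum_(0 <= n < M) (soft_stay r n)%:E)%E).
  by apply: lee_sum => n _; exact: stays_le_soft.
by rewrite sumEFin lee_fin; exact: sum_le.
Qed.

End MeanExitTime.

(** With C0 = 97 + 4 D and N <= C0 / h(r) + 1, one has 8 N h(r) <= 8 (C0 + h(r)), and h(r) <= 4. *)
Definition mean_exit_constant {R : realType} (c : R) : R :=
  8 * (97 + 4 * (96 ^+ 2 * (2 + 8 / c)) + 4).

Lemma cotype2_mean_exit (R : realType) (B : completeNormedModType R) (c : R) :
  separable_space B -> 0 < c -> cotype2_with B c ->
  mean_exit_bound B (mean_exit_constant c).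
Proof.
move=> /dense_sequence[e e_dense] c0 cB d T P X LX d' T' P' Xs [rXs iXs lXs] r r0.
have [rX _] := LX; have h0 := h_fun_gt0 rX LX r0.
have h4 := h_fun_le4 P rX e_dense r0.
set C0 : R := 97 + 4 * (96 ^+ 2 * (2 + 8 / c)).
have C00 : 0 <= C0.
  have c8 : 0 <= 8 / c by rewrite divr_ge0 // ltW.
  rewrite /C0; apply: addr_ge0 => //; apply: mulr_ge0 => //; apply: mulr_ge0.
    exact: sqr_ge0.
  by rewrite addr_ge0.
(* The least N with N h(r) > C0; [stay_h_fun_le] then excludes a staying probability of 7/8. *)
pose N := (Num.truncn (C0 / h_fun P X r)).+1.
have lXs' i A : borel A -> P' (Xs i @^-1` A) = P' (Xs 0%N @^-1` A).
  by move=> bA; rewrite !lXs.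
have hN : (P' (stays Xs (8 * r) N) < (7 / 8)%:E)%E.
  rewrite ltNge; apply/negP => h.
  have := stay_h_fun_le e_dense c0 cB rX rXs iXs lXs r0 (isT : (1 <= N)%N) h.
  rewrite -/C0; apply/negP; rewrite -ltNge -ltr_pdivrMr//.
  exact: truncnS_gt.
apply: (le_trans (mean_exit_time_le e_dense rXs iXs lXs' r0 hN)).
rewrite lee_fin ler_pdivlMr// /mean_exit_constant -/C0 -mulrA ler_pM2l//.
rewrite /N -natr1 mulrDl mul1r lerD//.
rewrite -ler_pdivlMr//; rewrite truncn_le.
by rewrite divr_ge0// ltW.
Qed.

(** * From Rademacher sums to cotype 2 *)

Section RademacherSums.
Context {R : realType} {B : completeNormedModType R}.
Implicit Types (mu : seq (R * B)) (mus : seq (seq (R * B))) (l : seq B) (y : B).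

Lemma seq_mean_sum mu mus (phi : B -> seq B -> R) :
  \sum_(a <- mu) a.1 * seq_mean mus (phi a.2) =
  seq_mean mus (fun l => \sum_(a <- mu) a.1 * phi a.2 l).
Proof.
elim: mus phi => //= nu mus IH phi.
under eq_bigr => a _ do rewrite mulr_sumr.
rewrite exchange_big/=; apply: eq_bigr => b _.
rewrite -(IH (fun v l => phi v (b.2 :: l))) mulr_sumr; apply: eq_bigr => a _.
by rewrite mulrCA.
Qed.

Definition sum_mean mus y : R := seq_mean mus (fun l => sq (y + \sum_(a <- l) a)).

Lemma sum_mean_cons mu mus y :
  sum_mean (mu :: mus) y = \sum_(a <- mu) a.1 * sum_mean mus (y + a.2).
Proof.
apply: eq_bigr => a _; congr (_ * _); apply: eq_seq_mean => l.
by rewrite big_cons addrA.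
Qed.

Lemma le_sum_mean_cons mu mus y : law mu -> mean mu = 0 ->
  (forall nu, nu \in mus -> law nu) -> sum_mean mus y <= sum_mean (mu :: mus) y.
Proof.
move=> lm m0 lms; rewrite sum_mean_cons /sum_mean.
rewrite (seq_mean_sum mu mus (fun v l => sq (y + v + \sum_(a <- l) a))).
apply: le_seq_mean => // l; apply: (le_trans (jensen_sq0 _ lm m0)).
by rewrite /conv; apply: ler_sum => a _; rewrite addrAC.
Qed.

(* Split a Rademacher sum into its positive and negative parts; by Jensen,
   either part has smaller second moment than the full sum of centered terms. *)
Lemma rademacher_le_sum mus y1 y2 :
  (forall mu, mu \in mus -> law mu /\ mean mu = 0) ->
  seq_mean mus (fun l => walk [:: 1; -1] l sq (y1 - y2)) <=
  2 * sum_mean mus y1 + 2 * sum_mean mus y2.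
Proof.
elim: mus y1 y2 => [|mu mus IH] y1 y2 lm /=.
  by rewrite /sum_mean /= big_nil !addr0 -(sqN y2); exact: sqD_le.
have [lmu m0] := lm mu (mem_head _ _).
have {}lm nu : nu \in mus -> law nu /\ mean nu = 0.
  by move=> nus; apply: lm; rewrite inE nus orbT.
have lms nu : nu \in mus -> law nu by move=> /lm[].
have h1 := le_sum_mean_cons y1 lmu m0 lms.
have h2 := le_sum_mean_cons y2 lmu m0 lms.
apply: (@le_trans _ _ (\sum_(a <- mu) a.1 * (sum_mean mus (y1 + a.2) + sum_mean mus y2 +
    (sum_mean mus y1 + sum_mean mus (y2 + a.2))))).
  rewrite !big_seq; apply: ler_sum => a am; rewrite ler_wpM2l ?lmu.1//.
  rewrite (eq_seq_mean _ (psi := fun l => 2^-1 * (walk [:: 1; -1] l sq (y1 + a.2 - y2)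
      + walk [:: 1; -1] l sq (y1 - (y2 + a.2))))); last first.
    move=> l; rewrite conv_step /avg/= !big_cons big_nil mulrN1z addr0 mulr1z.
    by rewrite opprD addrA [y1 + a.2 - y2]addrAC.
  rewrite seq_meanZ seq_meanD.
  by have := IH (y1 + a.2) y2 lm; have := IH y1 (y2 + a.2) lm; lra.
under eq_bigr => a _ do rewrite !mulrDr.
rewrite !big_split/= -!mulr_suml lmu.2 !mul1r -!sum_mean_cons.
by move: h1 h2; lra.
Qed.

Lemma seq_mean_sum_sq mus : (forall mu, mu \in mus -> law mu) ->
  seq_mean mus (fun l => \sum_(x <- l) sq x) = \sum_(mu <- mus) conv mu sq 0.
Proof.
elim: mus => [|mu mus IH] lm /=; first by rewrite !big_nil.
have lmu := lm mu (mem_head _ _).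
have lms nu : nu \in mus -> law nu by move=> h; apply: lm; rewrite inE h orbT.
rewrite big_cons -IH//.
under eq_bigr => a _.
  rewrite (eq_seq_mean _ (psi := fun l => sq a.2 + \sum_(x <- l) sq x)); last first.
    by move=> l; rewrite big_cons.
  rewrite seq_meanD seq_mean_cst// mulrDr; over.
rewrite big_split/= -mulr_suml lmu.2 mul1r; congr (_ + _).
by apply: eq_bigr => a _; rewrite add0r.
Qed.

Definition centered mu : seq (R * B) := [seq (a.1, a.2 - mean mu) | a <- mu].

Lemma law_centered mu : law mu -> law (centered mu).
Proof.
move=> [m0 m1]; split; first by move=> _ /mapP[a am ->]; exact: (m0 a am).
by rewrite big_map.
Qed.

Lemma mean_centered mu : law mu -> mean (centered mu) = 0.
Proof.
move=> [_ m1]; rewrite {1}/mean big_map /=.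
under eq_bigr do rewrite scalerBr.
by rewrite sumrB -scaler_suml m1 scale1r subrr.
Qed.

Lemma conv_centered mu f y : conv (centered mu) f y = conv mu f (y - mean mu).
Proof. by rewrite /conv big_map; apply: eq_bigr => a _ /=; rewrite addrA addrAC. Qed.

Lemma sum_mean_centered mus y :
  sum_mean [seq centered mu | mu <- mus] y = sum_mean mus (y - \sum_(mu <- mus) mean mu).
Proof.
elim: mus y => [|mu mus IH] y; first by rewrite big_nil subr0.
rewrite [LHS]sum_mean_cons sum_mean_cons big_map; apply: eq_bigr => a _ /=.
rewrite IH; congr (_ * sum_mean _ _); rewrite big_cons opprD !addrA.
by rewrite [RHS]addrAC; congr (_ - _); rewrite addrAC.
Qed.

Variable K : R.
Hypothesis K0 : 0 < K.
Hypothesis radK : forall xs : seq B, \sum_(x <- xs) sq x <= K * walk [:: 1; -1] xs sq 0.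

(** The Rademacher inequality is used for each outcome of the variables and then averaged. *)
Lemma centered_cotype mus : (forall mu, mu \in mus -> law mu /\ mean mu = 0) ->
  \sum_(mu <- mus) conv mu sq 0 <= 4 * K * sum_mean mus 0.
Proof.
move=> lm; have lms mu : mu \in mus -> law mu by move=> /lm[].
rewrite -seq_mean_sum_sq//.
apply: (@le_trans _ _ (K * seq_mean mus (fun l => walk [:: 1; -1] l sq 0))).
  by rewrite -seq_meanZ; apply: le_seq_mean => // l; exact: radK.
have := rademacher_le_sum 0 0 lm; rewrite subr0 => h.
have -> : 4 * K * sum_mean mus 0 = K * (4 * sum_mean mus 0) by ring.
by rewrite ler_pM2l//; move: h; lra.
Qed.

(** Nearest points of centered variables need not be centered. The extra terms involve only the
    means and disappear in the limit. *)
Lemma finite_cotype mus : (forall mu, mu \in mus -> law mu) ->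
  \sum_(mu <- mus) conv mu sq 0 <=
  16 * K * sum_mean mus 0 + (16 * K * sq (\sum_(mu <- mus) mean mu) +
    2 * \sum_(mu <- mus) sq (mean mu)).
Proof.
move=> lm; set M := \sum_(mu <- mus) mean mu.
have h1 : \sum_(mu <- mus) conv mu sq 0 <=
    2 * \sum_(mu <- mus) conv (centered mu) sq 0 + 2 * \sum_(mu <- mus) sq (mean mu).
  rewrite !mulr_sumr -big_split/= !big_seq; apply: ler_sum => mu mus0.
  rewrite conv_centered sub0r.
  have := @iter_conv_sqD _ _ _ 1 (mean mu) (- mean mu) (lm mu mus0).
  by rewrite subrr /= addrC.
have h2 : \sum_(mu <- mus) conv (centered mu) sq 0 <= 4 * K * sum_mean mus (- M).
  rewrite -[- M]add0r -sum_mean_centered -(big_map centered xpredT (fun mu => conv mu sq 0)).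
  apply: centered_cotype => _ /mapP[mu mus0 ->].
  by split; [exact/law_centered/lm|exact/mean_centered/lm].
have h3 : sum_mean mus (- M) <= 2 * sq M + 2 * sum_mean mus 0.
  rewrite -[2 * sq M](seq_mean_cst _ lm) -seq_meanZ -seq_meanD.
  by apply: le_seq_mean => // l; rewrite add0r -(sqN M); exact: sqD_le.
have h4 : 4 * K * sum_mean mus (- M) <= 4 * K * (2 * sq M + 2 * sum_mean mus 0).
  by rewrite ler_pM2l// mulr_gt0.
by move: h1 h2 h4; lra.
Qed.

Lemma rademacher_cotype2 : separable_space B -> cotype2_with B (16 * K)^-1.
Proof.
move=> /dense_sequence[e e_dense] n d T P X n1 rX iX EX mX.
have K16 : 0 < 16 * K by rewrite mulr_gt0.
have mE (Y : T -> B) : second_moment P Y = (\int[P]_w (sq (Y w))%:E)%E.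
  by rewrite /second_moment unlock.
have fX i : second_moment P (X i) \is a fin_num.
  rewrite ge0_fin_numE ?mX// mE; apply: integral_ge0 => w _.
  by rewrite lee_fin sq_ge0.
(* A domination for all discretized sums: Cauchy-Schwarz gives the factor n, doubled norms the 4. *)
pose g w := n%:R * \sum_(i < n) 4 * sq (X i w).
have isq i : P.-integrable setT (fun w => (sq (X i w))%:E).
  apply/integrableP; split; first by apply/measurable_EFinP; exact: random_var_sq.
  under eq_integral => w _ do rewrite gee0_abs ?lee_fin ?sq_ge0//.
  by rewrite -mE.
have ig : P.-integrable setT (EFin \o g).
  rewrite (_ : EFin \o g = fun w => (n%:R%:E * \sum_(i < n) (4%:E * (sq (X i w))%:E))%E).
    apply: integrableZl => //; apply: integrable_sum => // i _.
    by apply: integrableZl => //.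
  apply/funext => w /=; rewrite /g EFinM -sumEFin; congr (_ * _)%E.
pose J := index_enum 'I_n; have uJ : uniq J by exact: index_enum_uniq.
pose q : pred B := xpredT.
pose mu k i := grid_law e P X q k i.
have lmu k i : law (mu k i) by apply: grid_law_law.
have nX k i w : sq (nearest e k (X i w)) <= 4 * sq (X i w).
  rewrite /sq (_ : 4 * _ = (2 * `|X i w|) ^+ 2).
    by rewrite ler_pXn2r ?nnegrE ?mulr_ge0// nearest_norm_le.
  by rewrite exprMn -natrX.
have Xk i w : (fun k => nearest e k (X i w)) @ \oo --> X i w.
  by apply: nearest_cvg => eps; exact: e_dense.
have cvgI i : (fun k => conv (mu k i) sq 0) @ \oo --> fine (second_moment P (X i)).
  have [||||fin H] := @grid_mean_cvg _ _ e _ _ P _ X q rX iX (fun _ _ _ => isT)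
    [:: i] (path_fun (fun=> 1) sq 0) _ isT _ (fun w => 4 * sq (X i w)).
  - move=> w; rewrite path_fun1; under eq_fun do rewrite path_fun1.
    rewrite /= !big_seq1 add0r; under eq_fun do rewrite big_seq1 add0r.
    apply: (@continuous_cvg _ _ _ _ _ (fun k => nearest e k (X i w)) sq) => //.
    exact: continuous_sq.
  - by move=> l; apply: path_fun_ge0 => // u; exact: sq_ge0.
  - rewrite (_ : EFin \o _ = fun w => (4%:E * (sq (X i w))%:E)%E); first exact: integrableZl.
    by apply/funext => w /=; rewrite EFinM.
  - by move=> k w; rewrite path_fun1 /= big_seq1 add0r.
  rewrite mE.
  have <- : (\int[P]_w (path_fun (fun=> 1) sq 0 [seq X i w | i <- [:: i]])%:E =
      \int[P]_w (sq (X i w))%:E)%E.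
    by apply: eq_integral => w _; rewrite path_fun1 /= big_seq1 add0r.
  apply: cvg_trans H; apply: near_eq_cvg; apply: nearW => k /=.
  by apply: eq_bigr => a _; rewrite mul1r.
have [||||finS cvgS] := @grid_mean_cvg _ _ e _ _ P _ X q rX iX (fun _ _ _ => isT)
    J (fun l => sq (0 + \sum_(a <- l) a)) _ uJ _ g.
- move=> w; rewrite add0r big_map.
  rewrite (_ : (fun k => _) = (fun k => sq (\sum_(i <- J) nearest e k (X i w)))); last first.
    by apply/funext => k; rewrite add0r big_map.
  apply: (@continuous_cvg _ _ _ _ _ (fun k => \sum_(i <- J) nearest e k (X i w)) sq).
    exact: continuous_sq.
  elim: (J) => [|i s IH].
    by rewrite big_nil; under eq_fun do rewrite big_nil; exact: cvg_cst.
  by rewrite big_cons; under eq_fun do rewrite big_cons; exact: cvgD.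
- by move=> l; exact: sq_ge0.
- exact: ig.
- move=> k w; rewrite add0r big_map.
  have := @sq_sum_le _ _ _ J (fun=> 1) (fun i => nearest e k (X i w)) (fun=> ltr01).
  rewrite sumr_const card_ord => /le_trans; apply.
  rewrite /g ler_wpM2l//; apply: ler_sum => i _.
  by rewrite invr1 mul1r.
have SE : (\int[P]_w (sq (0 + \sum_(a <- [seq X i w | i <- J]) a))%:E =
    second_moment P (fun w => (\sum_(i < n) X i w)%R))%E.
  by rewrite mE; apply: eq_integral => w _; rewrite add0r big_map.
rewrite SE in finS cvgS.
have cvgm i : (fun k => mean (mu k i)) @ \oo --> (0 : B).
  have iXi : (\int[P]_w `|X i w|%:E < +oo)%E.
    apply: (@le_lt_trans _ _ (\int[P]_w (1%:E + (sq (X i w))%:E))%E).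
      apply: ge0_le_integral => //.
      - by apply/measurable_EFinP; exact: random_var_norm.
      - by apply: emeasurable_funD => //; apply/measurable_EFinP; exact: random_var_sq.
      - move=> w _; rewrite -EFinD lee_fin /sq; set t := `|X i w|.
        have t0 : 0 <= t := normr_ge0 _; have := sqr_ge0 (t - 1); clearbody t.
        by rewrite sqrrB1; move: t0; lra.
    rewrite ge0_integralD//; last 2 first.
    - by move=> w _; rewrite lee_fin sq_ge0.
    - by apply/measurable_EFinP; exact: random_var_sq.
    rewrite integral_cst// mul1e [X in (X + _)%E](probability_setT P) -mE.
    by rewrite lte_add_pinfty// ltry.
  have := bochner_expectation_cvg e_dense (rX i) iXi; rewrite EX.
  apply: cvg_trans; apply: near_eq_cvg; apply: nearW => k /=.
  rewrite (@simple_expectation_mean _ _ _ _ P _ (grid e q k)) ?uniq_grid// => w.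
  exact: nearest_grid.
have cvgL : (fun k => \sum_(i <- J) conv (mu k i) sq 0) @ \oo -->
    \sum_(i <- J) fine (second_moment P (X i)).
  elim: (J) => [|i s IH].
    by rewrite big_nil; under eq_fun do rewrite big_nil; exact: cvg_cst.
  rewrite big_cons; under eq_fun do rewrite big_cons; exact: cvgD.
have cvg_mean : (fun k => \sum_(i <- J) mean (mu k i)) @ \oo --> (0 : B).
  elim: (J) => [|i s IH].
    by under eq_fun do rewrite big_nil; exact: cvg_cst.
  have H := cvgD (cvgm i) IH; rewrite addr0 in H.
  by under eq_fun do rewrite big_cons; exact: H.
have sq0 : sq (0 : B) = 0 :> R by rewrite /sq normr0 expr0n.
have cvg_sqmean : (fun k => sq (\sum_(i <- J) mean (mu k i))) @ \oo --> (0 : R).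
  rewrite -sq0; apply: (@continuous_cvg _ _ _ _ _ (fun k => \sum_(i <- J) mean (mu k i)) sq) => //.
  exact: continuous_sq.
have cvg_sqmeans : (fun k => \sum_(i <- J) sq (mean (mu k i))) @ \oo --> (0 : R).
  elim: (J) => [|i s IH].
    by under eq_fun do rewrite big_nil; exact: cvg_cst.
  have H : (fun k => sq (mean (mu k i))) @ \oo --> (0 : R).
    rewrite -sq0; apply: (@continuous_cvg _ _ _ _ _ (fun k => mean (mu k i)) sq) => //.
    exact: continuous_sq.
  have {}H := cvgD H IH; rewrite addr0 in H.
  by under eq_fun do rewrite big_cons; exact: H.
have key : \sum_(i < n) fine (second_moment P (X i)) <=
    16 * K * fine (second_moment P (fun w => (\sum_(i < n) X i w)%R)) + (16 * K * 0 + 2 * 0).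
  have cz (a l : R) (u : nat -> R) : u @ \oo --> l -> (fun k => a * u k) @ \oo --> a * l.
    by move=> h; apply: cvgM => //; exact: cvg_cst.
  have CR : (fun k => 16 * K * sum_mean [seq mu k i | i <- J] 0 +
      (16 * K * sq (\sum_(i <- J) mean (mu k i)) + 2 * \sum_(i <- J) sq (mean (mu k i)))) @ \oo -->
    16 * K * fine (second_moment P (fun w => (\sum_(i < n) X i w)%R)) + (16 * K * 0 + 2 * 0).
    by apply: cvgD; [exact: cz|apply: cvgD; exact: cz].
  apply: (ler_cvg_to cvgL CR).
  apply: nearW => k /=.
  have := @finite_cotype [seq mu k i | i <- J].
  rewrite !big_map; apply => _ /mapP[i _ ->]; exact: lmu.
have -> : (\sum_(i < n) second_moment P (X i))%E = (\sum_(i < n) fine (second_moment P (X i)))%:E.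
  by rewrite -sumEFin; apply: eq_bigr => i _; rewrite fineK.
rewrite -(fineK finS) -EFinM lee_fin mulrC ler_pdivrMr// mulrC.
by move: key; rewrite !mulr0 !addr0.
Qed.

End RademacherSums.

(** * An i.i.d. sequence from the digits of a uniform number *)

Lemma sum_base_digits (R : comNzRingType) (b n : nat) (g : nat -> nat -> R) : (0 < b)%N ->
  \sum_(0 <= k < b ^ n) \prod_(0 <= j < n) g j ((k %/ b ^ (n - j.+1)) %% b)%N =
  \prod_(0 <= j < n) \sum_(0 <= r < b) g j r.
Proof.
move=> b0.
have blocks (F : nat -> R) m : \sum_(0 <= k < m * b) F k =
    \sum_(0 <= k < m) \sum_(0 <= r < b) F (k * b + r)%N.
  elim: m => [|m IH]; first by rewrite mul0n !big_geq.
  rewrite mulSn addnC (big_cat_nat (n := (m * b)%N)) ?leq_addr//= IH [RHS]big_nat_recr//=.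
  congr (_ + _); rewrite -{1}[(m * b)%N]add0n big_addn addKn.
  by apply: eq_bigr => r _; rewrite addnC.
elim: n => [|n IH]; first by rewrite expn0 big_nat1 !big_geq.
rewrite expnSr blocks [RHS]big_nat_recr//= -IH mulr_suml; apply: eq_bigr => k _.
rewrite mulr_sumr; rewrite !big_nat; apply: eq_bigr => r /andP[_ rb].
rewrite big_nat_recr//= subnn expn0 divn1 modnMDl modn_small//; congr (_ * _).
rewrite !big_nat; apply: eq_bigr => j /andP[_ jn]; congr (g j (_ %% b)%N).
have -> : (n.+1 - j.+1 = (n - j.+1).+1)%N by rewrite subSS subnSK.
by rewrite expnS divnMA divnMDl// (divn_small rb) addn0.
Qed.

(** With m a power of b, this recovers a shorter block of leading digits from a longer one. *)
Lemma truncn_divn (R : realType) (x : R) (m : nat) : 0 <= x -> (0 < m)%N ->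
  Num.truncn x = (Num.truncn (x * m%:R) %/ m)%N.
Proof.
move=> x0 m0; have mR : 0 < m%:R :> R by rewrite ltr0n.
have /andP[h1 h2] := truncn_itv x0.
set q := Num.truncn x in h1 h2 *.
have xm0 : 0 <= x * m%:R by rewrite mulr_ge0// ltW.
have a1 : (q * m <= Num.truncn (x * m%:R))%N.
  by rewrite truncn_ge_nat// natrM ler_pM2r.
have a2 : (Num.truncn (x * m%:R) < q.+1 * m)%N.
  by rewrite truncn_lt_nat// natrM ltr_pM2r.
apply/eqP; rewrite eq_sym eqn_leq; apply/andP; split.
  by rewrite -ltnS ltn_divLR.
by rewrite leq_divRL.
Qed.

Section IidDigits.
Context {R : realType} {B : completeNormedModType R}.
Variable vs : seq B.
Hypothesis vs0 : (0 < size vs)%N.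

Let b := size vs.
Let U : probability _ R := uniform_prob (@ltr01 R).

Let bR : 0 < b%:R :> R. Proof. by rewrite ltr0n. Qed.

Definition digit_block (n : nat) (w : R) : nat := Num.truncn (w * b%:R ^+ n).

(** The base-b digits of a uniform point of [0, 1] are independent and uniform. Read as indices into
    [vs], they realize the i.i.d. sequence on which (v) is tested. *)
Definition digit_var (j : nat) (w : measurableTypeR R) : B :=
  nth 0 vs (digit_block j.+1 w %% b).

Let uniform_itv (x y : R) : 0 <= x -> x <= y -> y <= 1 -> (U [set` `[x, y[%R] = (y - x)%:E)%E.
Proof.
move=> x0 xy y1; rewrite /U /= /uniform_prob.
rewrite (eq_integral (fun=> 1%:E)); last first.
  move=> w; rewrite inE /= in_itv /= => /andP[xw wy].
  by rewrite /uniform_pdf (le_trans x0 xw) (le_trans (ltW wy) y1) subr0 invr1.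
rewrite integral_cst//= mul1e lebesgue_measure_itv /= lte_fin.
by case: ltP => // yx; rewrite (le_anti (_ : x <= y <= x)) ?subrr// xy yx.
Qed.

Lemma measurable_digit_block n k : measurable [set w : measurableTypeR R | digit_block n w = k].
Proof.
have bn : 0 < b%:R ^+ n :> R by rewrite exprn_gt0.
(* Block 0 is a half-line, since [Num.truncn] is 0 on negative reals. *)
case: k => [|k].
  rewrite (_ : [set _ | _] = `]-oo, (b%:R ^+ n)^-1[%classic); first exact: measurable_itv.
  apply/seteqP; split=> w; rewrite /= in_itv /= /digit_block -[X in w < X]mul1r ltr_pdivlMr//.
    have [w0|w0] := leP 0 (w * b%:R ^+ n).
      by move=> h; have := truncn_itv w0; rewrite h => /andP[].
    by move=> _; rewrite (lt_trans w0).
  move=> w1; have [w0|w0] := leP 0 (w * b%:R ^+ n); last first.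
    by apply/eqP; rewrite -leqn0 leqNgt truncn_gt_nat -ltNge (lt_trans w0).
  by apply/eqP; rewrite truncn_eq// w0.
rewrite (_ : [set _ | _] = `[k.+1%:R / b%:R ^+ n, k.+2%:R / b%:R ^+ n[%classic).
  exact: measurable_itv.
apply/seteqP; split=> w; rewrite /= in_itv /= /digit_block ltr_pdivlMr// ler_pdivrMr//.
  move=> h; have w0 : 0 <= w * b%:R ^+ n.
    rewrite leNgt; apply/negP => w0; have : (0 < Num.truncn (w * b%:R ^+ n))%N by rewrite h.
    by rewrite truncn_gt_nat leNgt (lt_trans w0 ltr01).
  by have := truncn_itv w0; rewrite h.
move=> /andP[h1 h2]; apply: truncn_def; by rewrite h1.
Qed.

Lemma digit_var_preimage j (A : set B) : measurable (digit_var j @^-1` A).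
Proof.
rewrite (_ : _ @^-1` _ = \bigcup_(k in [set k | A (nth 0 vs (k %% b))])
    [set w | digit_block j.+1 w = k]).
  by apply: bigcup_measurable => k _; exact: measurable_digit_block.
apply/seteqP; split=> w /=; first by move=> h; exists (digit_block j.+1 w).
by move=> [k Ak /= wk]; rewrite /digit_var wk.
Qed.

Lemma random_var_digit j : random_var (digit_var j).
Proof. by move=> _ A mA; rewrite setTI; exact: digit_var_preimage. Qed.

Lemma uniform_block n k : (k < b ^ n)%N ->
  (U [set` `[k%:R / b%:R ^+ n, k.+1%:R / b%:R ^+ n[%R] = (b%:R ^- n)%:E)%E.
Proof.
move=> kn; have bn : 0 < b%:R ^+ n :> R by rewrite exprn_gt0.
rewrite uniform_itv.
- by rewrite -mulrBl -natr1 addrAC subrr add0r mul1r.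
- by rewrite divr_ge0// ltW.
- by rewrite ler_pM2r ?invr_gt0// ler_nat.
- by rewrite ler_pdivrMr// mul1r -natrX ler_nat.
Qed.

(** The unit interval splits into b^n intervals of constant digit block, each of probability b^-n;
    points outside [0, 1) have probability 0 and may behave arbitrarily. *)
Lemma uniform_digits n (S : set (measurableTypeR R)) (good : pred nat) : measurable S ->
  (forall w, 0 <= w < 1 -> S w <-> good (digit_block n w)) ->
  U S = (b%:R ^- n * \sum_(0 <= k < b ^ n) (good k)%:R)%:E.
Proof.
move=> mS Sg; have bn : 0 < b%:R ^+ n :> R by rewrite exprn_gt0.
pose D := [set` `[0, 1[] : set (measurableTypeR R).
pose I k := [set` `[k%:R / b%:R ^+ n, k.+1%:R / b%:R ^+ n[] : set (measurableTypeR R).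
have mD : measurable D by exact: measurable_itv.
have mI k : measurable (I k) by exact: measurable_itv.
have UD : U D = 1%E by rewrite uniform_itv// subr0.
have UDc : U (~` D) = 0%E by rewrite probability_setC// UD subee.
have -> : U S = U (S `&` D).
  have e1 : (U (S `&` D) <= U S)%E by apply: le_measure; rewrite ?inE//; exact: measurableI.
  apply/eqP; rewrite eq_le e1 andbT.
  rewrite -{1}(setUIDK S D); apply: (@le_trans _ _ (U (S `&` D) + U (S `\` D))%E).
    apply: measureU2; [exact: measurableI|exact: measurableD].
  rewrite -[leRHS]adde0 leeD2l// -UDc; apply: le_measure; rewrite ?inE.
  - exact: measurableD.
  - exact: measurableC.
  - by move=> w [].
have -> : U (S `&` D) = (\int[U]_w (\1_(S `&` D) w)%:E)%E.
  by rewrite integral_indic ?setIT//; exact: measurableI.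
have -> : (\int[U]_w (\1_(S `&` D) w)%:E =
   \int[U]_w (\sum_(0 <= k < b ^ n) ((good k)%:R%:E * (\1_(I k) w)%:E))%E)%E.
  apply: eq_integral => w _.
  have [/andP[w0 w1]|wD] := boolP (0 <= w < 1); last first.
    rewrite indicE memNset; last by move=> [_]; rewrite /D /= in_itv /=; apply/negP.
    rewrite big1_seq// => k /andP[_]; rewrite mem_index_iota => /andP[_ kn].
    rewrite indicE memNset ?mule0// /I /= in_itv /= => /andP[k1 k2].
    move/negP: wD; apply; rewrite (le_trans _ k1) ?divr_ge0 ?ler0n ?(ltW bn)//=.
    by rewrite (lt_le_trans k2)// ler_pdivrMr// mul1r -natrX ler_nat.
  have wb0 : 0 <= w * b%:R ^+ n by rewrite mulr_ge0// ltW.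
  have /andP[k1 k2] := truncn_itv wb0; set k0 := digit_block n w.
  have k0n : (k0 < b ^ n)%N.
    by rewrite truncn_lt_nat// natrX -[ltRHS]mul1r ltr_pM2r.
  rewrite (bigD1_seq k0) ?mem_index_iota ?iota_uniq//= big1 ?adde0; last first.
    move=> k kk0; rewrite indicE memNset ?mule0// /I /= in_itv /=.
    rewrite ler_pdivrMr// ltr_pdivlMr// => h; move: kk0.
    by rewrite /k0 /digit_block (truncn_def h) eqxx.
  have -> : \1_(I k0) w = 1 :> R.
    rewrite indicE mem_set// /I /= in_itv /= ler_pdivrMr// ltr_pdivlMr//.
    by rewrite k1 k2.
  rewrite mule1 indicE; have w01 : 0 <= w < 1 by rewrite w0 w1.
  have := Sg w w01; rewrite -/k0; case: (good k0) => Sw.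
    by rewrite mem_set//; split; [apply/Sw|rewrite /D /= in_itv /= w0 w1].
  by rewrite memNset// => -[/Sw].
rewrite ge0_integral_sum//=; last first.
  by move=> k; apply: measurable_funeM; apply/measurable_EFinP; exact: measurable_indic.
rewrite mulr_sumr -sumEFin; rewrite !big_nat; apply: eq_bigr => k /andP[_ kn].
rewrite ge0_integralZl//; last by apply/measurable_EFinP; exact: measurable_indic.
rewrite integral_indic// setIT [X in (_ * X)%E](uniform_block kn) -EFinM.
by rewrite mulrC.
Qed.

Definition list_prob (A : set B) : R :=
  b%:R^-1 * \sum_(0 <= r < b) (nth 0 vs r \in A)%:R.

Lemma list_prob_setT : list_prob setT = 1.
Proof.
rewrite /list_prob (eq_bigr (fun=> 1)) => [|r _]; last by rewrite mem_setT.
by rewrite sumr_const_nat subn0 mulVf// gt_eqF.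
Qed.

Lemma uniform_digit_box n (A : nat -> set B) :
  U (\bigcap_(j in [set j | (j < n)%N]) digit_var j @^-1` A j) =
  (\prod_(0 <= j < n) list_prob (A j))%:E.
Proof.
pose good k := all (fun j => nth 0 vs ((k %/ b ^ (n - j.+1)) %% b) \in A j) (iota 0 n).
rewrite (@uniform_digits n _ good).
- congr (_%:E); rewrite /list_prob big_split/= prodr_const_nat subn0 exprVn; congr (_ * _).
  rewrite -(@sum_base_digits R b n (fun j r => (nth 0 vs r \in A j)%:R))//.
  apply: eq_bigr => k _; rewrite /good /index_iota subn0.
  elim: (iota 0 n) => [|j s IH] /=; first by rewrite big_nil.
  by rewrite big_cons -IH -natrM mulnb.
- by apply: bigcap_measurableType => j _; exact: digit_var_preimage.
move=> w /andP[w0 w1].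
have E j : (j < n)%N -> digit_var j w = nth 0 vs ((digit_block n w %/ b ^ (n - j.+1)) %% b).
  move=> jn; rewrite /digit_var /digit_block; congr (nth 0 vs (_ %% b)%N).
  rewrite (@truncn_divn _ _ (b ^ (n - j.+1)))%N ?expn_gt0 ?vs0//; last first.
    by rewrite mulr_ge0// exprn_ge0.
  by rewrite natrX -mulrA -exprD subnKC.
split=> [H|/allP H].
  by apply/allP => j; rewrite mem_iota add0n => /= jn; rewrite -E// inE; exact: H.
move=> j /= jn; have := H j; rewrite mem_iota add0n => /(_ jn).
by rewrite -E// inE.
Qed.

Lemma digit_var_law j A : U (digit_var j @^-1` A) = (list_prob A)%:E.
Proof.
pose A' i := if i == j then A else setT.
have := uniform_digit_box j.+1 A'.
have A'j : A' j = A by rewrite /A' eqxx.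
rewrite big_nat_recr//= A'j big_nat big1 => [|i /andP[_ ij]]; last first.
  by rewrite /A' ltn_eqF// list_prob_setT.
rewrite mul1r => <-; congr (U _); apply/seteqP; split=> w.
  by move=> Aw i /= _; rewrite /A'; case: eqP => // ->.
by move=> /(_ j (ltnSn j)); rewrite A'j.
Qed.

Lemma digit_var_independent : independent_vars U digit_var.
Proof.
move=> J A uJ bA.
(* Missing indices get the whole space, whose factor is 1, to complete J to an initial segment. *)
pose A' i := if i \in J then A i else setT.
pose n := (\max_(j <- J) j).+1.
have Jn j : j \in J -> (j < n)%N by move=> jJ; rewrite ltnS; exact: leq_bigmax_seq.
have := uniform_digit_box n A'.
have -> : \bigcap_(j in [set j | (j < n)%N]) digit_var j @^-1` A' j =
    \bigcap_(i in [set` J]) digit_var i @^-1` A i.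
  apply/seteqP; split=> w H j /=.
    by move=> jJ; have := H j (Jn j jJ); rewrite /A' jJ.
  by move=> jn; rewrite /A'; case: ifP => // jJ; exact: H.
move=> ->.
under [RHS]eq_bigr do rewrite digit_var_law.
have -> : (\prod_(i <- J) (list_prob (A i))%:E = (\prod_(i <- J) list_prob (A i))%:E)%E.
  by elim: (J) => [|j s IH]; rewrite ?big_nil// !big_cons IH EFinM.
congr (_%:E).
rewrite (eq_bigr (fun j => if j \in J then list_prob (A j) else 1)) => [|j _]; last first.
  by rewrite /A'; case: ifP => // _; exact: list_prob_setT.
rewrite -big_mkcond/= -big_filter; apply: perm_big; apply: uniq_perm => //.
  by rewrite filter_uniq// iota_uniq.
move=> j; rewrite mem_filter mem_index_iota; case: (boolP (j \in J)) => //= jJ.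
exact: Jn.
Qed.

End IidDigits.

(** * From (v) to the central limit bound for lists *)

Section TailExitToCltCotype.
Context {R : realType} {B : completeNormedModType R}.
Variable e : nat -> B.
Hypothesis e_dense : forall x (eps : R), 0 < eps -> exists k, `|x - e k| < eps.
Variable c : R.
Hypotheses (c0 : 0 < c) (tail : tail_exit_limsup_bound B c).
Variable vs : seq B.
Hypotheses (vs0 : (0 < size vs)%N) (sum_vs : \sum_(v <- vs) v = 0).

Let U : probability _ R := uniform_prob (@ltr01 R).
Let X := digit_var (R := R) vs 0.
Let mu := law_of U X (undup vs).

Let rX j : random_var (digit_var (R := R) vs j) := random_var_digit vs0 j.

Let X_mem j w : digit_var (R := R) vs j w \in undup vs.
Proof. by rewrite mem_undup; apply: mem_nth; rewrite ltn_mod. Qed.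

Let X_iid j A : borel A -> U (digit_var vs j @^-1` A) = U (X @^-1` A).
Proof. by move=> _; rewrite !digit_var_law. Qed.

(** The law of X lists distinct values, [unif vs] counts repetitions; this reconciles the two. *)
Lemma sum_digit_law (V : lmodType R) (F : B -> V) :
  \sum_(v <- undup vs) fine (U (X @^-1` [set v])) *: F v =
  (size vs)%:R^-1 *: \sum_(v <- vs) F v.
Proof.
under eq_bigr => v _ do rewrite digit_var_law//= /list_prob -scalerA scaler_suml.
rewrite -scaler_sumr exchange_big/= [in RHS](big_nth 0); congr (_ *: _).
rewrite !big_nat; apply: eq_bigr => r /andP[_ rb].
have rv : nth 0 vs r \in undup vs by rewrite mem_undup mem_nth.
rewrite (bigD1_seq (nth 0 vs r)) ?undup_uniq//= big1 ?addr0.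
  by rewrite mem_set// scale1r.
by move=> v vr; rewrite memNset ?scale0r//= => rv'; rewrite rv' eqxx in vr.
Qed.

Let conv_mu f : conv mu f =1 conv (unif vs) f.
Proof.
move=> y; rewrite conv_unif /conv /mu /law_of big_map /=.
exact: (@sum_digit_law R^o (fun v => f (y + v))).
Qed.

Let iter_mu n f : iter n (conv mu) f =1 iter n (conv (unif vs)) f.
Proof.
elim: n => // n IH y; rewrite !iterS conv_mu; exact: eq_conv.
Qed.

Let law_mu : law mu.
Proof. exact: (law_iid rX X_mem (undup_uniq vs) (digit_var_independent vs0)). Qed.

Let mean_mu : mean mu = 0.
Proof.
by rewrite /mean /mu big_map /= (@sum_digit_law B id) sum_vs scaler0.
Qed.

Lemma digit_copies : independent_copies U X U (digit_var vs).
Proof. by split; [exact: rX|exact: digit_var_independent|exact: X_iid]. Qed.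

Lemma digit_second_moment : second_moment U X = (conv (unif vs) sq 0)%:E.
Proof.
rewrite -conv_mu -(integral_fun1 rX X_mem (undup_uniq vs) (digit_var_independent vs0) X_iid 0).
  by rewrite /second_moment unlock; apply: eq_integral => w _; rewrite add0r.
exact: sq_ge0.
Qed.

(** Every entry has positive probability. If X were almost surely b, all entries would equal b, and
    the vanishing sum would force b = 0. *)
Lemma digit_in_L2_0 : (exists2 v, v \in vs & v != 0) -> in_L2_0 U X.
Proof.
move=> [v0 v0s v0N]; split; [split; first exact: rX| |].
- move=> [b [N [mN N0 sN]]].
  have allb v : v \in vs -> v = b.
    move=> vvs; apply: contrapT => vb.
    have : U (X @^-1` [set v]) = 0%E.
      apply/eqP; rewrite -measure_le0 -N0; apply: le_measure; rewrite ?inE//.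
        exact: digit_var_preimage.
      by move=> w /= Xw; apply: sN => /= Xb; apply: vb; rewrite -Xw Xb.
    rewrite digit_var_law// => -[/eqP]; rewrite mulf_eq0 invr_eq0 pnatr_eq0 gtn_eqF//=.
    have iv : (index v vs < size vs)%N by rewrite index_mem.
    rewrite psumr_eq0 => [|i _]; last by rewrite ler0n.
    move=> /allP /(_ (index v vs)); rewrite mem_index_iota => /(_ iv) /=.
    by rewrite nth_index// mem_set//= oner_eq0.
  have : \sum_(v <- vs) v = b *+ size vs.
    rewrite big_seq (eq_bigr (fun=> b)) => [|v /allb//].
    by rewrite -big_seq big_const_seq count_predT iter_addr_0.
  rewrite sum_vs => /esym/eqP; rewrite -scaler_nat scaler_eq0 pnatr_eq0 gtn_eqF//=.
  by rewrite -(allb _ v0s) (negbTE v0N).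
- by rewrite digit_second_moment ltry.
- by rewrite (bochner_expectation_simple U (rX 0) (undup_uniq vs) (X_mem 0)).
Qed.

Lemma digit_stays r n : U (stays (digit_var vs) r n) = (stay r mu n 0)%:E.
Proof.
have mS := measurable_stays e_dense rX r n.
rewrite /stay -(integral_path_fun rX X_mem (undup_uniq vs) (digit_var_independent vs0) X_iid)//.
have -> : U (stays (digit_var vs) r n) = (\int[U]_w (\1_(stays (digit_var vs) r n) w)%:E)%E.
  by rewrite integral_indic// setIT.
by apply: eq_integral => w _; rewrite -path_of_indic.
Qed.

Lemma clt_cotype_list L : 0 < L ->
  (exists m0 : nat, forall m, (m0 <= m)%N -> iter m (conv (unif vs)) sq 0 <= m%:R * L) ->
  conv (unif vs) sq 0 <= 4 * c * L.
Proof.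
move=> L0 [m0 Hm].
have cL : 0 <= 4 * c * L by rewrite !mulr_ge0// ltW.
(* A list of zeros gives a degenerate variable, outside the scope of (v), but the claim is then
   trivial. *)
have [vz|/existsNP[v0 /not_implyP[v0s /eqP v0N]]] := pselect (forall v, v \in vs -> v = 0).
  rewrite conv_unif /avg big_seq big1 ?mulr0// => v /vz ->.
  by rewrite addr0 /sq normr0 expr0n.
have XL : in_L2_0 U X by apply: digit_in_L2_0; exists v0.
have s2 : 0 < conv (unif vs) sq 0.
  rewrite conv_unif /avg mulr_gt0 ?invr_gt0 ?ltr0n//.
  rewrite lt_neqAle sumr_ge0 ?andbT => [|v _]; last exact: sq_ge0.
  apply/eqP => /esym /eqP; rewrite psumr_eq0 => [|v _]; last exact: sq_ge0.
  move=> /allP /(_ v0 v0s) /=; rewrite add0r /sq sqrf_eq0 normr_eq0.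
  by rewrite (negbTE v0N).
have := tail XL digit_copies; rewrite digit_second_moment /= => H.
(* The limsup is at least 1/(4 L): for n = m and r^2 = 2 m L, a staying probability of at least 1/2
   gives m P / r^2 >= 1/(4 L). *)
suff : (((4 * L)^-1)%:E <= (c / conv (unif vs) sq 0)%:E)%E.
  rewrite lee_fin ler_pdivlMr// mulrC ler_pdivrMr ?mulr_gt0//.
  by rewrite mulrA [c * 4]mulrC.
apply: le_trans H; rewrite limf_esupE; apply: le_ereal_inf_tmp => _ [A [M [Mreal MA]] <-].
(* Large enough for the hypothesis on E|S_m|^2 and for r = sqrt (2 m L) to exceed M. *)
pose m := maxn m0 (maxn 1 (Num.truncn (M ^+ 2 / (2 * L))).+1).
have m1 : (1 <= m)%N by rewrite /m !leq_max leqnn !orbT.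
have mR : 0 < m%:R :> R by rewrite ltr0n.
pose r := Num.sqrt (2 * m%:R * L).
have r2 : r ^+ 2 = 2 * m%:R * L by rewrite sqr_sqrtr// !mulr_ge0// ltW.
have r0 : 0 < r by rewrite sqrtr_gt0 !mulr_gt0.
have Mr : M < r.
  have [M0|M0] := leP M 0; first exact: le_lt_trans M0 r0.
  rewrite -(@ltr_pXn2r _ 2) ?nnegrE ?(ltW M0) ?(ltW r0)// r2.
  rewrite [2 * _]mulrC -mulrA -ltr_pdivrMr ?mulr_gt0//.
  by apply: (lt_le_trans (truncnS_gt _)); rewrite ler_nat /m !leq_max leqnn !orbT.
apply: (@le_trans _ _ ((m%:R / r ^+ 2)%:E *
    U [set w | (m%:R)%:E < exit_time (digit_var vs) r w])%E); last first.
  apply: (@le_trans _ _ (ereal_sup [set ((n%:R / r ^+ 2)%:E *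
       U [set w | (n%:R)%:E < exit_time (digit_var vs) r w])%E | n in [set n | (1 <= n)%N]])).
    by apply: ereal_sup_ubound; exists m.
  by apply: ereal_sup_ubound; exists r => //; exact: MA.
rewrite exit_time_gt digit_stays -EFinM lee_fin r2.
have half : 2^-1 <= stay r mu m 0.
  have := doob_sq m 0 law_mu mean_mu r0; rewrite iter_mu r2 => h.
  have : iter m (conv (unif vs)) sq 0 / (2 * m%:R * L) <= 2^-1.
    rewrite ler_pdivrMr ?mulr_gt0//.
    have -> : 2^-1 * (2 * m%:R * L) = m%:R * L by field.
    by apply: Hm; rewrite /m leq_max leqnn.
  by move: h; set x := _ / _; set y := stay _ _ _ _; lra.
apply: (@le_trans _ _ (m%:R / (2 * m%:R * L) * 2^-1)).
  rewrite le_eqVlt; apply/orP; left; apply/eqP; field.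
  by rewrite !gt_eqF.
by rewrite ler_pM2l// divr_gt0// !mulr_gt0.
Qed.

End TailExitToCltCotype.

(** * Upper limits as r tends to infinity *)

Section LimsupAtInfinity.
Context {R : realType}.
Implicit Types f g : R -> \bar R.

Lemma le_limf_esup_pinfty f g : (forall r, 0 < r -> (f r <= g r)%E) ->
  (limf_esup f (pinfty_nbhs R) <= limf_esup g (pinfty_nbhs R))%E.
Proof.
move=> fg; rewrite !limf_esupE; apply: le_ereal_inf_tmp => _ [V [M [Mr MV]] <-].
pose W := [set r | Num.max 0 M < r].
apply: (@le_trans _ _ (ereal_sup (f @` W))).
  apply: ereal_inf_lbound; exists W => //.
  by exists (Num.max 0 M); split; rewrite ?num_real.
apply: ge_ereal_sup => _ [r + <-]; rewrite /W /= gt_max => /andP[r0 rM].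
apply: (le_trans (fg r r0)); apply: ereal_sup_ubound; exists r => //; exact: MV.
Qed.

Lemma limf_esup_pinfty_le f (l : R) :
  (forall eps, 0 < eps -> exists M : R, forall r, M < r -> (f r <= (l + eps)%:E)%E) ->
  (limf_esup f (pinfty_nbhs R) <= l%:E)%E.
Proof.
move=> H; apply/lee_addgt0Pr => eps eps0; have [M HM] := H eps eps0.
rewrite limf_esupE; apply: (@le_trans _ _ (ereal_sup (f @` [set r | M < r]))).
  apply: ereal_inf_lbound; exists [set r | M < r] => //.
  by exists M; split; rewrite ?num_real.
apply: ge_ereal_sup => _ [r /= Mr <-]; rewrite -EFinD; exact: HM.
Qed.

End LimsupAtInfinity.

(** * Comparison of r^2 h(r) with the second moment *)

Section SecondMomentLimit.
Context {R : realType} {B : completeNormedModType R}.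
Context {d} {T : measurableType d} (P : probability T R) (X : T -> B).
Hypothesis LX : in_L P X.
Let rX : random_var X := LX.1.

Let measurable_sq : measurable_fun [set: T] (fun w => (sq (X w))%:E : \bar R).
Proof. by apply/measurable_EFinP; exact: random_var_sq. Qed.

Lemma second_momentE : second_moment P X = (\int[P]_w (sq (X w))%:E)%E.
Proof. by rewrite /second_moment unlock. Qed.

Lemma second_moment_gt0 : (0 < second_moment P X)%E.
Proof.
rewrite second_momentE lt_neqAle; apply/andP; split; last first.
  by apply: integral_ge0 => w _; rewrite lee_fin sq_ge0.
apply/eqP => I0; apply: LX.2; exists 0.
have A : ae_eq P setT (fun w => (sq (X w))%:E) (cst 0%E).
  apply/ae_eq_integral_abs => //.
  by rewrite [RHS]I0; apply: eq_integral => w _; rewrite gee0_abs// lee_fin sq_ge0.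
apply: filterS A => w /(_ I) [] /eqP.
by rewrite /sq sqrf_eq0 normr_eq0 => /eqP.
Qed.

Lemma sq_trunc_le r r' (x : B) : r <= r' -> sq (trunc r x) <= sq (trunc r' x).
Proof.
move=> rr'; rewrite /trunc; case: (leP `|x| r) => h; first by rewrite (le_trans h rr').
by rewrite {1}/sq normr0 expr0n sq_ge0.
Qed.

(** Monotone convergence along integer radii; monotonicity in r covers the radii in between. *)
Lemma truncated_second_moment (s : R) : (s%:E < second_moment P X)%E ->
  exists2 M, 0 < M & forall r, M <= r -> s <= r ^+ 2 * K_fun P X r.
Proof.
move=> sX.
have cv : ((fun n : nat => \int[P]_w (sq (trunc n%:R (X w)))%:E) @ \oo -->
    second_moment P X)%E.
  rewrite second_momentE.
  have -> : (\int[P]_w (sq (X w))%:E =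
      \int[P]_w limn (fun n : nat => (sq (trunc n%:R (X w)))%:E))%E.
    apply: eq_integral => w _; apply/esym/cvg_lim => //.
    apply: cvg_near_cst; near=> n.
    rewrite /trunc ifT//; near: n; exact: nbhs_infty_ger.
  apply: cvg_monotone_convergence => //.
  - by move=> n; exact: measurable_trunc_sq.
  - by move=> n w _; rewrite lee_fin sq_ge0.
  - by move=> w _ n m nm; rewrite lee_fin sq_trunc_le// ler_nat.
have : \forall n \near \oo, (s%:E < \int[P]_w (sq (trunc n%:R (X w)))%:E)%E.
  exact: (cv _ (open_ereal_gt' sX)).
move=> [N _ HN]; exists N.+1%:R => // r Nr.
have r0 : 0 < r by apply: lt_le_trans Nr.
rewrite -lee_fin -integral_trunc_sq//.
apply: (le_trans (ltW (HN N.+1 (leqnSn _)))).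
apply: ge0_le_integral => //.
- by move=> w _; rewrite lee_fin sq_ge0.
- exact: measurable_trunc_sq.
- exact: measurable_trunc_sq.
- by move=> w _; rewrite lee_fin sq_trunc_le.
Unshelve. all: by end_near. Qed.

Lemma rescaled_h_fun_bound (c eps : R) : 0 < c -> 0 < eps -> (second_moment P X < +oo)%E ->
  exists2 M, 0 < M & forall r, M <= r ->
    c / (r ^+ 2 * h_fun P X r) <= c / fine (second_moment P X) + eps.
Proof.
move=> c0 eps0 fX; have s0 := second_moment_gt0.
set s2 := fine _; have s2E : second_moment P X = s2%:E by rewrite fineK// gt0_fin_numE.
have s20 : 0 < s2 by rewrite -lte_fin -s2E.
have t0 : 0 < c / s2 + eps by rewrite addr_gt0// divr_gt0.
(* This s lies below the second moment and solves c / s = c / s2 + eps. *)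
have [|M M0 HM] := @truncated_second_moment (c / (c / s2 + eps)).
  rewrite s2E lte_fin ltr_pdivrMr// mulrDr mulrCA divff ?gt_eqF// mulr1.
  by rewrite ltrDl mulr_gt0.
exists M => // r Mr; have r0 : 0 < r by apply: lt_le_trans Mr.
have r20 : 0 < r ^+ 2 by rewrite exprn_gt0.
rewrite ler_pdivrMr ?mulr_gt0 ?(h_fun_gt0 rX)// mulrC -ler_pdivrMr//.
by apply: (le_trans (HM r Mr)); rewrite ler_pM2l// K_fun_le_h_fun.
Qed.

End SecondMomentLimit.

(** * The implications between the five statements *)

Section ExitTimeBounds.
Context {R : realType} {B : completeNormedModType R}.
Hypothesis sepB : separable_space B.
Variable c : R.
Hypothesis c0 : 0 < c.

Lemma mean_exit_tail : mean_exit_bound B c -> tail_exit_bound B c.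
Proof.
move=> H d T P X LX d' T' P' Xs copies r n r0 n1; have [rXs _ _] := copies.
have [e e_dense] := dense_sequence sepB.
have nR : 0 < n%:R :> R by rewrite ltr0n.
have mS := measurable_stays e_dense rXs r n.
have := le_trans (markov_exit_time e_dense P' rXs r n) (H _ _ _ _ LX _ _ _ _ copies r r0).
rewrite exit_time_gt -[P' _]fineK ?fin_num_measure// -EFinM !lee_fin.
by rewrite [n%:R * fine _]mulrC -ler_pdivlMr// -mulrA -invfM [h_fun _ _ _ * _]mulrC.
Qed.

Lemma mean_exit_limsup : mean_exit_bound B c -> mean_exit_limsup_bound B c.
Proof.
move=> H d T P X [LX fX _] d' T' P' Xs copies.
apply: limf_esup_pinfty_le => eps eps0.
have [M M0 HM] := rescaled_h_fun_bound LX c0 eps0 fX.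
exists M => r Mr; have r0 := lt_trans M0 Mr.
have r2 : 0 < r ^- 2 by rewrite invr_gt0 exprn_gt0.
apply: (@le_trans _ _ ((r ^- 2)%:E * (c / h_fun P X r)%:E)%E).
  by rewrite lee_pmul2l// ?ltry//; exact: H.
by rewrite -EFinM lee_fin (le_trans _ (HM r (ltW Mr)))// [in leRHS]invfM mulrCA.
Qed.

Lemma tail_exit_limsup : tail_exit_bound B c -> tail_exit_limsup_bound B c.
Proof.
move=> H d T P X [LX fX _] d' T' P' Xs copies.
apply: limf_esup_pinfty_le => eps eps0.
have [M M0 HM] := rescaled_h_fun_bound LX c0 eps0 fX.
exists M => r Mr; have r0 := lt_trans M0 Mr.
have r2 : 0 < r ^+ 2 by rewrite exprn_gt0.
apply: ge_ereal_sup => _ [n /= n1 <-].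
have nR : 0 < n%:R :> R by rewrite ltr0n.
apply: (@le_trans _ _ ((n%:R / r ^+ 2)%:E * (c / (n%:R * h_fun P X r))%:E)%E).
  by rewrite lee_pmul2l ?lte_fin ?divr_gt0//; exact: H.
rewrite -EFinM lee_fin (le_trans _ (HM r (ltW Mr)))// le_eqVlt; apply/orP; left; apply/eqP.
by have h0 := h_fun_gt0 LX.1 LX r0; field; rewrite !gt_eqF.
Qed.

Lemma mean_limsup_tail_limsup : mean_exit_limsup_bound B c -> tail_exit_limsup_bound B c.
Proof.
move=> H d T P X LX d' T' P' Xs copies; have [rXs _ _] := copies.
have [e e_dense] := dense_sequence sepB.
apply: le_trans (H _ _ _ _ LX _ _ _ _ copies).
apply: le_limf_esup_pinfty => r r0.
have r2 : 0 < r ^- 2 by rewrite invr_gt0 exprn_gt0.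
apply: ge_ereal_sup => _ [n /= n1 <-].
rewrite exit_time_gt mulrC EFinM -muleA lee_pmul2l//.
exact: (markov_exit_time e_dense P' rXs r n).
Qed.

(** The constant of [rademacher_cotype2] for K = 256 c tau from [rademacher_cotype]. *)
Definition cotype_constant : R := (16 * (256 * c * (128 * c + 1)))^-1.

Lemma tail_limsup_cotype2 : tail_exit_limsup_bound B c -> cotype2_with B cotype_constant.
Proof.
move=> H; have [e e_dense] := dense_sequence sepB.
apply: rademacher_cotype2 => //; first by rewrite !mulr_gt0// addr_gt0// mulr_gt0.
by move=> xs; apply: rademacher_cotype => // vs L vs0 sum_vs L0;
  exact: (clt_cotype_list e_dense c0 H vs0 sum_vs L0).
Qed.

End ExitTimeBounds.

Theorem theorem3p2 (R : realType) :
  (forall B : completeNormedModType R, separable_space B ->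
    [<-> cotype2 B;
         exists2 c : R, 0 < c & mean_exit_bound B c;
         exists2 c : R, 0 < c & tail_exit_bound B c;
         exists2 c : R, 0 < c & mean_exit_limsup_bound B c;
         exists2 c : R, 0 < c & tail_exit_limsup_bound B c])
  /\
  (exists phi : assertion -> assertion -> R -> R,
    forall (s t : assertion) (c : R), 0 < c ->
      0 < phi s t c /\
      forall B : completeNormedModType R, separable_space B ->
        holds_with s B c -> holds_with t B (phi s t c)).
Proof.
have to_cotype (B : completeNormedModType R) (c : R) : separable_space B -> 0 < c ->
    tail_exit_limsup_bound B c -> cotype2_with B (cotype_constant c).
  by move=> sB c0; exact: tail_limsup_cotype2.
have k0 (c : R) : 0 < c -> 0 < cotype_constant c.
  by move=> c0; rewrite invr_gt0 !mulr_gt0// addr_gt0// mulr_gt0.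
have m0 (c : R) : 0 < c -> 0 < mean_exit_constant c.
  move=> c0; rewrite /mean_exit_constant mulr_gt0// addr_gt0// addr_gt0// mulr_gt0//.
  by rewrite mulr_gt0 ?exprn_gt0// addr_gt0// divr_gt0.
split.
- move=> B sB; tfae.
  + by move=> [c c0 H]; exists (mean_exit_constant c); [exact: m0|exact: cotype2_mean_exit].
  + by move=> [c c0 H]; exists c => //; exact: mean_exit_tail.
  (* A tail bound of order 1/n is not summable and gives no bound on the mean, so (iii) => (iv) goes
     through (v), (i) and (ii). *)
  + move=> [c c0 /(tail_exit_limsup c0) /(to_cotype _ _ sB c0)].
    move=> /(cotype2_mean_exit sB (k0 _ c0)) H.
    exists (mean_exit_constant (cotype_constant c)); first exact/m0/k0.
    by apply: mean_exit_limsup H; exact/m0/k0.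
  + by move=> [c c0 H]; exists c => //; exact: mean_limsup_tail_limsup.
  + by move=> [c c0 H]; exists (cotype_constant c); [exact: k0|exact: to_cotype].
(* Every passage runs through (i): the source fixes a cotype constant, and all targets other than
   (i) share the constant it yields in (ii). *)
pose cot (s : assertion) (c : R) := if s is Cotype2 then c else cotype_constant c.
exists (fun s t c => if t is Cotype2 then cot s c else mean_exit_constant (cot s c)).
move=> s t c c0; have cot0 : 0 < cot s c by case: s; rewrite /= ?k0.
split=> [|B sB Hs]; first by case: t; rewrite ?m0.
have Hc : cotype2_with B (cot s c).
  case: s Hs {cot0} => //= H; apply: to_cotype => //.
  - exact/tail_exit_limsup/mean_exit_tail.
  - exact: tail_exit_limsup.
  - exact: mean_limsup_tail_limsup.
have Hm := cotype2_mean_exit sB cot0 Hc; have mc0 := m0 _ cot0.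
case: t => //=.
- exact: mean_exit_tail.
- exact: mean_exit_limsup.
- exact/tail_exit_limsup/mean_exit_tail.
Qed.
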